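(* Let $\psi$ be a function analytic on the half-plane $\{s\in\mathbb{C}:\operatorname{Re}(s)>1\}$ such that $$\sup_{\operatorname{Re}(s)>1}\int_0^1 |\psi(s+it)|^2\,dt<\infty ,$$ and suppose that $\psi(2)\neq 0$. Define $\psi$ on the line $\operatorname{Re}(s)=1$ by its limit as $\operatorname{Re}(s)\to 1$. Then $$\int_{-\infty}^{\infty}\frac{\log^-|\psi(1+it)|}{1+t^2}\,dt\;\le\;\int_{-\infty}^{\infty}\frac{\log^+|\psi(1+it)|}{1+t^2}\,dt-\pi\log|\psi(2)|.$$
   Context: For $x\ge 0$: $\log^+ x=\max(0,\log x)$ and $\log^- x=\max(0,-\log x)$ (so both are nonnegative, with $\log^+0=0$ and $\log^- 0=+\infty$). The boundary value $\psi(1+it)$ is $\lim_{\sigma\to1^+}\psi(\sigma+it)$, for almost every real $t$. *)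

(* Defs.v *)
From HB Require Import structures.
From mathcomp Require Import all_boot all_order all_algebra.
From mathcomp Require Import complex.
From mathcomp Require Import all_classical all_reals all_analysis.

Set Implicit Arguments.
Unset Strict Implicit.
Unset Printing Implicit Defensive.

Import Order.TTheory GRing.Theory Num.Theory.
Import numFieldNormedType.Exports.

Local Open Scope classical_set_scope.
Local Open Scope ring_scope.
Local Open Scope complex_scope.

(* Complex derivability: [R[i]^o] is [R[i]] as a normed space over itself, so
   the difference quotient has a complex increment and a complex limit. *)
Definition holomorphic_on (R : realType) (U : set R[i]) (f : R[i] -> R[i]) :
    Prop :=
  forall z, U z -> derivable (f : R[i]^o -> R[i]^o) z 1.

(* On nonnegative arguments; extended-real valued, as [lne 0 = -oo]. *)
Definition logp (R : realType) (x : R) : \bar R := maxe 0%E (lne x%:E).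
Definition logm (R : realType) (x : R) : \bar R := maxe 0%E (- lne x%:E)%E.

(* [lim] is total: [boundary_value f t] is meaningful only for those [t] with
   [has_boundary_value f t]. *)
Definition has_boundary_value (R : realType) (f : R[i] -> R[i]) (t : R) : Prop :=
  cvg ((f (sigma +i* t) : R[i]^o) @[sigma --> (1 : R)^'+]).

Definition boundary_value (R : realType) (f : R[i] -> R[i]) (t : R) : R[i] :=
  lim ((f (sigma +i* t) : R[i]^o) @[sigma --> (1 : R)^'+]).

(* Main.v *)
Require Import Defs.
From HB Require Import structures.
From mathcomp Require Import all_boot all_order all_algebra.
From mathcomp Require Import complex.
From mathcomp Require Import all_classical all_reals all_analysis.
From mathcomp Require Import measurable_realfun.
From mathcomp Require Import ring lra.

(** The function [log |f|] is subharmonic when [f] is holomorphic, and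
    [dt / (pi * (1 + t ^+ 2))] is the harmonic measure of the half-plane
    [Re > 1] seen from [2]. Hence Jensen's inequality
    [pi * ln |f 2| <= \int ln |f (1 +i* t)| / (1 + t ^+ 2) dt] for bounded [f]
    ([jensen_bounded]). It applies to the shifts [f w = psi (w + e)], which are
    bounded, and [e] tends to [0] in [log_mean_limit]: Fatou's lemma takes care
    of the negative part of the logarithm, while the positive part is truncated
    at a height [K], the hypothesis on mean squares making the truncation error
    small uniformly in [e].

    Both this and the existence of boundary values rest on one estimate,
    [poisson_sqr_bound]: up to a factor [6], [|H z| ^+ 2] is at most the Poisson
    mean of [|H| ^+ 2] over a vertical line to the left of [z]. Normalize
    [H z = 1]. With [zs] the mirror image of [z] in the line, the function
    [(H w - 1) ^+ 2 / ((w - z) * (w - zs))] is differentiable even at [z], because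
    of the square, and its integral over vertical lines to the right of [zs] is
    constant ([line_shift], from
    Goursat's theorem by bisection) and tends to [0]; on the given line the
    denominator is minus the denominator of the Poisson kernel. So the Poisson
    mean of [Re ((H - 1) ^+ 2)] is [0], which forbids [H] to be small on most of
    the line.

    Boundary values ([ae_has_boundary_value]). The quotient [g w = psi w / w] is
    square integrable on vertical lines. The integral over vertical lines of [g]
    times its reflection is constant, which makes the traces of [g] on the lines
    [Re = x] a Cauchy family in mean square as [x] tends to [1]. The estimate
    above, applied to differences of shifts of [g], and the Hardy-Littlewood
    maximal inequality upgrade this to convergence at almost every height, by
    the Borel-Cantelli lemma.

    Jensen's inequality. In the coordinate [t = tan phi] of the edge, the
    rotations of the half-plane about [2] are the translations of [phi]. The
    product of [N] copies of [f] rotated by multiples of [pi / N] has the value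
    [f 2 ^+ N] at [2], and the logarithm of its modulus on the edge is [N / pi]
    times a Riemann sum of the logarithmic integral of [f]. Apply the estimate
    to the product, take logarithms and divide by [N]: the factor [6] disappears
    in the limit. *)

Set Implicit Arguments.
Unset Strict Implicit.
Unset Printing Implicit Defensive.

Import Order.TTheory GRing.Theory Num.Theory.
Import numFieldNormedType.Exports.

Local Open Scope classical_set_scope.
Local Open Scope ring_scope.
Local Open Scope complex_scope.

(** * Induction on rectangles *)

Lemma exists_halving_lt (R : realType) (x r : R) : 0 < r ->
  exists n, x / 2 ^+ n < r.
Proof.
move=> r0; exists (Num.bound `|x / r|).
rewrite ltr_pdivrMr ?exprn_gt0// mulrC -ltr_pdivrMr//.
apply: le_lt_trans (ler_norm _) _; apply: lt_le_trans (archi_boundP _) _ => //.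
rewrite -natrX ler_nat; apply: ltnW; exact: ltn_expl.
Qed.

(** Compactness of a rectangle in the form in which Goursat's argument uses it:
    a property that is inherited from the four quarters and that holds on all
    sufficiently small rectangles around each point holds on the whole
    rectangle. Otherwise quarter the rectangle for ever, keeping a bad quarter;
    the bad rectangles shrink to a point, near which there are none. A segment
    is the case [c0 = d0]. *)
Lemma rectangle_induction (R : realType) (P : R -> R -> R -> R -> Prop)
  (a0 b0 c0 d0 : R) : a0 <= b0 -> c0 <= d0 ->
  (forall a b c d, a0 <= a -> a <= b -> b <= b0 -> c0 <= c -> c <= d -> d <= d0 ->
    let m := (a + b) / 2 in let n := (c + d) / 2 in
    P a m c n -> P m b c n -> P a m n d -> P m b n d -> P a b c d) ->
  (forall x y, a0 <= x <= b0 -> c0 <= y <= d0 -> exists2 r, 0 < r &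
    forall a b c d, a0 <= a -> b <= b0 -> c0 <= c -> d <= d0 ->
      a <= x <= b -> c <= y <= d -> b - a < r -> d - c < r -> P a b c d) ->
  P a0 b0 c0 d0.
Proof.
move=> ab0 cd0 Psplit Ploc; apply: contrapT => nP0.
pose T := (R * R * R * R)%type.
pose A (s : T) := s.1.1.1; pose B (s : T) := s.1.1.2.
pose C (s : T) := s.1.2; pose D (s : T) := s.2.
pose ok (s : T) := [/\ a0 <= A s <= B s, B s <= b0, c0 <= C s <= D s, D s <= d0
  & ~ P (A s) (B s) (C s) (D s)].
pose child (s t : T) := [/\ A s <= A t, B t <= B s, C s <= C t & D t <= D s]
  /\ (B t - A t = (B s - A s) / 2 /\ D t - C t = (D s - C s) / 2).
have step (s : T) : {t | ok s -> ok t /\ child s t}.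
  apply: cid; case: (pselect (ok s)) => [oks|]; last by exists s.
  case: s oks => [[[a b] c] d]; rewrite /ok /child /A /B /C /D /=.
  move=> [/andP[a0a ab] bb0 /andP[c0c cd] dd0 nP].
  pose m := (a + b) / 2; pose n := (c + d) / 2.
  have am : a <= m by rewrite /m; lra.
  have mb : m <= b by rewrite /m; lra.
  have cn : c <= n by rewrite /n; lra.
  have nd : n <= d by rewrite /n; lra.
  have am0 : a0 <= m by lra.
  have mb0 : m <= b0 by lra.
  have cn0 : c0 <= n by lra.
  have nd0 : n <= d0 by lra.
  case: (pselect (P a m c n)) => [P1|nP1]; last first.
    by exists (a, m, c, n) => _; split; [split=> //=; apply/andP|
      split; split=> //=; rewrite ?/m ?/n; lra].
  case: (pselect (P m b c n)) => [P2|nP2]; last first.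
    by exists (m, b, c, n) => _; split; [split=> //=; apply/andP|
      split; split=> //=; rewrite ?/m ?/n; lra].
  case: (pselect (P a m n d)) => [P3|nP3]; last first.
    by exists (a, m, n, d) => _; split; [split=> //=; apply/andP|
      split; split=> //=; rewrite ?/m ?/n; lra].
  case: (pselect (P m b n d)) => [P4|nP4]; last first.
    by exists (m, b, n, d) => _; split; [split=> //=; apply/andP|
      split; split=> //=; rewrite ?/m ?/n; lra].
  by case: nP; apply: Psplit.
have [s [s0 sS]] := dependent_choice step (a0, b0, c0, d0).
have oks n : ok (s n).
  elim: n => [|n /sS[]//]; rewrite s0; split=> //=; exact/andP.
have chs n : child (s n) (s n.+1) by have [] := sS n (oks n).
have mono m n : (m <= n)%N -> [/\ A (s m) <= A (s n), B (s n) <= B (s m),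
    C (s m) <= C (s n) & D (s n) <= D (s m)].
  move=> /subnK <-; elim: (n - m)%N => [|k [h1 h2 h3 h4]]; first by split.
  have [[g1 g2 g3 g4] _] := chs (k + m)%N.
  by rewrite addSn; split; [apply: le_trans g1|apply: le_trans h2|
     apply: le_trans g3|apply: le_trans h4].
have size n : B (s n) - A (s n) = (b0 - a0) / 2 ^+ n
     /\ D (s n) - C (s n) = (d0 - c0) / 2 ^+ n.
  elim: n => [|n [h1 h2]]; first by rewrite s0 expr0 !divr1.
  have [_ [-> ->]] := chs n; rewrite h1 h2 exprSr.
  by split; field; rewrite expf_neq0.
have AB m n : A (s m) <= B (s n).
  have [h _ _ _] := mono _ _ (leq_maxl m n).
  have [_ g _ _] := mono _ _ (leq_maxr m n).
  have [/andP[_ i] _ _ _ _] := oks (maxn m n).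
  exact: le_trans h (le_trans i g).
have CD m n : C (s m) <= D (s n).
  have [_ _ h _] := mono _ _ (leq_maxl m n).
  have [_ _ _ g] := mono _ _ (leq_maxr m n).
  have [_ _ /andP[_ i] _ _] := oks (maxn m n).
  exact: le_trans h (le_trans i g).
pose x := sup (range (A \o s)); pose y := sup (range (C \o s)).
have supA : has_sup (range (A \o s)).
  by split; [exists (A (s 0%N)); exists 0%N|exists (B (s 0%N)) => _ [n _ <-]; exact: AB].
have supC : has_sup (range (C \o s)).
  by split; [exists (C (s 0%N)); exists 0%N|exists (D (s 0%N)) => _ [n _ <-]; exact: CD].
have Ax n : A (s n) <= x by apply: sup_upper_bound => //; exists n.
have Cy n : C (s n) <= y by apply: sup_upper_bound => //; exists n.
have xB n : x <= B (s n).
  by apply: ge_sup; [exists (A (s 0%N)); exists 0%N|move=> _ [m _ <-]; exact: AB].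
have yD n : y <= D (s n).
  by apply: ge_sup; [exists (C (s 0%N)); exists 0%N|move=> _ [m _ <-]; exact: CD].
have xab : a0 <= x <= b0.
  by have := Ax 0%N; have := xB 0%N; rewrite s0 /A /B /= => -> ->.
have ycd : c0 <= y <= d0.
  by have := Cy 0%N; have := yD 0%N; rewrite s0 /C /D /= => -> ->.
have [r r0 Pr] := Ploc x y xab ycd.
have [n nr] := exists_halving_lt (b0 - a0 + (d0 - c0)) r0.
have [/andP[h1 h2] h3 /andP[h4 h5] h6 nP] := oks n.
apply: nP; have [e1 e2] := size n.
have q1 : 0 <= (b0 - a0) / 2 ^+ n by rewrite divr_ge0 ?exprn_ge0// subr_ge0.
have q2 : 0 <= (d0 - c0) / 2 ^+ n by rewrite divr_ge0 ?exprn_ge0// subr_ge0.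
move: nr; rewrite mulrDl => nr.
by apply: Pr => //; rewrite ?Ax ?xB ?Cy ?yD//; lra.
Qed.

(** * Closed real one-forms have no integral around rectangles *)

Section segments.
Context {R : realType}.
Notation mu := (@lebesgue_measure R).
Implicit Types f g : R -> R.

Definition seg f a b : R := \int[mu]_(x in `[a, b]) f x.

Lemma continuous_seg_integrable f (lo hi a b : R) : lo < a -> b < hi ->
  {in `]lo, hi[, continuous f} -> mu.-integrable `[a, b] (EFin \o f).
Proof.
move=> loa bhi cf; apply: continuous_compact_integrable.
  exact: segment_compact.
apply: continuous_subspace_itv => x /[!in_itv]/= /andP[ax xb].
by apply: cf; rewrite in_itv/= (lt_le_trans loa ax) (le_lt_trans xb bhi).
Qed.

Lemma seg_split f a m b : a <= m -> m <= b ->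
  mu.-integrable `[a, b] (EFin \o f) ->
  seg f a b = seg f a m + seg f m b.
Proof.
move=> am mb fi; have := @Rintegral_itvB _ f (BLeft a) (BRight b) m fi.
rewrite !bnd_simp => /(_ am mb) /eqP; rewrite subr_eq addrC => /eqP e.
rewrite /seg e; congr (_ + _); apply: Rintegral_itv_obnd_cbnd.
apply: integrableS fi => //; apply: subset_itv; rewrite bnd_simp//.
Qed.

Lemma seg_cst (k a b : R) : a <= b -> seg (fun=> k) a b = k * (b - a).
Proof.
move=> ab; rewrite /seg Rintegral_cst//= lebesgue_measure_itv/= lte_fin.
by case: ltgtP ab => //= -> _; rewrite subrr.
Qed.

Lemma cst_seg_integrable (k a b : R) : mu.-integrable `[a, b] (EFin \o (fun=> k)).
Proof.
apply: continuous_compact_integrable; first exact: segment_compact.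
by apply: continuous_subspaceT => x; exact: cst_continuous.
Qed.

Lemma segB f g a b : mu.-integrable `[a, b] (EFin \o f) ->
  mu.-integrable `[a, b] (EFin \o g) ->
  seg (fun x => f x - g x) a b = seg f a b - seg g a b.
Proof. by move=> fi gi; rewrite /seg RintegralB. Qed.

Lemma seg_near f (k e a b : R) : a <= b -> mu.-integrable `[a, b] (EFin \o f) ->
  (forall x, a <= x <= b -> `|f x - k| <= e) ->
  `|seg f a b - k * (b - a)| <= e * (b - a).
Proof.
move=> ab fi fke; rewrite -!seg_cst// -segB//; last exact: cst_seg_integrable.
have fki : mu.-integrable `[a, b] (EFin \o (fun x => f x - k)).
  by apply: (@integrableB _ _ _ mu `[a, b] _ _ _ fi (cst_seg_integrable k a b)).
apply: le_trans (le_normr_Rintegral _ fki) _ => //.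
apply: le_Rintegral => //; last exact: cst_seg_integrable.
exact: (integrable_norm fki).
Qed.

End segments.

Section goursat.
Context {R : realType}.
Notation mu := (@lebesgue_measure R).
Variables (p q : R -> R -> R) (lo hi : R).

Definition rect_integral a b c d : R :=
  seg (p^~ c) a b - seg (p^~ d) a b + seg (q b) c d - seg (q a) c d.

Hypothesis cp : forall y, {in `]lo, hi[, continuous (p^~ y)}.
Hypothesis cq : forall x, x \in `]lo, hi[ -> continuous (q x).
Hypothesis dpq : forall x y, x \in `]lo, hi[ -> exists p1 k q2 : R,
  forall e : R, 0 < e -> exists2 r : R, 0 < r & forall x' y',
  `|x' - x| < r -> `|y' - y| < r ->
  `|p x' y' - p x y - (p1 * (x' - x) + k * (y' - y))| <= e * (`|x' - x| + `|y' - y|)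
  /\
  `|q x' y' - q x y - (k * (x' - x) + q2 * (y' - y))| <= e * (`|x' - x| + `|y' - y|).

Let pint y a b : lo < a -> b < hi -> mu.-integrable `[a, b] (EFin \o (p^~ y)).
Proof. by move=> h1 h2; exact: (continuous_seg_integrable h1 h2 (@cp y)). Qed.

Let qint x c d : x \in `]lo, hi[ -> mu.-integrable `[c, d] (EFin \o (q x)).
Proof.
move=> xi; apply: (@continuous_seg_integrable _ _ (c - 1) (d + 1)).
- by rewrite ltrBlDr ltrDl.
- by rewrite ltrDl.
- by move=> y _; exact: cq.
Qed.

(** Goursat's argument. Near a point the form [p dx + q dy] is the sum of a form
    with a symmetric linear part, whose integral around a rectangle vanishes,
    and of an error [e * L] on a contour of length of order [L]; so the
    integral around a small rectangle is at most [e * L ^+ 2]. That bound is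
    inherited from quarters, hence holds globally, for every [e]. *)
Lemma closed_form_rect_integral a b c d : lo < a -> a <= b -> b < hi -> c <= d ->
  rect_integral a b c d = 0.
Proof.
move=> loa ab bhi cd.
suff small e : 0 < e -> `|rect_integral a b c d| <= e * ((b - a) + (d - c)) ^+ 2.
  apply/eqP; rewrite -normr_le0; apply/ler_addgt0Pl => e e0; rewrite addr0.
  pose L := ((b - a) + (d - c)) ^+ 2.
  have L0 : 0 <= L by exact: sqr_ge0.
  have L1 : 0 < L + 1 by rewrite ltr_wpDl.
  apply: le_trans (small (e / (L + 1)) (divr_gt0 e0 L1)) _.
  by rewrite -/L mulrAC ler_pdivrMr// ler_pM2l// lerDl.
move=> e0; apply: (rectangle_induction (P := fun a b c d =>
  `|rect_integral a b c d| <= e * ((b - a) + (d - c)) ^+ 2) ab cd).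
- move=> a1 b1 c1 d1 aa1 ab1 bb1 cc1 cd1 dd1 m n.
  have am : a1 <= m by rewrite /m; lra.
  have mb : m <= b1 by rewrite /m; lra.
  have cn : c1 <= n by rewrite /n; lra.
  have nd : n <= d1 by rewrite /n; lra.
  have hh : e * ((b1 - a1) + (d1 - c1)) ^+ 2 =
    e * ((m - a1) + (n - c1)) ^+ 2 + e * ((b1 - m) + (n - c1)) ^+ 2 +
    e * ((m - a1) + (d1 - n)) ^+ 2 + e * ((b1 - m) + (d1 - n)) ^+ 2.
    by rewrite /m /n; field.
  have I : rect_integral a1 b1 c1 d1 = rect_integral a1 m c1 n +
     rect_integral m b1 c1 n + rect_integral a1 m n d1 + rect_integral m b1 n d1.
    rewrite /rect_integral.
    rewrite (seg_split (f := p^~ c1) am mb) ?(seg_split (f := p^~ d1) am mb);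
      [|apply: pint; lra|apply: pint; lra].
    rewrite (seg_split (f := q b1) cn nd) ?(seg_split (f := q a1) cn nd);
      [|apply: qint; rewrite in_itv/=; lra|apply: qint; rewrite in_itv/=; lra].
    by ring.
  move=> h1 h2 h3 h4; rewrite I hh.
  by do 3 (apply: le_trans (ler_normD _ _) _; apply: lerD => //).
- move=> x y xab ycd.
  have xi : x \in `]lo, hi[ by rewrite in_itv/=; lra.
  have [p1 [k [q2 H]]] := dpq y xi.
  have e20 : 0 < e / 2 by rewrite divr_gt0.
  have [r r0 {}H] := H _ e20; exists r => // a1 b1 c1 d1 aa1 bb1 cc1 dd1 x1 y1 br dr.
  have ab1 : a1 <= b1 by lra.
  have cd1 : c1 <= d1 by lra.
  set L := (b1 - a1) + (d1 - c1).
  have H1 : `|seg (p^~ c1) a1 b1 - seg (p^~ d1) a1 b1 - (- k * (d1 - c1)) * (b1 - a1)|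
      <= (e * L) * (b1 - a1).
    rewrite -segB; [|apply: pint; lra|apply: pint; lra].
    apply: seg_near => //.
      by apply: (@integrableB _ _ _ mu `[a1, b1] _ (EFin \o (p^~ c1)) (EFin \o (p^~ d1)));
        [|apply: pint; lra|apply: pint; lra].
    move=> t t1.
    have [||C _] := H t c1; [by rewrite ltr_norml; lra|by rewrite ltr_norml; lra|].
    have [||D _] := H t d1; [by rewrite ltr_norml; lra|by rewrite ltr_norml; lra|].
    rewrite (_ : p t c1 - p t d1 - - k * (d1 - c1) =
      (p t c1 - p x y - (p1 * (t - x) + k * (c1 - y))) -
      (p t d1 - p x y - (p1 * (t - x) + k * (d1 - y)))); last by ring.
    apply: le_trans (ler_normB _ _) _.
    apply: le_trans (lerD C D) _.
    rewrite -mulrDr (_ : e * L = e / 2 * (L + L)); last by field.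
    rewrite ler_pM2l//.
    have T : `|t - x| <= b1 - a1 by rewrite ler_norml; lra.
    have T2 : `|c1 - y| + `|d1 - y| = d1 - c1.
      by rewrite ler0_norm ?ger0_norm; lra.
    by rewrite /L; lra.
  have H2 : `|seg (q b1) c1 d1 - seg (q a1) c1 d1 - (k * (b1 - a1)) * (d1 - c1)|
      <= (e * L) * (d1 - c1).
    rewrite -segB; [|apply: qint; rewrite in_itv/=; lra|apply: qint; rewrite in_itv/=; lra].
    apply: seg_near => //.
      by apply: (@integrableB _ _ _ mu `[c1, d1] _ (EFin \o (q b1)) (EFin \o (q a1)));
       [|apply: qint; rewrite in_itv/=; lra|apply: qint; rewrite in_itv/=; lra].
    move=> t t1.
    have [||_ C] := H b1 t; [by rewrite ltr_norml; lra|by rewrite ltr_norml; lra|].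
    have [||_ D] := H a1 t; [by rewrite ltr_norml; lra|by rewrite ltr_norml; lra|].
    rewrite (_ : q b1 t - q a1 t - k * (b1 - a1) =
      (q b1 t - q x y - (k * (b1 - x) + q2 * (t - y))) -
      (q a1 t - q x y - (k * (a1 - x) + q2 * (t - y)))); last by ring.
    apply: le_trans (ler_normB _ _) _.
    apply: le_trans (lerD C D) _.
    rewrite -mulrDr (_ : e * L = e / 2 * (L + L)); last by field.
    rewrite ler_pM2l//.
    have T : `|t - y| <= d1 - c1 by rewrite ler_norml; lra.
    have T2 : `|a1 - x| + `|b1 - x| = b1 - a1.
      by rewrite ler0_norm ?ger0_norm; lra.
    by rewrite /L; lra.
  rewrite (_ : rect_integral a1 b1 c1 d1 =
    (seg (p^~ c1) a1 b1 - seg (p^~ d1) a1 b1 - (- k * (d1 - c1)) * (b1 - a1)) +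
    (seg (q b1) c1 d1 - seg (q a1) c1 d1 - (k * (b1 - a1)) * (d1 - c1))); last first.
    by rewrite /rect_integral; ring.
  apply: le_trans (ler_normD _ _) _; apply: le_trans (lerD H1 H2) _.
  by rewrite -mulrDr expr2 mulrA.
Qed.

End goursat.

(** * Complex derivatives *)

Section complex_basics.
Context {R : realType}.
Notation C := (R[i]^o).
Implicit Types (f g : R[i] -> R[i]) (z w : R[i]).

Lemma normc_sqr z : Normc.normc z ^+ 2 = complex.Re z ^+ 2 + complex.Im z ^+ 2.
Proof. by case: z => a b /=; rewrite sqr_sqrtr// addr_ge0// sqr_ge0. Qed.

Lemma normc_ge0 z : 0 <= Normc.normc z.
Proof. by case: z => a b /=; rewrite sqrtr_ge0. Qed.

Lemma normc_gt0 z : (0 < Normc.normc z) = (z != 0).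
Proof.
rewrite lt_def normc_ge0 andbT; congr negb.
by apply/eqP/eqP => [/Normc.eq0_normc|->//]; rewrite ?Normc.normc0.
Qed.

Lemma Re_add z w : complex.Re (z + w) = complex.Re z + complex.Re w.
Proof. by case: z w => ? ? [? ?]. Qed.
Lemma Im_add z w : complex.Im (z + w) = complex.Im z + complex.Im w.
Proof. by case: z w => ? ? [? ?]. Qed.
Lemma Re_opp z : complex.Re (- z) = - complex.Re z.
Proof. by case: z. Qed.
Lemma Im_opp z : complex.Im (- z) = - complex.Im z.
Proof. by case: z. Qed.
Lemma Re_mul z w : complex.Re (z * w) =
  complex.Re z * complex.Re w - complex.Im z * complex.Im w.
Proof. by case: z w => ? ? [? ?]. Qed.
Lemma Im_mul z w : complex.Im (z * w) =
  complex.Re z * complex.Im w + complex.Im z * complex.Re w.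
Proof. by case: z w => ? ? [? ?]. Qed.

Lemma Re_le_normc z : `|complex.Re z| <= Normc.normc z.
Proof.
rewrite -(ler_pXn2r (n := 2))// ?nnegrE ?normc_ge0// normc_sqr real_normK ?num_real//.
by rewrite lerDl sqr_ge0.
Qed.

Lemma Im_le_normc z : `|complex.Im z| <= Normc.normc z.
Proof.
rewrite -(ler_pXn2r (n := 2))// ?nnegrE ?normc_ge0// normc_sqr real_normK ?num_real//.
by rewrite lerDr sqr_ge0.
Qed.

Lemma normc_le_ReIm z : Normc.normc z <= `|complex.Re z| + `|complex.Im z|.
Proof.
rewrite -(ler_pXn2r (n := 2))// ?nnegrE ?normc_ge0 ?addr_ge0// normc_sqr.
rewrite sqrrD !real_normK ?num_real// -addrA [X in _ <= _ + X]addrC addrA lerDl.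
by rewrite mulrn_wge0// mulr_ge0.
Qed.

Lemma normcD z w : Normc.normc (z + w) <= Normc.normc z + Normc.normc w.
Proof. exact: le_normcD. Qed.

Lemma normcB z w : Normc.normc (z - w) = Normc.normc (w - z).
Proof. by rewrite -normcN opprB. Qed.

Lemma normc_real (x : R) : Normc.normc (x%:C) = `|x|.
Proof. by rewrite /Normc.normc /= expr0n addr0 sqrtr_sqr. Qed.

Lemma eps_complex (e : R[i]) : 0 < e -> exists2 r : R, 0 < r & e = r%:C.
Proof.
by case: e => a b; rewrite ltcE/= => /andP[/eqP-> a0]; exists a.
Qed.

Lemma near_normcP (P : set C) (z : C) :
  (\forall w \near z, P w) <->
  exists2 r : R, 0 < r & forall w : R[i], Normc.normc (w - z) < r -> P w.
Proof.
split=> [/nbhs_ballP[e /= /eps_complex[r r0 ->] eP]|[r r0 rP]].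
  exists r => // w wz; apply: eP; rewrite -ball_normE/= distrC.
  by rewrite (_ : `|w - z| = (Normc.normc (w - z))%:C)// ltcR.
apply/nbhs_ballP; exists r%:C => /=; first by rewrite ltcR.
move=> w; rewrite -ball_normE/= distrC => wz; apply: rP.
by rewrite -ltcR.
Qed.

Lemma near_all (P : set C) (z : C) : (forall w, P w) -> \forall w \near z, P w.
Proof. by move=> PT; apply/near_normcP; exists 1. Qed.

(** Continuity is boxed so that unification never unfolds it into filters on
    [R[i]]; [ccontP] is the form with real radii. *)
Variant ccont f z : Prop := CCont of {for z, continuous (f : C -> C)}.

Lemma ccontP f z : ccont f z <-> forall e : R, 0 < e ->
  exists2 r : R, 0 < r & forall w, Normc.normc (w - z) < r ->
    Normc.normc (f w - f z) < e.
Proof.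
split=> [[/(@cvgrPdist_lt _ C _ (nbhs (z : C)) (nbhs_filter _)) H] e e0|H].
  have := H e%:C; rewrite ltcR => /(_ e0)/near_normcP[r r0 rP].
  by exists r => // w /rP; rewrite -ltcR distrC.
split; apply/(@cvgrPdist_lt _ C _ (nbhs (z : C)) (nbhs_filter _)) => _ /eps_complex[e e0 ->].
apply/near_normcP.
by have [r r0 rP] := H e e0; exists r => // w /rP; rewrite -ltcR distrC.
Qed.

Lemma ccont_cst k z : ccont (fun=> k) z.
Proof. by split; exact: cst_continuous. Qed.

Lemma ccont_id z : ccont id z.
Proof. by split. Qed.

Lemma ccontD f g z : ccont f z -> ccont g z -> ccont (fun w => f w + g w) z.
Proof. by move=> [cf] [cg]; split; exact: (@continuousD _ C C f g z cf cg). Qed.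

Lemma ccontN f z : ccont f z -> ccont (fun w => - f w) z.
Proof. by move=> [cf]; split; exact: (@continuousN _ C C f z cf). Qed.

Lemma ccontM f g z : ccont f z -> ccont g z -> ccont (fun w => f w * g w) z.
Proof. by move=> [cf] [cg]; split; exact: (@continuousM _ C f g z cf cg). Qed.

Lemma ccontV f z : f z != 0 -> ccont f z -> ccont (fun w => (f w)^-1) z.
Proof. by move=> f0 [cf]; split; exact: (@continuousV _ C f z f0 cf). Qed.

Lemma ccont_comp f g z : ccont g z -> ccont f (g z) -> ccont (fun w => f (g w)) z.
Proof. by move=> [cf] [cg]; split; exact: (@continuous_comp C C C g f z cf cg). Qed.

Lemma normc_conj z : Normc.normc (z^*)%C = Normc.normc z.
Proof. by case: z => a b /=; rewrite sqrrN. Qed.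

Lemma ccont_conj z : ccont (fun w => (w^*)%C) z.
Proof.
apply/ccontP => e e0; exists e => // w.
by rewrite -rmorphB /= normc_conj.
Qed.

Lemma near_neq0 f z : ccont f z -> f z != 0 -> \forall w \near (z : C), f w != 0.
Proof.
move=> /ccontP H; rewrite -normc_gt0 => f0; apply/near_normcP.
have [r r0 rP] := H _ f0; exists r => // w /rP; apply: contraTneq => ->.
by rewrite sub0r normcN ltxx.
Qed.

(** Carathéodory's form of differentiability: the increment is a multiple of
    [w - z] by a factor continuous at [z]. Products, inverses and composites are
    then plain algebra, and the removable singularity of a difference quotient
    is removed by the factor [q] itself. *)
Definition cderiv f z := exists2 q, ccont q z &
  \forall w \near (z : C), f w = f z + q w * (w - z).

Lemma near_mono (P S : set C) (z : C) : (\forall w \near z, P w) ->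
  (forall w, P w -> S w) -> \forall w \near z, S w.
Proof.
by move=> /near_normcP[r r0 rP] PS; apply/near_normcP; exists r => // w /rP/PS.
Qed.

Lemma near_mono2 (P Q S : set C) (z : C) : (\forall w \near z, P w) ->
  (\forall w \near z, Q w) -> (forall w, P w -> Q w -> S w) ->
  \forall w \near z, S w.
Proof.
move=> /near_normcP[r r0 rP] /near_normcP[s s0 sQ] PQS; apply/near_normcP.
exists (Num.min r s); first by rewrite lt_min r0.
by move=> w; rewrite lt_min => /andP[/rP ? /sQ ?]; exact: PQS.
Qed.

Lemma near_comp f (P : set C) z : ccont f z ->
  (\forall w \near (f z : C), P w) -> \forall w \near (z : C), P (f w).
Proof.
move=> /ccontP cf /near_normcP[r r0 rP]; have [s s0 sP] := cf r r0.
by apply/near_normcP; exists s => // w /sP/rP.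
Qed.

Lemma near_at (P : set C) (z : C) : (\forall w \near z, P w) -> P z.
Proof. by move=> /near_normcP[r r0]; apply; rewrite subrr Normc.normc0. Qed.

Lemma ccont_near f g z : (\forall w \near (z : C), f w = g w) -> ccont g z ->
  ccont f z.
Proof.
move=> fg /ccontP cg; have fgz := near_at fg; move: fg => /near_normcP[r r0 rP].
apply/ccontP => e /cg[s s0 sP]; exists (Num.min r s); first by rewrite lt_min r0.
by move=> w; rewrite lt_min => /andP[/rP -> /sP]; rewrite fgz.
Qed.

Lemma cderiv_ccont f z : cderiv f z -> ccont f z.
Proof.
move=> [q cq /ccont_near]; apply.
exact: (ccontD (ccont_cst (f z) z) (ccontM cq (ccontD (ccont_id z) (ccont_cst (- z) z)))).
Qed.

Lemma cderiv_cst k z : cderiv (fun=> k) z.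
Proof.
by exists (fun=> 0); [exact: ccont_cst|apply: near_all => w; rewrite mul0r addr0].
Qed.

Lemma cderiv_id z : cderiv id z.
Proof.
by exists (fun=> 1); [exact: ccont_cst|apply: near_all => w; rewrite mul1r addrC subrK].
Qed.

Lemma cderivD f g z : cderiv f z -> cderiv g z -> cderiv (fun w => f w + g w) z.
Proof.
move=> [q cq H] [p cp G]; exists (fun w => q w + p w); first exact: ccontD.
by apply: (near_mono2 H G) => w -> ->; ring.
Qed.

Lemma cderivM f g z : cderiv f z -> cderiv g z -> cderiv (fun w => f w * g w) z.
Proof.
move=> df dg; have cf := cderiv_ccont df.
move: df dg => [q cq H] [p cp G]; exists (fun w => f w * p w + q w * g z).
  exact: (ccontD (ccontM cf cp) (ccontM cq (ccont_cst (g z) z))).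
apply: (near_mono2 H G) => w fw /eqP; rewrite mulrDl.
rewrite addrC -subr_eq => /eqP e; rewrite -[f w * p w * _]mulrA -e fw.
by ring.
Qed.

Lemma cderivN f z : cderiv f z -> cderiv (fun w => - f w) z.
Proof.
move=> [q cq H]; exists (fun w => - q w); first exact: ccontN.
by apply: (near_mono H) => w ->; ring.
Qed.

Lemma cderivB f g z : cderiv f z -> cderiv g z -> cderiv (fun w => f w - g w) z.
Proof. by move=> df /cderivN; exact: cderivD. Qed.

Lemma cderivV f z : f z != 0 -> cderiv f z -> cderiv (fun w => (f w)^-1) z.
Proof.
move=> f0 df; have cf := cderiv_ccont df; move: df => [q cq H].
exists (fun w => - (q w * (f w * f z)^-1)).
  have ff0 : f z * f z != 0 by rewrite mulf_neq0.
  exact: (ccontN (ccontM cq (ccontV (f := fun w => f w * f z) ff0 (ccontM cf (ccont_cst (f z) z))))).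
apply: (near_mono2 H (near_neq0 cf f0)) => w /eqP + fw0.
rewrite addrC -subr_eq => /eqP e.
rewrite (_ : - (q w / (f w * f z)) * (w - z) = - ((q w * (w - z)) / (f w * f z))); last by ring.
by rewrite -e; field; rewrite f0 fw0.
Qed.

Lemma cderiv_comp f g z : cderiv g z -> cderiv f (g z) -> cderiv (fun w => f (g w)) z.
Proof.
move=> dg [q cq H]; have cg := cderiv_ccont dg; move: dg => [p cp G].
exists (fun w => q (g w) * p w); first exact: (ccontM (ccont_comp cg cq) cp).
apply: (near_mono2 (near_comp cg H) G) => w -> gw.
by congr (_ + _); rewrite -mulrA; congr (_ * _); rewrite gw; ring.
Qed.

Lemma cderiv_prod (I : eqType) (s : seq I) (F : I -> R[i] -> R[i]) z :
  {in s, forall i, cderiv (F i) z} -> cderiv (fun w => \prod_(i <- s) F i w) z.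
Proof.
elim: s => [|i s IHs] dF.
  by under eq_fun do rewrite big_nil; exact: cderiv_cst.
under eq_fun do rewrite big_cons; apply: cderivM.
  by apply: dF; rewrite mem_head.
by apply: IHs => j js; apply: dF; rewrite inE js orbT.
Qed.

(** Schwarz reflection across the vertical line [Re = c / 2]. *)
Lemma cderiv_reflect f (c : R) z : cderiv f (c%:C - z^*%C) ->
  cderiv (fun w => (f (c%:C - w^*%C))^*%C) z.
Proof.
move=> [q cq H].
have cr w : ccont (fun w => c%:C - w^*%C) w.
  exact: (ccontD (ccont_cst c%:C w) (ccontN (ccont_conj w))).
exists (fun w => - (q (c%:C - w^*%C))^*%C).
  exact: (ccontN (ccont_comp (ccont_comp (cr z) cq) (ccont_conj _))).
apply: (near_mono (near_comp (cr z) H)) => w /= ->.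
have -> : c%:C - w^*%C - (c%:C - z^*%C) = (- (w - z))^*%C.
  by rewrite rmorphN rmorphB /=; ring.
by rewrite rmorphD rmorphM /= conjcK mulrN mulNr.
Qed.

Lemma derivable_cderiv f z : derivable (f : C -> C) z 1 -> cderiv f z.
Proof.
move=> /cvg_ex[/= D /cvgrPdist_lt H].
exists (fun w => if w == z then D else (w - z)^-1 * (f w - f z)); last first.
  apply: near_all => w; case: eqP => [->|/eqP wz]; first by rewrite subrr mulr0 addr0.
  by rewrite mulrC mulVKf ?subr_eq0// addrC subrK.
apply/ccontP => e e0; have := H e%:C; rewrite ltcR => /(_ e0).
rewrite near_withinE => /near_normcP[r r0 rP]; exists r => // w wz.
rewrite eqxx; case: eqP => [_|/eqP wz0]; first by rewrite subrr Normc.normc0.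
have wz' : Normc.normc (w - z - 0) < r by rewrite subr0.
have wz0' : w - z != 0 by rewrite subr_eq0.
have K : `|D - (w - z)^-1 * (f ((w - z) * 1 + z) - f z)| < e%:C :> R[i].
  exact: rP wz' wz0'.
by rewrite mulr1 subrK distrC in K; rewrite -ltcR.
Qed.

Lemma complexRe_conj z : complex.Re (z^*)%C = complex.Re z. Proof. by case: z. Qed.
Lemma complexIm_conj z : complex.Im (z^*)%C = - complex.Im z. Proof. by case: z. Qed.

Lemma continuous_vertical f (x : R) y : ccont f (x +i* y) ->
  {for y, continuous (fun t => complex.Re (f (x +i* t)))} /\
  {for y, continuous (fun t => complex.Im (f (x +i* t)))}.
Proof.
move=> /ccontP H; split; apply/cvgrPdist_lt => e e0; have [r r0 rP] := H e e0.
  near=> t; rewrite distrC -Re_opp -Re_add; apply: le_lt_trans (Re_le_normc _) _; apply: rP.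
  apply: le_lt_trans (normc_le_ReIm _) _; rewrite /= subrr normr0 add0r distrC.
  by near: t; apply: cvgr_dist_lt => //; exact: cvg_id.
near=> t; rewrite distrC -Im_opp -Im_add; apply: le_lt_trans (Im_le_normc _) _; apply: rP.
apply: le_lt_trans (normc_le_ReIm _) _; rewrite /= subrr normr0 add0r distrC.
by near: t; apply: cvgr_dist_lt => //; exact: cvg_id.
Unshelve. all: by end_near. Qed.

Lemma continuous_horizontal f x (y : R) : ccont f (x +i* y) ->
  {for x, continuous (fun t => complex.Re (f (t +i* y)))} /\
  {for x, continuous (fun t => complex.Im (f (t +i* y)))}.
Proof.
move=> /ccontP H; split; apply/cvgrPdist_lt => e e0; have [r r0 rP] := H e e0.
  near=> t; rewrite distrC -Re_opp -Re_add; apply: le_lt_trans (Re_le_normc _) _; apply: rP.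
  apply: le_lt_trans (normc_le_ReIm _) _; rewrite /= subrr normr0 addr0 distrC.
  by near: t; apply: cvgr_dist_lt => //; exact: cvg_id.
near=> t; rewrite distrC -Im_opp -Im_add; apply: le_lt_trans (Im_le_normc _) _; apply: rP.
apply: le_lt_trans (normc_le_ReIm _) _; rewrite /= subrr normr0 addr0 distrC.
by near: t; apply: cvgr_dist_lt => //; exact: cvg_id.
Unshelve. all: by end_near. Qed.

Lemma normc_lipschitz z w : `|Normc.normc z - Normc.normc w| <= Normc.normc (z - w).
Proof.
have h1 := normcD (z - w) w; have h2 := normcD (w - z) z.
by rewrite subrK in h1; rewrite subrK normcB in h2; rewrite ler_norml; lra.
Qed.

Lemma continuous_normc_vertical f (x : R) y : ccont f (x +i* y) ->
  {for y, continuous (fun t => Normc.normc (f (x +i* t)))}.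
Proof.
move=> /ccontP H; apply/cvgrPdist_lt => e e0; have [r r0 rP] := H e e0.
near=> t; rewrite distrC; apply: le_lt_trans (normc_lipschitz _ _) _; apply: rP.
apply: le_lt_trans (normc_le_ReIm _) _; rewrite /= subrr normr0 add0r distrC.
by near: t; apply: cvgr_dist_lt => //; exact: cvg_id.
Unshelve. all: by end_near. Qed.

Lemma continuous_normc_horizontal f x (y : R) : ccont f (x +i* y) ->
  {for x, continuous (fun t => Normc.normc (f (t +i* y)))}.
Proof.
move=> /ccontP H; apply/cvgrPdist_lt => e e0; have [r r0 rP] := H e e0.
near=> t; rewrite distrC; apply: le_lt_trans (normc_lipschitz _ _) _; apply: rP.
apply: le_lt_trans (normc_le_ReIm _) _; rewrite /= subrr normr0 addr0 distrC.
by near: t; apply: cvgr_dist_lt => //; exact: cvg_id.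
Unshelve. all: by end_near. Qed.

End complex_basics.

(** * Shifting the line of integration *)

(** [g] is the pointwise limit of its values at the [1 / n]-grid points to the
    left of the first variable. *)
Lemma caratheodory_measurable (R : realType) (g : R -> R -> R) :
  (forall y, continuous (g^~ y)) -> (forall x, measurable_fun setT (g x)) ->
  measurable_fun [set: measurableTypeR R * measurableTypeR R]
    (fun z : R * R => g z.1 z.2).
Proof.
move=> cg mg.
pose st n (x : R) : R := (Num.floor (x * n.+1%:R))%:~R / n.+1%:R.
apply: (measurable_realfun.measurable_fun_cvg
  (h := fun n (z : R * R) => g (st n z.1) z.2)) => [n|[x y] _ /=].
  move=> _ A mA; rewrite setTI.
  rewrite (_ : _ @^-1` _ = \bigcup_(k : int)
    (`[k%:~R / n.+1%:R, (k + 1)%:~R / n.+1%:R[%classic `*`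
       (g (k%:~R / n.+1%:R) @^-1` A))); last first.
    apply/seteqP; split=> [[x y] /= Axy|[x y] [k _ [/=]]].
      exists (Num.floor (x * n.+1%:R)) => //; split => //=.
      rewrite in_itv/= ler_pdivrMr ?ltr_pdivlMr ?ltr0n//.
      exact: floor_itv.
    rewrite in_itv/= ler_pdivrMr ?ltr_pdivlMr ?ltr0n// => /floor_def e.
    by rewrite /st e.
  apply: countable_bigcupT_measurable => // k; apply: measurableX => //.
  by rewrite -[X in measurable X]setTI; exact: mg.
have sx : st n x @[n --> \oo] --> x; last exact: (cvg_comp _ _ sx (cg y x)).
apply/cvgrPdist_lt => e e0; near=> n.
have n0 : 0 < n.+1%:R :> R by rewrite ltr0n.
have /andP[h1 h2] := floor_itv (x * n.+1%:R).
rewrite ger0_norm; last by rewrite subr_ge0 /st ler_pdivrMr.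
rewrite -(ltr_pM2r n0) mulrBl /st mulfVK ?gt_eqF//.
apply: (@lt_le_trans _ _ 1); first by rewrite ltrBlDr addrC; move: h2; rewrite intrD.
rewrite -ler_pdivrMl// mulr1.
apply: (@le_trans _ _ n%:R); last by rewrite ler_nat.
by near: n; exact: nbhs_infty_ger.
Unshelve. all: by end_near. Qed.

Section line_shift.
Context {R : realType}.
Notation mu := (@lebesgue_measure R).
Notation C := (R[i]^o).
Implicit Types h : R[i] -> R[i].

(** The imaginary part of [h dz] is the form [Im h dx + Re h dy], which is closed
    by the Cauchy-Riemann equations. *)
Lemma cderiv_rect_integral h lo hi a b c d :
  (forall z, lo < complex.Re z < hi -> cderiv h z) ->
  lo < a -> a <= b -> b < hi -> c <= d ->
  rect_integral (fun x y => complex.Im (h (x +i* y)))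
                (fun x y => complex.Re (h (x +i* y))) a b c d = 0.
Proof.
move=> dh loa ab bhi cd; apply: (closed_form_rect_integral (lo := lo) (hi := hi)) => //.
- move=> y x; rewrite in_itv/= => xlh.
  exact: (continuous_horizontal (cderiv_ccont (dh (x +i* y) xlh))).2.
- move=> x xlh y; rewrite in_itv/= in xlh.
  exact: (continuous_vertical (cderiv_ccont (dh (x +i* y) xlh))).1.
move=> x y; rewrite in_itv/= => xlh.
have [q /ccontP cq /near_normcP[s s0 H]] := dh (x +i* y) xlh.
set z := x +i* y in cq H *.
exists (complex.Im (q z)), (complex.Re (q z)), (- complex.Im (q z)) => e e0.
have [r r0 rP] := cq e e0.
exists (Num.min (r / 2) (s / 2)); first by rewrite lt_min !divr_gt0.
move=> x' y'; rewrite !lt_min => /andP[xr xs] /andP[yr ys].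
pose w := x' +i* y'.
have wz : Normc.normc (w - z) <= `|x' - x| + `|y' - y|.
  by apply: le_trans (normc_le_ReIm _) _.
have wzr : Normc.normc (w - z) < r by lra.
have wzs : Normc.normc (w - z) < s by lra.
have E : Normc.normc ((q w - q z) * (w - z)) <= e * (`|x' - x| + `|y' - y|).
  by rewrite Normc.normcM; apply: ler_pM => //; rewrite ?normc_ge0// ltW// rP.
have hw := H _ wzs.
have I : (q w - q z) * (w - z) = h w - h z - q z * (w - z) by rewrite hw; ring.
rewrite I in E.
split.
  apply: le_trans _ E; apply: le_trans _ (Im_le_normc _).
  rewrite !(Im_add, Im_opp, Im_mul) /w /z /= le_eqVlt; apply/orP; left; apply/eqP.
  by congr (`| _ |); ring.
apply: le_trans _ E; apply: le_trans _ (Re_le_normc _).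
rewrite !(Re_add, Re_opp, Re_mul) /w /z /= le_eqVlt; apply/orP; left; apply/eqP.
by congr (`| _ |); ring.
Qed.

(** For choosing the far ends of a rectangle: there need not be a limit at
    infinity, only points of a set of infinite measure at which [K] is small. *)
Lemma small_far (K : R -> \bar R) (B : R) (D : set R) (e : R) : measurable D ->
  mu D = +oo%E -> measurable_fun setT K -> (forall x, 0 <= K x)%E ->
  (\int[mu]_x K x <= B%:E)%E -> 0 < e -> exists2 T, D T & (K T <= e%:E)%E.
Proof.
move=> mD muD mK K0 KB e0; apply: contrapT => H.
have KD x : D x -> (e%:E <= K x)%E.
  move=> Dx; rewrite leNgt; apply/negP => Kx; apply: H; exists x => //; exact: ltW.
have : (\int[mu]_(x in D) (cst e%:E x) <= B%:E)%E.
  apply: (@le_trans _ _ (\int[mu]_(x in D) K x)%E).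
    by apply: ge0_le_integral => // [x _|]; [rewrite lee_fin ltW|exact: measurable_funTS].
  apply: le_trans KB; apply: ge0_subset_integral => //.
by rewrite integral_cst// [X in (_ * X)%E](_ : _ = +oo%E)// mulry gtr0_sg// mul1e leye_eq.
Qed.

Lemma cvg_seg_line (f : R -> R) (S T : R^nat) : mu.-integrable setT (EFin \o f) ->
  (forall n, S n <= - n%:R) -> (forall n, n%:R <= T n) ->
  seg f (S n) (T n) @[n --> \oo] --> \int[mu]_x f x.
Proof.
move=> fi Sn Tn.
have mf : measurable_fun setT (EFin \o f) by exact: measurable_int fi.
pose f_ n := (EFin \o f) \_ `[S n, T n].
have mf_ n : measurable_fun setT (f_ n).
  by apply/measurable_restrict => //; rewrite setTI; exact: measurable_funTS.
have f_f : {ae mu, forall x, setT x -> f_ ^~ x @ \oo --> (EFin \o f) x}.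
  apply: aeW => x _; apply: cvg_near_cst; near=> n.
  rewrite /f_ patchE mem_set//= in_itv/=; apply/andP; split.
    apply: le_trans (Sn n) _; rewrite lerNl.
    apply: (@le_trans _ _ `|x|); first by rewrite -normrN ler_norm.
    by near: n; exact: nbhs_infty_ger.
  apply: le_trans (Tn n); apply: le_trans (ler_norm _) _.
  by near: n; exact: nbhs_infty_ger.
have f_g : {ae mu, forall x n, setT x -> `|f_ n x| <= (abse \o (EFin \o f)) x}%E.
  apply: aeW => x n _ /=; rewrite /f_ patchE; case: ifP => //= _.
  by rewrite normr0 lee_fin normr_ge0.
have [_ _ H] := @dominated_convergence _ _ _ mu setT measurableT f_ _ _
  mf_ mf f_f (integrable_abse fi) f_g.
apply: fine_cvg; rewrite fineK ?integrable_fin_num//.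
apply: cvg_trans H; apply: near_eq_cvg; apply: nearW => n /=.
by rewrite /f_ -integral_mkcond.
Unshelve. all: by end_near. Qed.

(** Cauchy's theorem on tall rectangles. The integral of [|h|] over the strip
    between the two lines is finite, so that the horizontal sides can be placed
    at heights [S n] and [T n] where they contribute little. *)
Lemma line_shift h lo hi (B : R) :
  (forall z, lo < complex.Re z < hi -> cderiv h z) ->
  (forall x, lo < x < hi -> (\int[mu]_t (Normc.normc (h (x +i* t)))%:E <= B%:E)%E) ->
  forall c1 c2, lo < c1 -> c1 <= c2 -> c2 < hi ->
  \int[mu]_t complex.Re (h (c1 +i* t)) = \int[mu]_t complex.Re (h (c2 +i* t)).
Proof.
move=> dh hB c1 c2 l1 c12 h2.
(* [h] is only controlled inside the strip: clamping the abscissa to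
   [c1, c2] makes [g] continuous everywhere without changing it there *)
pose cl x : R := Num.min c2 (Num.max c1 x).
pose g x t := Normc.normc (h (cl x +i* t)).
have clE x : lo < cl x < hi.
  by rewrite /cl; case: (leP c1 x) => ?; case: (leP c2 _) => ?; lra.
have clid x : c1 <= x <= c2 -> cl x = x.
  by move=> /andP[? ?]; rewrite /cl max_r// min_r.
have g0 x t : 0 <= g x t by exact: normc_ge0.
have chh x t : ccont h (cl x +i* t) by apply/cderiv_ccont/dh/clE.
have ccl : continuous cl.
  move=> x; apply: (@continuous_min _ _ (cst c2)); first exact: cst_continuous.
  by apply: (@continuous_max _ _ (cst c1)); [exact: cst_continuous|].
have cg y : continuous (g^~ y).
  move=> x; have cx := continuous_normc_horizontal (chh x y).
  exact: (@continuous_comp _ _ _ cl (fun x => Normc.normc (h (x +i* y))) _ (ccl x) cx).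
have cgt x : continuous (g x).
  by move=> y; exact: continuous_normc_vertical (chh x y).
have B0 : 0 <= B.
  rewrite -lee_fin; apply: le_trans (hB c1 _); last lra.
  by apply: integral_ge0 => t _; rewrite lee_fin normc_ge0.
pose F (p : R * R) := ((g p.1 p.2)%:E * (\1_`[c1, c2] p.1)%:E)%E.
have mF : measurable_fun [set: measurableTypeR R * measurableTypeR R] F.
  apply: emeasurable_funM.
    apply/measurable_EFinP; apply: caratheodory_measurable => // x.
    exact: continuous_measurable_fun.
  apply/measurable_EFinP.
  apply: (@measurableT_comp _ _ _ _ _ _ (\1_`[c1, c2] : R -> R) _ fst) => //.
have F0 p : (0 <= F p)%E by rewrite mule_ge0// lee_fin ?normc_ge0.
pose K t := (\int[mu]_x F (x, t))%E.
have K0 t : (0 <= K t)%E by apply: integral_ge0.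
have mK : measurable_fun [set: measurableTypeR R] K.
  exact: (measurable_fun_fubini_tonelli_G (m1 := mu) F mF F0).
have c12E : mu `[c1, c2] = (c2 - c1)%:E.
  rewrite lebesgue_measure_itv/= lte_fin.
  by case: ltgtP c12 => // -> _; rewrite subrr.
have KB : (\int[mu]_t K t <= (B * (c2 - c1))%:E)%E.
  rewrite /K -(fubini_tonelli (m1 := mu) (m2 := mu) F mF F0).
  apply: (@le_trans _ _ (\int[mu]_(x in `[c1, c2]) (cst B%:E x))%E); last first.
    by rewrite integral_cst// [X in (_ * X)%E](_ : _ = (c2 - c1)%:E).
  rewrite [leRHS]integral_mkcond; apply: ge0_le_integral => //.
  - by move=> x _; apply: integral_ge0.
  - exact: (measurable_fun_fubini_tonelli_F (m2 := mu) F mF F0).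
  - by apply/measurable_restrict => //; exact: measurable_cst.
  - move=> x _; rewrite /F/= patchE indicE; case: ifP => _ /=; last first.
      by under eq_integral do rewrite mule0; rewrite integral0.
    by under eq_integral do rewrite mule1; exact: hB.
have KE t : (`|seg (fun x => complex.Im (h (x +i* t))) c1 c2|%:E <= K t)%E.
  have ii : mu.-integrable `[c1, c2] (EFin \o (fun x => complex.Im (h (x +i* t)))).
    apply: (@continuous_seg_integrable _ _ lo hi) => // x; rewrite in_itv/= => xlh.
    exact: (continuous_horizontal (cderiv_ccont (dh (x +i* t) xlh))).2.
  rewrite /seg EFin_normr_Rintegral//.
  apply: le_trans (le_abse_integral _ _ _) _ => //.
    exact: measurable_int ii.
  rewrite integral_mkcond; apply: ge0_le_integral => //.
  - by move=> x _; rewrite patchE; case: ifP.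
  - apply/measurable_restrict => //; rewrite setTI.
    by apply: measurableT_comp => //; exact: measurable_int ii.
  - exact: (measurable_fun_pair1 t mF).
  move=> x _; rewrite patchE /F/= indicE; case: ifP => [|_]; last by rewrite mule0.
  rewrite inE/= in_itv/= => xc; rewrite mule1 lee_fin /g clid//.
  exact: Im_le_normc.
have e0 n : 0 < n.+1%:R^-1 :> R by rewrite invr_gt0 ltr0n.
have fT n : {T | n%:R <= T /\ (K T <= (n.+1%:R^-1)%:E)%E}.
  apply: cid; have mui : mu `[n%:R, +oo[ = +oo%E by rewrite lebesgue_measure_itv/= ltry.
  have [T] := small_far (measurable_itv _) mui mK K0 KB (e0 n).
  by rewrite /= in_itv/= andbT; exists T.
have fS n : {T | T <= - n%:R /\ (K T <= (n.+1%:R^-1)%:E)%E}.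
  apply: cid; have mui : mu `]-oo, - n%:R] = +oo%E by rewrite lebesgue_measure_itv/= ltNyr.
  have [T] := small_far (measurable_itv _) mui mK K0 KB (e0 n).
  by rewrite /= in_itv/=; exists T.
pose T n := sval (fT n); pose S n := sval (fS n).
have Ji c : lo < c < hi ->
    mu.-integrable setT (EFin \o (fun t => complex.Re (h (c +i* t)))).
  move=> clh; have mm : measurable_fun setT (fun t => complex.Re (h (c +i* t))).
    apply: continuous_measurable_fun => y.
    exact: (continuous_vertical (cderiv_ccont (dh (c +i* y) clh))).1.
  apply/integrableP; split; first exact/measurable_EFinP.
  apply: (@le_lt_trans _ _ B%:E); last exact: ltry.
  apply: le_trans (hB c clh); apply: ge0_le_integral => //.
  - by apply: measurableT_comp => //; exact/measurable_EFinP.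
  - apply/measurable_EFinP; apply: continuous_measurable_fun => y.
    exact: continuous_normc_vertical (cderiv_ccont (dh (c +i* y) clh)).
  by move=> t _; rewrite lee_fin Re_le_normc.
have lim c : lo < c < hi -> seg (fun t => complex.Re (h (c +i* t))) (S n) (T n)
    @[n --> \oo] --> \int[mu]_t complex.Re (h (c +i* t)).
  move=> clh; apply: cvg_seg_line; first exact: Ji.
    by move=> n; have [] := svalP (fS n).
  by move=> n; have [] := svalP (fT n).
have c1lh : lo < c1 < hi by lra.
have c2lh : lo < c2 < hi by lra.
apply/eqP; rewrite -subr_eq0; apply/eqP.
apply: (cvg_unique _ (cvgB (lim c1 c1lh) (lim c2 c2lh))); first exact: norm_hausdorff.
apply/norm_cvg0P; apply: (@squeeze_cvgr _ _ _ _ (cst 0) (fun n => 2 * n.+1%:R^-1)).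
- near=> n; rewrite normr_ge0/=.
  have [S1 S2] := svalP (fS n); have [T1 T2] := svalP (fT n).
  rewrite -/(S n) in S1 S2; rewrite -/(T n) in T1 T2.
  have ST : S n <= T n by have := ler0n R n; lra.
  have := cderiv_rect_integral dh l1 c12 h2 ST.
  rewrite /rect_integral => /eqP; rewrite -addrA addr_eq0 opprB => /eqP e.
  rewrite [leLHS]/(`| _ - _ |) -e.
  apply: le_trans (ler_normB _ _) _; rewrite mulr_natl mulr2n.
  apply: lerD; rewrite -lee_fin; apply: le_trans (KE _) _.
    exact: S2.
  exact: T2.
- exact: cvg_cst.
- rewrite -[0 in X in _ --> X](mulr0 2); apply: cvgM; first exact: cvg_cst.
  exact: cvg_harmonic.
Unshelve. all: by end_near. Qed.

End line_shift.

(** * The Poisson kernel *)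

Section poisson_kernel.
Context {R : realType}.
Notation mu := (@lebesgue_measure R).

(** [pi] times the Poisson kernel of a half-plane, at distance [d] from its edge. *)
Definition poisson (d t : R) : R := d / (d ^+ 2 + t ^+ 2).

Lemma poisson_den_gt0 (d t : R) : 0 < d -> 0 < d ^+ 2 + t ^+ 2.
Proof. by move=> d0; rewrite ltr_wpDr ?sqr_ge0// exprn_gt0. Qed.

Lemma poisson_ge0 (d t : R) : 0 < d -> 0 <= poisson d t.
Proof. by move=> d0; rewrite divr_ge0 ?ltW// poisson_den_gt0. Qed.

Lemma continuous_poisson (d : R) : 0 < d -> continuous (poisson d).
Proof.
move=> d0 t; apply: cvgM; first exact: cvg_cst.
apply: cvgV; first by rewrite gt_eqF ?poisson_den_gt0.
by apply: cvgD; [exact: cvg_cst|exact: exprn_continuous].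
Qed.

Lemma integral_affine (G : R -> R) (a b : R) : 0 < a -> continuous G ->
  (forall x, 0 <= G x) ->
  (\int[mu]_x (G x)%:E = \int[mu]_x (a * G (a * x + b))%:E)%E.
Proof.
move=> a0 cG G0; pose F x : R := a * x + b.
have dF (x : R) : is_derive x (1 : R) F a.
  by rewrite /F; apply: is_derive_eq; rewrite /GRing.scale/= ?mulr1 ?mulr0 ?scaler0 ?addr0.
have F'E : derive1 F = cst a by apply/funext => x; rewrite derive1E derive_val.
rewrite (increasing_ge0_integration_by_substitutionT (F := F)) //.
- by apply: eq_integral => x _ /=; rewrite F'E /= mulrC.
- by move=> x y xy; rewrite /F ltrD2r ltr_pM2l.
- by rewrite F'E => x; exact: cst_continuous.
- by rewrite F'E; exact: is_cvg_cst.
- by rewrite F'E; exact: is_cvg_cst.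
- apply/cvgrNyPle => A; exists ((A - b) / a); split; first exact: num_real.
  by move=> x; rewrite /= ltr_pdivlMr// mulrC /F => /ltW; rewrite lerBrDr.
- apply/cvgryPge => A; exists ((A - b) / a); split; first exact: num_real.
  by move=> x; rewrite /= ltr_pdivrMr// mulrC /F => /ltW; rewrite lerBlDr.
Qed.

Lemma integral_poisson1 : (\int[mu]_t ((1 + t ^+ 2)^-1)%:E = pi%:E)%E.
Proof.
rewrite ge0_symfun_integralT.
- rewrite -set_itvcy; have := @integral0y_oneDsqr R; rewrite /oneDsqr => ->.
  by rewrite -EFinM; congr EFin; field.
- by move=> x; rewrite invr_ge0 addr_ge0// sqr_ge0.
- exact: continuous_oneDsqrV.
- by move=> x /=; rewrite sqrrN.
Qed.

Lemma integral_poisson (d y : R) : 0 < d ->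
  (\int[mu]_t (poisson d (t - y))%:E = pi%:E)%E.
Proof.
move=> d0; rewrite -integral_poisson1 (@integral_affine _ d y)//.
- apply: eq_integral => t _; congr EFin; rewrite addrK /poisson.
  have t1 : 1 + t ^+ 2 != 0 by rewrite gt_eqF// ltr_wpDr// sqr_ge0.
  rewrite (_ : d ^+ 2 + (d * t) ^+ 2 = d ^+ 2 * (1 + t ^+ 2)); last by ring.
  by field; rewrite t1 gt_eqF.
- move=> t; apply: (@continuous_comp _ _ _ (fun t => t - y) (poisson d)).
    by apply: cvgB; [exact: cvg_id|exact: cvg_cst].
  exact: continuous_poisson.
- by move=> t; exact: poisson_ge0.
Qed.

(** Harnack: translating by at most [1] costs only a constant factor, so that
    integrating [f] against the kernel is no worse than integrating its means
    over unit intervals. *)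
Lemma poisson_translate (d t u : R) : 0 < d -> 0 <= u <= 1 ->
  poisson d t <= (2 + 2 / d ^+ 2) * poisson d (t - u).
Proof.
move=> d0 u01; rewrite /poisson mulrA ler_pdivlMr ?poisson_den_gt0//.
rewrite mulrAC ler_pdivrMr ?poisson_den_gt0// mulrC [X in _ <= X]mulrAC.
rewrite ler_pM2r//.
have -> : (2 + 2 / d ^+ 2) * (d ^+ 2 + t ^+ 2) =
  2 * d ^+ 2 + 2 * t ^+ 2 + 2 + 2 * (t / d) ^+ 2 by field; rewrite gt_eqF.
have := sqr_ge0 (t / d); have := sqr_ge0 d; have := sqr_ge0 (t + u).
have : u ^+ 2 <= 1 by rewrite expr_le1//; lra.
by rewrite !sqrrD !sqrrN; lra.
Qed.

(** Average the integral over all translates of [f] by [u] in [0, 1]: the kernel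
    changes by a bounded factor, and Fubini's theorem then integrates [f] over
    unit intervals first. *)
Lemma uniformly_local_poisson (f : R -> R) (M d y : R) : 0 < d ->
  continuous f -> (forall t, 0 <= f t) ->
  (forall x, \int[mu]_(u in `[0%R, 1%R]) (f (x + u))%:E <= M%:E)%E ->
  (\int[mu]_t (f t * poisson d (t - y))%:E <= ((2 + 2 / d ^+ 2) * M * pi)%:E)%E.
Proof.
move=> d0 cf f0 fM; set k := 2 + 2 / d ^+ 2.
have k0 : 0 <= k by rewrite addr_ge0// divr_ge0// sqr_ge0.
have M0 : 0 <= M.
  by rewrite -lee_fin; apply: le_trans (fM 0); apply: integral_ge0 => u _; rewrite lee_fin.
have cP z : continuous (fun t => poisson d (t - z)).
  move=> t; apply: (@continuous_comp _ _ _ (fun t => t - z) (poisson d)).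
    by apply: cvgB; [exact: cvg_id|exact: cvg_cst].
  exact: continuous_poisson.
have cfP z : continuous (fun t => f t * poisson d (t - z)).
  by move=> t; apply: cvgM; [exact: cf|exact: cP].
have cfD a : continuous (fun u => f (u + a)).
  move=> u; apply: (@continuous_comp _ _ _ (fun u => u + a) f); last exact: cf.
  by apply: cvgD; [exact: cvg_id|exact: cvg_cst].
have cfD' a : continuous (fun u => f (a + u)).
  move=> u; apply: (@continuous_comp _ _ _ (fun u => a + u) f); last exact: cf.
  by apply: cvgD; [exact: cvg_cst|exact: cvg_id].
pose g x u := poisson d (x - y) * f (x + u).
have g0 x u : 0 <= g x u by rewrite mulr_ge0// poisson_ge0.
have cg u : continuous (g^~ u).
  by move=> x; apply: cvgM; [exact: cP|exact: cfD].
have cg' x : continuous (g x).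
  by move=> u; apply: cvgM; [exact: cvg_cst|exact: cfD'].
pose F (p : R * R) := ((g p.1 p.2)%:E * (\1_`[0%R, 1%R] p.2)%:E)%E.
have mF : measurable_fun [set: measurableTypeR R * measurableTypeR R] F.
  apply: emeasurable_funM.
    apply/measurable_EFinP; apply: caratheodory_measurable => // x.
    exact: continuous_measurable_fun.
  apply/measurable_EFinP.
  by apply: (@measurableT_comp _ _ _ _ _ _ (\1_`[0%R, 1%R] : R -> R) _ snd).
have F0 p : (0 <= F p)%E by rewrite mule_ge0// lee_fin.
have mu01 : mu `[0%R, 1%R] = 1%E.
  by rewrite lebesgue_measure_itv/= lte_fin ltr01 -EFinB subr0.
set I := (\int[mu]_t _)%E.
have -> : I = (\int[mu]_(u in `[0%R, 1%R]) (cst I u))%E.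
  by rewrite integral_cst// [X in (_ * X)%E](_ : _ = 1%E)// mule1.
apply: (@le_trans _ _ (\int[mu]_u (k%:E * \int[mu]_x F (x, u)))%E).
  rewrite integral_mkcond; apply: ge0_le_integral => //.
  - move=> u _; rewrite patchE; case: ifP => // _; apply: integral_ge0 => t _.
    by rewrite lee_fin mulr_ge0// poisson_ge0.
  - by apply/measurable_restrict => //; exact: measurable_cst.
  - apply: emeasurable_funM; first exact: measurable_cst.
    exact: (measurable_fun_fubini_tonelli_G (m1 := mu) F mF F0).
  move=> u _; rewrite patchE /F /=; case: ifPn => u01; last first.
    apply: mule_ge0; first by rewrite lee_fin.
    by apply: integral_ge0 => x _; exact: (F0 (x, u)).
  rewrite indicE u01; under eq_integral do rewrite mule1.
  rewrite inE/= in_itv/= in u01.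
  rewrite /I (@integral_affine _ 1 u)//; last first.
    by move=> t; rewrite mulr_ge0// poisson_ge0.
  rewrite -ge0_integralZl//=; last 2 first.
    by apply/measurable_EFinP; apply: continuous_measurable_fun; exact: cg.
    by move=> x _; rewrite lee_fin.
  apply: ge0_le_integral => //.
  - by move=> x _; rewrite lee_fin mul1r mulr_ge0// poisson_ge0.
  - apply/measurable_EFinP; apply: measurable_funM; first exact: measurable_cst.
    apply: continuous_measurable_fun => x.
    have cA : {for x, continuous (fun x : R => 1 * x + u)}.
      by apply: cvgD; [apply: cvgM; [exact: cvg_cst|exact: cvg_id]|exact: cvg_cst].
    exact: (continuous_comp cA (cfP y (1 * x + u))).
  - apply: emeasurable_funM; first exact: measurable_cst.
    by apply/measurable_EFinP; apply: continuous_measurable_fun; exact: cg.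
  move=> x _; rewrite !mul1r -EFinM lee_fin /g mulrC mulrA ler_wpM2r//.
  have := @poisson_translate d (x + u - y) u d0 u01.
  by rewrite [x + u - y - u](_ : _ = x - y)//; ring.
rewrite ge0_integralZl//; last 2 first.
  exact: (measurable_fun_fubini_tonelli_G (m1 := mu) F mF F0).
  by move=> u _; apply: integral_ge0.
rewrite -(fubini_tonelli (m1 := mu) (m2 := mu) F mF F0) -mulrA EFinM.
apply: lee_wpmul2l; first by rewrite lee_fin.
rewrite EFinM -(integral_poisson y d0) -ge0_integralZl//=; last 2 first.
  by apply/measurable_EFinP; apply: continuous_measurable_fun; exact: cP.
  by move=> t _; rewrite lee_fin poisson_ge0.
apply: ge0_le_integral => //.
- by move=> x _; apply: integral_ge0.
- exact: (measurable_fun_fubini_tonelli_F (m2 := mu) F mF F0).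
- apply: emeasurable_funM; first exact: measurable_cst.
  by apply/measurable_EFinP; apply: continuous_measurable_fun; exact: cP.
move=> x _.
apply: (@le_trans _ _ ((poisson d (x - y))%:E *
    \int[mu]_(u in `[0%R, 1%R]) (f (x + u))%:E)%E); last first.
  by rewrite muleC lee_wpmul2r// lee_fin poisson_ge0.
rewrite -ge0_integralZl//=; last 3 first.
  apply/measurable_EFinP; apply: measurable_funTS.
  by apply: continuous_measurable_fun; exact: cfD'.
  by move=> u _; rewrite lee_fin.
  by rewrite lee_fin poisson_ge0.
rewrite [leRHS]integral_mkcond le_eqVlt; apply/orP; left; apply/eqP.
apply: eq_integral => u _; rewrite /F /g/= patchE indicE; case: ifP => _.
  by rewrite mule1.
by rewrite mule0.
Qed.

End poisson_kernel.

(** * Mean squares on a vertical line control interior values *)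

Section poisson_bound.
Context {R : realType}.
Notation mu := (@lebesgue_measure R).
Notation nc := (@Normc.normc R).
Implicit Types H Y : R[i] -> R[i].

(** Locally square integrable, uniformly over all vertical lines of [Re > a]. *)
Definition ul2 H (a M : R) := forall x t, a < x ->
  (\int[mu]_(u in `[0%R, 1%R]) (nc (H (x +i* (t + u))) ^+ 2)%:E <= M%:E)%E.

Definition hol H (a : R) := forall w, a < complex.Re w -> cderiv H w.

Lemma hol_continuous_sqr H a x : hol H a -> a < x ->
  continuous (fun t => nc (H (x +i* t)) ^+ 2).
Proof.
move=> hH ax t; apply: (@continuous_comp _ _ _ _ (fun x : R => x ^+ 2)).
  exact: continuous_normc_vertical (cderiv_ccont (hH (x +i* t) ax)).
exact: exprn_continuous.
Qed.

Lemma continuous_poisson_shift (d y : R) : 0 < d ->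
  continuous (fun t => poisson d (t - y)).
Proof.
move=> d0 t; apply: (@continuous_comp _ _ _ (fun t => t - y) (poisson d)).
  by apply: cvgB; [exact: cvg_id|exact: cvg_cst].
exact: continuous_poisson.
Qed.

Lemma dominated_integrableR (f g : R -> R) (B : R) : measurable_fun setT f ->
  measurable_fun setT g -> (forall t, `|f t| <= g t) ->
  (\int[mu]_t (g t)%:E <= B%:E)%E ->
  mu.-integrable setT (EFin \o f) /\ `|\int[mu]_t f t| <= B.
Proof.
move=> mf mg fg gB.
have fB : (\int[mu]_t `|(f t)%:E| <= B%:E)%E.
  apply: le_trans gB; apply: ge0_le_integral => //.
  - by apply: measurableT_comp => //; exact/measurable_EFinP.
  - exact/measurable_EFinP.
  - by move=> t _; rewrite lee_fin.
have fi : mu.-integrable setT (EFin \o f).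
  apply/integrableP; split; first exact/measurable_EFinP.
  exact: le_lt_trans fB (ltry _).
split => //; rewrite -lee_fin EFin_normr_Rintegral//.
by apply: le_trans fB; apply: le_abse_integral => //; exact/measurable_EFinP.
Qed.

Lemma ul2_poisson H (a M d x y : R) : hol H a -> ul2 H a M -> a < x -> 0 < d ->
  (\int[mu]_t (nc (H (x +i* t)) ^+ 2 * poisson d (t - y))%:E <=
   ((2 + 2 / d ^+ 2) * M * pi)%:E)%E.
Proof.
move=> hH HM ax d0; apply: uniformly_local_poisson => //.
- exact: hol_continuous_sqr hH ax.
- by move=> t; exact: exprn_ge0 (normc_ge0 _).
- by move=> t; exact: HM.
Qed.

Lemma ul2_poisson_affine H (a M d x y A B : R) : hol H a -> ul2 H a M -> a < x -> 0 < d ->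
  0 <= A -> 0 <= B ->
  (\int[mu]_t ((A * nc (H (x +i* t)) ^+ 2 + B) * poisson d (t - y))%:E <=
   (A * ((2 + 2 / d ^+ 2) * M * pi) + B * pi)%:E)%E.
Proof.
move=> hH HM ax d0 A0 B0.
have P0 t : 0 <= poisson d (t - y) by exact: poisson_ge0.
have N0 t : 0 <= nc (H (x +i* t)) ^+ 2 by exact: exprn_ge0 (normc_ge0 _).
have mP : measurable_fun setT (fun t : R => poisson d (t - y)).
  by apply: continuous_measurable_fun; exact: continuous_poisson_shift.
have mN : measurable_fun setT (fun t : R => nc (H (x +i* t)) ^+ 2).
  by apply: continuous_measurable_fun; exact: hol_continuous_sqr hH ax.
under eq_integral do rewrite mulrDl EFinD -mulrA (EFinM A) (EFinM B).
rewrite ge0_integralD//=.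
- rewrite EFinD; apply: leeD.
    rewrite ge0_integralZl//=.
    + by rewrite EFinM lee_wpmul2l//; exact: (ul2_poisson y hH HM ax d0).
    + by apply/measurable_EFinP; exact: measurable_funM.
    + by move=> t _; rewrite lee_fin mulr_ge0//.
  rewrite ge0_integralZl//=.
  + by rewrite EFinM integral_poisson.
  + by apply/measurable_EFinP.
  + by move=> t _; rewrite lee_fin.
- by move=> t _; rewrite -EFinM lee_fin mulr_ge0// mulr_ge0.
- apply: emeasurable_funM; first exact: measurable_cst.
  by apply/measurable_EFinP; exact: measurable_funM.
- by move=> t _; rewrite -EFinM lee_fin mulr_ge0.
- apply: emeasurable_funM; first exact: measurable_cst.
  by apply/measurable_EFinP.
Qed.

(** Away from [z], and to the right of the reflected point [zs], the denominator
    [(w - z) * (w - zs)] grows like the square of the height, whence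
    integrability on vertical lines. *)
Lemma vertical_kernel_ge (w z zs : R[i]) (m : R) : 0 < m ->
  complex.Im zs = complex.Im z ->
  m <= nc (w - z) -> m <= complex.Re w - complex.Re zs ->
  m ^+ 2 + (complex.Im w - complex.Im z) ^+ 2 <= 2 * nc ((w - z) * (w - zs)).
Proof.
move=> m0 Iz mz mzs; set tau := complex.Im w - complex.Im z.
have A : m ^+ 2 + tau ^+ 2 <= 2 * nc (w - z) ^+ 2.
  have : m ^+ 2 <= nc (w - z) ^+ 2 by rewrite ler_pXn2r// nnegrE ?normc_ge0// ltW.
  rewrite normc_sqr !(Im_add, Im_opp) -/tau.
  by have := sqr_ge0 (complex.Re (w - z)); lra.
have B : m ^+ 2 + tau ^+ 2 <= nc (w - zs) ^+ 2.
  rewrite normc_sqr !(Im_add, Im_opp, Re_add, Re_opp) Iz -/tau lerD2r.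
  by rewrite ler_pXn2r// nnegrE ltW// (lt_le_trans m0).
have S0 : 0 <= m ^+ 2 + tau ^+ 2 by rewrite addr_ge0// sqr_ge0.
rewrite -(ler_pXn2r (n := 2))// ?nnegrE//; last by rewrite mulr_ge0// normc_ge0.
rewrite exprMn Normc.normcM exprMn expr2.
apply: (le_trans (ler_pM S0 S0 A B)).
rewrite mulrA ler_wpM2r// ?sqr_ge0// ler_wpM2r// ?sqr_ge0//.
by rewrite expr2 ler_peMl//; lra.
Qed.

(** Let [zs] be the mirror image of [z] in the line [Re = c]. The function
    [G w = - (Y w - 1) ^+ 2 / ((w - z) * (w - zs))] is holomorphic to the right
    of [zs], at [z] too since [Y - 1] vanishes there and is squared, and it is
    integrable on vertical lines. Its integral does not depend on the line and tends to [0] as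
    the line recedes, so it vanishes. On the line [Re = c] the denominator is
    real, and the vanishing of the real part says that the Poisson mean of
    [Re ((Y - 1) ^+ 2)] is [0]. As [Re ((Y - 1) ^+ 2)] is close to [1] where
    [Y] is small, [Y] cannot be small on most of the line. *)
Lemma mean_value_lower_bound Y (a M : R) (z : R[i]) (c : R) :
  hol Y a -> ul2 Y a M -> a < c -> c < complex.Re z -> Y z = 1 ->
  (pi%:E <= 6%:E * \int[mu]_t (nc (Y (c +i* t)) ^+ 2 *
     poisson (complex.Re z - c) (t - complex.Im z))%:E)%E.
Proof.
move=> hY YM ac cz Yz.
set y := complex.Im z; set d := complex.Re z - c.
have d0 : 0 < d by rewrite subr_gt0.
pose zs := (2 * c - complex.Re z) +i* y.
pose a1 := (Num.max a (2 * c - complex.Re z) + c) / 2.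
have [a1a a1z a1c] : [/\ a < a1, 2 * c - complex.Re z < a1 & a1 < c].
  by rewrite /a1; case: (leP a) => ?; split; rewrite /d in d0; lra.
have M0 : 0 <= M.
  have := YM c 0 ac; rewrite -lee_fin; apply: le_trans.
  by apply: integral_ge0 => t _; rewrite lee_fin; exact: exprn_ge0 (normc_ge0 _).
pose G w := - ((Y w - 1) ^+ 2 / ((w - z) * (w - zs))).
have wzs0 w : a1 < complex.Re w -> w - zs != 0.
  move=> aw; apply/eqP => /(congr1 (@complex.Re R)).
  by rewrite Re_add Re_opp /=; lra.
have dzs w : cderiv (fun w => w - zs) w.
  by apply: cderivB; [exact: cderiv_id|exact: cderiv_cst].
have dG w : a1 < complex.Re w -> cderiv G w.
  move=> aw; have dY : cderiv Y w by apply: hY; lra.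
  have [wz|wz] := eqVneq w z; last first.
    apply: cderivN; apply: cderivM.
      by apply: cderivM; apply: cderivB => //; exact: cderiv_cst.
    apply: cderivV; first by rewrite mulf_neq0 ?subr_eq0// -subr_eq0 wzs0.
    by apply: cderivM => //; apply: cderivB; [exact: cderiv_id|exact: cderiv_cst].
  subst w; have [q cq H] := dY.
  exists (fun w => - (q w * q w * (w - zs)^-1)).
    apply: ccontN; apply: ccontM; first exact: ccontM.
    by apply: (ccontV (f := fun w => w - zs)); [exact: wzs0|exact: cderiv_ccont].
  apply: (near_mono2 H (near_neq0 (cderiv_ccont (dzs z)) (wzs0 z aw))) => w Yw wn.
  rewrite /G Yw Yz [1 + _ - 1]addrC addKr subrr expr0n/= mul0r oppr0 add0r.
  have [->|wz] := eqVneq w z; first by rewrite subrr !(mulr0, mul0r) expr0n/= !(mul0r, oppr0).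
  by field; rewrite wn subr_eq0 wz.
have [q /ccontP cq /near_normcP[s s0 Hq]] : cderiv Y z by apply: hY; lra.
pose e := a1 - (2 * c - complex.Re z).
have e0 : 0 < e by rewrite /e; lra.
have [r1 r10 rP] := cq 1 ltr01.
(* inside the disc of radius [r] about [z] the factored form of [Y] bounds
   [G] by [K]; outside it the denominator does *)
pose r := Num.min (r1 / 2) (s / 2).
have r0 : 0 < r by rewrite lt_min !divr_gt0.
pose m := Num.min r e; have m0 : 0 < m by rewrite lt_min r0.
pose K := (nc (q z) + 1) ^+ 2 * r / e.
have K0 : 0 <= K by rewrite divr_ge0 ?(ltW e0)// mulr_ge0 ?sqr_ge0// ltW.
pose A := 4 / m; pose B := 4 / m + K * (m ^+ 2 + r ^+ 2) / m.
have A0 : 0 <= A by rewrite divr_ge0// ltW.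
have B0 : 0 <= B.
  rewrite addr_ge0//; apply: divr_ge0; last exact: ltW.
  by rewrite mulr_ge0// addr_ge0// sqr_ge0.
have Yle w : nc (Y w - 1) ^+ 2 <= 2 * nc (Y w) ^+ 2 + 2.
  have := normcD (Y w) (- 1); rewrite normcN Normc.normc1 => h.
  apply: (@le_trans _ _ ((nc (Y w) + 1) ^+ 2)).
    by rewrite ler_pXn2r// nnegrE ?addr_ge0 ?normc_ge0.
  by have := sqr_ge0 (nc (Y w) - 1); rewrite sqrrB sqrrD; lra.
have Gle w : a1 < complex.Re w ->
    nc (G w) <= (A * nc (Y w) ^+ 2 + B) * poisson m (complex.Im w - y).
  move=> aw; set P := poisson _ _.
  have P0 : 0 <= P by exact: poisson_ge0.
  have den0 := poisson_den_gt0 (complex.Im w - y) m0.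
  have [wz|wz] := ltP (nc (w - z)) r; last first.
    apply: (@le_trans _ _ ((2 * nc (Y w) ^+ 2 + 2) * (2 / m * P))); last first.
      rewrite mulrA ler_wpM2r// /A /B.
      have : 0 <= K * (m ^+ 2 + r ^+ 2) / m.
        apply: divr_ge0; last exact: ltW.
        by rewrite mulr_ge0// addr_ge0// sqr_ge0.
      rewrite -[2 / m]/(2 * m^-1) -[4 / m]/(4 * m^-1).
      by set v := nc (Y w) ^+ 2; set u := K * _ / m; move: m^-1 => mi; nra.
    rewrite /G normcN Normc.normcM Normc.normcV expr2 Normc.normcM -expr2.
    apply: ler_pM => //; rewrite ?sqr_ge0 ?invr_ge0 ?normc_ge0//.
    have V : m ^+ 2 + (complex.Im w - y) ^+ 2 <= 2 * nc ((w - z) * (w - zs)).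
      apply: vertical_kernel_ge => //.
        by apply: le_trans wz; rewrite /m ge_min lexx.
      apply: (@le_trans _ _ e); first by rewrite /m ge_min lexx orbT.
      by rewrite /e /=; lra.
    rewrite /P /poisson (_ : 2 / m * (m / _) = 2 / (m ^+ 2 + (complex.Im w - y) ^+ 2)); last first.
      by field; rewrite !gt_eqF.
    rewrite -[leLHS]mul1r ler_pdivrMr; last by lra.
    by rewrite mulrAC ler_pdivlMr// mul1r.
  have wr1 : nc (w - z) < r1.
    by apply: lt_trans wz _; rewrite gt_min; apply/orP; left; lra.
  have ws : nc (w - z) < s.
    by apply: lt_trans wz _; rewrite gt_min; apply/orP; right; lra.
  have GK : nc (G w) <= K.
    have qw : nc (q w) <= nc (q z) + 1.
      have := normcD (q w - q z) (q z); rewrite subrK.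
      by have := rP w wr1; lra.
    rewrite /G (Hq _ ws) Yz [1 + _ - 1]addrC addKr.
    have [->|wz0] := eqVneq w z.
      by rewrite subrr mulr0 expr0n/= mul0r oppr0 Normc.normc0.
    have wn := wzs0 w aw.
    rewrite (_ : _ / _ = q w * q w * (w - z) / (w - zs)); last first.
      by field; rewrite wn subr_eq0 wz0.
    rewrite normcN !Normc.normcM Normc.normcV -expr2 /K.
    apply: ler_pM; rewrite ?mulr_ge0 ?invr_ge0 ?normc_ge0//.
      apply: ler_pM; rewrite ?sqr_ge0 ?normc_ge0//; last exact: ltW.
      by rewrite ler_pXn2r// nnegrE ?addr_ge0 ?normc_ge0.
    rewrite lef_pV2 ?posrE ?normc_gt0//.
    apply: le_trans _ (Re_le_normc _); apply: le_trans _ (ler_norm _).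
    by rewrite Re_add Re_opp /e /=; lra.
  apply: (le_trans GK).
  have N0 : 0 <= nc (Y w) ^+ 2 by rewrite sqr_ge0.
  apply: (@le_trans _ _ (K * (m ^+ 2 + r ^+ 2) / m * P)); last first.
    rewrite ler_wpM2r// /B addrA lerDr addr_ge0// mulr_ge0//.
  rewrite /P /poisson (_ : _ / m * (m / _) =
    K * ((m ^+ 2 + r ^+ 2) / (m ^+ 2 + (complex.Im w - y) ^+ 2))); last first.
    by field; rewrite !gt_eqF.
  rewrite ler_peMr// ler_pdivlMr// mul1r lerD2l.
  have : `|complex.Im w - y| < r.
    by apply: le_lt_trans wz; rewrite -[_ - _]/(_ + _) /y -Im_opp -Im_add Im_le_normc.
  rewrite -[leLHS]real_normK ?num_real// => h.
  by rewrite ler_pXn2r// ?nnegrE// ltW.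
have aa x : a1 < x -> a < x by lra.
have mP D : 0 < D -> measurable_fun setT (fun t : R => poisson D (t - y)).
  by move=> D0; apply: continuous_measurable_fun; exact: continuous_poisson_shift.
have mN x : a1 < x -> measurable_fun setT (fun t : R => nc (Y (x +i* t)) ^+ 2).
  by move=> ax; apply: continuous_measurable_fun; exact: hol_continuous_sqr hY (aa _ ax).
have mRe x : a1 < x -> measurable_fun setT (fun t : R => complex.Re (G (x +i* t))).
  move=> ax; apply: continuous_measurable_fun => t.
  exact: (continuous_vertical (cderiv_ccont (dG (x +i* t) ax))).1.
have mG x : a1 < x -> measurable_fun setT (fun t : R => nc (G (x +i* t))).
  move=> ax; apply: continuous_measurable_fun => t.
  exact: (continuous_normc_vertical (cderiv_ccont (dG (x +i* t) ax))).
pose B1 := A * ((2 + 2 / m ^+ 2) * M * pi) + B * pi.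
have GB x : a1 < x -> (\int[mu]_t (nc (G (x +i* t)))%:E <= B1%:E)%E.
  move=> ax; apply: le_trans (ul2_poisson_affine y hY YM (aa _ ax) m0 A0 B0).
  apply: ge0_le_integral => //.
  - by move=> t _; rewrite lee_fin normc_ge0.
  - by apply/measurable_EFinP; exact: mG.
  - apply/measurable_EFinP; apply: measurable_funM; last exact: mP.
    apply: measurable_funD => //; apply: measurable_funM => //; exact: mN.
  - by move=> t _; rewrite lee_fin; exact: (Gle (x +i* t)).
pose J x := \int[mu]_t complex.Re (G (x +i* t)).
have Jle D : 1 <= D -> `|J (complex.Re z + D)| <= ((8 * M + 2) * pi) / D.
  move=> D1; have D0 : 0 < D by lra.
  have ax : a1 < complex.Re z + D by lra.
  pose k := 2 / D; have k0 : 0 <= k by rewrite divr_ge0// ltW.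
  have := ul2_poisson_affine y hY YM (aa _ ax) D0 k0 k0.
  set b := k * _ + _ => H.
  have bE : b <= ((8 * M + 2) * pi) / D.
    have -> : b = (2 * (2 + 2 / D ^+ 2) * M + 2) * pi / D.
      by rewrite /b /k; field; rewrite gt_eqF.
    rewrite ler_pM2r ?invr_gt0// ler_pM2r ?pi_gt0// lerD2r ler_wpM2r//.
    have : D ^- 2 <= 1 by rewrite invf_le1 ?exprn_gt0// exprn_ege1.
    by lra.
  apply: le_trans bE.
  apply: (dominated_integrableR (mRe _ ax) _ _ H).2.
    apply: measurable_funM; last exact: mP.
    apply: measurable_funD => //; apply: measurable_funM => //; exact: mN.
  move=> t; apply: le_trans (Re_le_normc _) _.
  set w := _ +i* t.
  have Dw : D ^+ 2 + (t - y) ^+ 2 <= nc ((w - z) * (w - zs)).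
    have S0 : 0 <= D ^+ 2 + (t - y) ^+ 2 by rewrite addr_ge0// sqr_ge0.
    rewrite -(ler_pXn2r (n := 2))// ?nnegrE ?normc_ge0//.
    rewrite Normc.normcM exprMn expr2; apply: ler_pM => //.
      rewrite normc_sqr !(Im_add, Im_opp, Re_add, Re_opp) /w /= -/y lerD2r.
      by rewrite [_ + D]addrC addrK.
    rewrite normc_sqr !(Im_add, Im_opp, Re_add, Re_opp) /w /= lerD2r.
    by rewrite /zs /=; apply: lerXn2r; rewrite ?nnegrE; lra.
  rewrite /G normcN Normc.normcM Normc.normcV expr2 Normc.normcM -expr2.
  rewrite (_ : k * _ + k = (2 * nc (Y w) ^+ 2 + 2) / D); last first.
    by rewrite /k; ring.
  rewrite /poisson (_ : _ / D * _ = (2 * nc (Y w) ^+ 2 + 2) / (D ^+ 2 + (t - y) ^+ 2)); last first.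
    by field; rewrite !gt_eqF// poisson_den_gt0.
  apply: ler_pM => //; rewrite ?sqr_ge0 ?invr_ge0 ?normc_ge0//.
  have P0 := poisson_den_gt0 (t - y) D0.
  by rewrite lef_pV2 ?posrE// (lt_le_trans P0).
have Jc : J c = 0.
  apply/eqP; rewrite -normr_le0; apply/ler_addgt0Pl => eps eps0; rewrite addr0.
  pose L := (8 * M + 2) * pi.
  have L0 : 0 <= L by rewrite mulr_ge0 ?pi_ge0// addr_ge0// mulr_ge0.
  pose D := L / eps + 1.
  have D1 : 1 <= D by rewrite /D lerDr divr_ge0// ltW.
  have -> : J c = J (complex.Re z + D).
    apply: (@line_shift _ _ a1 (complex.Re z + D + 1) B1); try lra.
      by move=> w /andP[aw _]; exact: dG.
    by move=> x /andP[ax _]; exact: GB.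
  apply: le_trans (Jle D D1) _; rewrite ler_pdivrMr; last by lra.
  by rewrite -/L /D mulrDr mulr1 [eps * _]mulrC divfK ?gt_eqF// lerDl ltW.
have mc : a1 < c by [].
pose N t := nc (Y (c +i* t)) ^+ 2; pose P t := poisson d (t - y).
have P0 t : 0 <= P t by exact: poisson_ge0.
have N0 t : 0 <= N t by exact: sqr_ge0.
have NPi : mu.-integrable setT (EFin \o (fun t => N t * P t)).
  have mNP : measurable_fun setT (fun t : R => N t * P t).
    by apply: measurable_funM; [exact: mN|exact: mP].
  apply: (dominated_integrableR mNP mNP _ (ul2_poisson y hY YM ac d0)).1.
  by move=> t; rewrite ger0_norm// mulr_ge0.
have Pi : mu.-integrable setT (EFin \o P).
  have e1 : (\int[mu]_t (P t)%:E <= pi%:E)%E by rewrite integral_poisson.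
  apply: (dominated_integrableR (mP _ d0) (mP _ d0) _ e1).1.
  by move=> t; rewrite ger0_norm; [|exact: P0].
have Gi : mu.-integrable setT (EFin \o (fun t => complex.Re (G (c +i* t)))).
  apply: (dominated_integrableR (mRe _ mc) (mG _ mc) _ (GB _ mc)).1 => t.
  exact: Re_le_normc.
(* [Re ((Y - 1) ^+ 2) + 3 * |Y| ^+ 2 = (4 * u - 1) ^+ 2 / 4 + 2 * v ^+ 2 + 3 / 4]
   for [Y = u + i v] *)
have point t : 2^-1 * P t <= d * complex.Re (G (c +i* t)) + 3 * (N t * P t).
  set w := c +i* t.
  have wE : (w - z) * (w - zs) = (- (d ^+ 2 + (t - y) ^+ 2))%:C.
    apply/eqP; rewrite eq_complex !(Re_mul, Im_mul, Im_add, Im_opp, Re_add, Re_opp) /= -/y.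
    by apply/andP; split; apply/eqP; rewrite /d; ring.
  rewrite /G wE; set Q := d ^+ 2 + (t - y) ^+ 2.
  have Q0 : 0 < Q by exact: poisson_den_gt0.
  have -> : - ((Y w - 1) ^+ 2 / (- Q)%:C) = (Y w - 1) ^+ 2 * (Q^-1)%:C.
    by rewrite rmorphN /= invrN mulrN opprK fmorphV.
  rewrite Re_mul /= mulr0 subr0 mulrA.
  have -> : d * complex.Re ((Y w - 1) ^+ 2) / Q = complex.Re ((Y w - 1) ^+ 2) * P t.
    by rewrite /P /poisson -/Q; ring.
  rewrite mulrA -mulrDl ler_wpM2r// /N normc_sqr expr2 Re_mul Re_add Im_add Re_opp Im_opp /= subr0.
  set u := complex.Re _; set v := complex.Im _.
  by have := sqr_ge0 (4 * u - 1); have := sqr_ge0 v; rewrite sqrrB; lra.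
have : \int[mu]_t (2^-1 * P t) <=
    \int[mu]_t (d * complex.Re (G (c +i* t)) + 3 * (N t * P t)).
  apply: le_Rintegral => //.
  - exact: (integrableZl measurableT 2^-1 Pi).
  - apply: (@integrableD _ _ _ mu setT measurableT
      (EFin \o (fun t => d * complex.Re (G (c +i* t)))) (EFin \o (fun t => 3 * (N t * P t)))).
      exact: (integrableZl measurableT d Gi).
    exact: (integrableZl measurableT 3 NPi).
rewrite RintegralD//; last 2 first.
  exact: (integrableZl measurableT d Gi).
  exact: (integrableZl measurableT 3 NPi).
have Jc0 : \int[mu]_t complex.Re (G (c +i* t)) = 0 by exact: Jc.
rewrite (RintegralZl _ measurableT Pi) (RintegralZl _ measurableT Gi).
rewrite (RintegralZl _ measurableT NPi) Jc0 mulr0 add0r.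
have -> : \int[mu]_t P t = pi by rewrite /Rintegral integral_poisson.
move=> h; rewrite -(fineK (integrable_fin_num measurableT NPi)) -EFinM lee_fin.
by move: h; rewrite /Rintegral /N /P; lra.
Qed.

(** Divide [H] by its value at [z]. The sharp constant is [1]; the [6] is the
    price of the numerator [(Y - 1) ^+ 2] in place of [Y ^+ 2 - 1], for which
    the differentiability of the quotient at [z] would be the removable
    singularity theorem. *)
Lemma poisson_sqr_bound H (a M : R) (z : R[i]) (c : R) :
  hol H a -> ul2 H a M -> a < c -> c < complex.Re z ->
  ((nc (H z) ^+ 2 * pi)%:E <= 6%:E * \int[mu]_t (nc (H (c +i* t)) ^+ 2 *
     poisson (complex.Re z - c) (t - complex.Im z))%:E)%E.
Proof.
move=> hH HM ac cz.
have P0 t : 0 <= poisson (complex.Re z - c) (t - complex.Im z).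
  by apply: poisson_ge0; rewrite subr_gt0.
have [H0|H0] := eqVneq (H z) 0.
  rewrite H0 Normc.normc0 expr0n/= mul0r mule_ge0// integral_ge0// => t _.
  by rewrite lee_fin mulr_ge0// sqr_ge0.
have h0 : 0 < nc (H z) by rewrite normc_gt0.
pose Y w := H w * (H z)^-1.
have nY w : nc (Y w) ^+ 2 = (nc (H z) ^+ 2)^-1 * nc (H w) ^+ 2.
  by rewrite /Y Normc.normcM Normc.normcV exprMn exprVn mulrC.
have mNn x : a < x -> measurable_fun setT (fun t : R => nc (H (x +i* t)) ^+ 2).
  by move=> ax; apply: continuous_measurable_fun; exact: hol_continuous_sqr hH ax.
have hY : hol Y a by move=> w aw; apply: cderivM; [exact: hH|exact: cderiv_cst].
have YM : ul2 Y a ((nc (H z) ^+ 2)^-1 * M).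
  move=> x t ax; under eq_integral do rewrite nY EFinM.
  rewrite ge0_integralZl//=.
  - by rewrite EFinM lee_wpmul2l ?lee_fin ?invr_ge0 ?sqr_ge0//; exact: HM.
  - apply/measurable_EFinP; apply: measurable_funTS.
    apply: (measurableT_comp (mNn x ax)); exact: measurable_funD.
  - by move=> u _; rewrite lee_fin sqr_ge0.
  - by rewrite lee_fin invr_ge0 sqr_ge0.
have := mean_value_lower_bound hY YM ac cz (divff H0).
under eq_integral do rewrite nY -mulrA EFinM.
rewrite ge0_integralZl//=.
- set I := (\int[mu]_t _)%E; rewrite muleCA => h.
  have -> : ((nc (H z) ^+ 2 * pi)%:E = (nc (H z) ^+ 2)%:E * pi%:E)%E by rewrite EFinM.
  have hz : 0 < nc (H z) ^+ 2 by rewrite exprn_gt0.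
  apply: (@le_trans _ _ ((nc (H z) ^+ 2)%:E * (((nc (H z) ^+ 2)^-1)%:E * (6%:E * I))))%E.
    by rewrite lee_wpmul2l// lee_fin ltW.
  by rewrite muleA -EFinM divff ?gt_eqF// mul1e.
- apply/measurable_EFinP; apply: measurable_funM; first exact: mNn.
  by apply: continuous_measurable_fun; apply: continuous_poisson_shift; rewrite subr_gt0.
- by move=> t _; rewrite lee_fin mulr_ge0// sqr_ge0.
- by rewrite lee_fin invr_ge0 sqr_ge0.
Qed.

End poisson_bound.

(** * Poisson means and the maximal function *)

Section poisson_maximal.
Context {R : realType}.
Notation mu := (@lebesgue_measure R).

Lemma integral_ball_HL (f : R -> R) (t r h : R) : 0 < r -> (forall u, 0 <= f u) ->
  (HL_maximal f t <= h%:E)%E ->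
  (\int[mu]_(u in ball t r) (f u)%:E <= (2 * r * h)%:E)%E.
Proof.
move=> r0 f0 Hh.
have : (iavg f (ball t r) <= h%:E)%E.
  apply: le_trans Hh; apply: ereal_sup_ubound; exists r => //.
  by rewrite /= in_itv/= r0.
have e : ((r *+ 2)%:E^-1 = ((r *+ 2)^-1)%:E)%E by rewrite inver mulrn_eq0/= gt_eqF.
rewrite /iavg (lebesgue_measure_ball _ (ltW r0)) e.
under eq_integral do rewrite /= ger0_norm//.
rewrite lee_pdivrMl; last by rewrite pmulrn_rgt0.
by rewrite -EFinM [2 * r]mulr_natl.
Qed.

(** The kernel is at most a sum, over the balls of radius [2 ^ k * d], of
    constants [4 / (4 ^ k * d)]; against the ball means of [f] these form a
    geometric series. *)
Lemma poisson_le_HL (f : R -> R) (d t h : R) : 0 < d -> 0 <= h -> continuous f ->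
  (forall u, 0 <= f u) -> (HL_maximal f t <= h%:E)%E ->
  (\int[mu]_u (f u * poisson d (u - t))%:E <= (16 * h)%:E)%E.
Proof.
move=> d0 h0 cf f0 Hh.
have mf : measurable_fun setT f by exact: continuous_measurable_fun.
pose c k : R := 4 / (4 ^+ k * d).
have c0 k : 0 <= c k by rewrite divr_ge0// mulr_ge0 ?exprn_ge0// ltW.
pose T k u : \bar R := ((c k)%:E * ((f \_ (ball t (2 ^+ k * d))) u)%:E)%E.
have fb0 k u : 0 <= (f \_ (ball t (2 ^+ k * d))) u by rewrite patchE; case: ifP.
have T0 k u : (0 <= T k u)%E by rewrite mule_ge0// lee_fin.
have mfb k : measurable_fun setT (EFin \o (f \_ (ball t (2 ^+ k * d)))).
  apply/measurable_EFinP; apply/measurable_restrict => //.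
    exact: measurable_ball.
  exact: measurable_funTS.
have mT k : measurable_fun setT (T k).
  by rewrite /T; apply: emeasurable_funM; [exact: measurable_cst|exact: mfb].
have point u : ((f u * poisson d (u - t))%:E <= \sum_(0 <= k <oo) T k u)%E.
  have ex : exists k, `|t - u| < 2 ^+ k * d.
    have [n] := exists_halving_lt `|t - u| d0.
    by rewrite ltr_pdivrMr ?exprn_gt0// mulrC; exists n.
  have [k tuk kmin] := ex_minnP ex.
  apply: (@le_trans _ _ (T k u)); last first.
    apply: (@le_trans _ _ (\sum_(0 <= j < k.+1) T j u)%E); last first.
      by apply: nneseries_lim_ge => j _ _; exact: T0.
    by rewrite big_nat_recr//= leeDr// sume_ge0.
  rewrite /T patchE mem_set// -EFinM lee_fin mulrC ler_wpM2r//.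
  rewrite /poisson /c ler_pdivrMr ?poisson_den_gt0// mulrAC ler_pdivlMr; last first.
    by rewrite mulr_gt0// exprn_gt0.
  case: k {tuk} kmin => [_|k kmin].
    by rewrite expr0 mul1r -expr2; have := sqr_ge0 (u - t); have := sqr_ge0 d; lra.
  have : ~~ (`|t - u| < 2 ^+ k * d).
    by apply/negP => /kmin; rewrite ltnn.
  rewrite -leNgt distrC => H.
  have : (2 ^+ k * d) ^+ 2 <= (u - t) ^+ 2.
    rewrite -(real_normK (num_real (u - t))) ler_pXn2r// nnegrE.
    by rewrite mulr_ge0 ?exprn_ge0// ltW.
  rewrite exprMn -exprM mulnC exprM (_ : 2 ^+ 2 = 4 :> R); last by rewrite expr2; ring.
  rewrite (_ : d * (4 ^+ k.+1 * d) = 4 * (4 ^+ k * d ^+ 2)); last by rewrite exprS; ring.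
  by have := sqr_ge0 d; lra.
apply: (@le_trans _ _ (\int[mu]_u \sum_(0 <= k <oo) T k u)%E).
  apply: ge0_le_integral => //.
  - by move=> u _; rewrite lee_fin mulr_ge0// poisson_ge0.
  - apply/measurable_EFinP; apply: measurable_funM => //.
    by apply: continuous_measurable_fun; exact: continuous_poisson_shift.
  - by apply: ge0_emeasurable_sum => [k u _ _|k _]; [exact: T0|exact: mT].
rewrite integral_nneseries//.
apply: le_trans (epsilon_trick0 xpredT _); last by rewrite mulr_ge0.
apply: lee_nneseries => [k _ _|k _]; first exact: integral_ge0.
rewrite /T ge0_integralZl//=; last 3 first.
  exact: mfb.
  by move=> u _; rewrite lee_fin.
  by rewrite lee_fin.
have -> : (\int[mu]_x ((f \_ (ball t (2 ^+ k * d))) x)%:E =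
    \int[mu]_(x in ball t (2 ^+ k * d)) (f x)%:E)%E.
  by rewrite [RHS]integral_mkcond restrict_EFin.
have r0 : 0 < 2 ^+ k * d by rewrite mulr_gt0// exprn_gt0.
apply: (@le_trans _ _ ((c k)%:E * (2 * (2 ^+ k * d) * h)%:E)%E).
  by rewrite lee_wpmul2l ?lee_fin//; exact: integral_ball_HL.
rewrite -EFinM lee_fin /c natrX exprS (_ : 4 = 2 ^+ 2 :> R); last by rewrite expr2; ring.
rewrite -exprM mulnC exprM le_eqVlt; apply/orP; left; apply/eqP.
by field; rewrite expf_neq0// gt_eqF.
Qed.

End poisson_maximal.

(** * Mean squares on lines decrease away from the edge *)

Section hardy_space.
Context {R : realType}.
Notation mu := (@lebesgue_measure R).
Notation nc := (@Normc.normc R).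
Variables (g : R[i] -> R[i]) (S : R).
Hypothesis hg : hol g 1.
Hypothesis gS : forall x, 1 < x -> (\int[mu]_t (nc (g (x +i* t)) ^+ 2)%:E <= S%:E)%E.

Definition sqnorm x : R := \int[mu]_t (nc (g (x +i* t)) ^+ 2).

Let N0 x t : 0 <= nc (g (x +i* t)) ^+ 2. Proof. exact: sqr_ge0. Qed.

Let mN x : 1 < x -> measurable_fun setT (fun t : R => nc (g (x +i* t)) ^+ 2).
Proof. by move=> x1; apply: continuous_measurable_fun; exact: hol_continuous_sqr hg x1. Qed.

Let Ni x : 1 < x -> mu.-integrable setT (EFin \o (fun t : R => nc (g (x +i* t)) ^+ 2)).
Proof.
move=> x1; apply: (dominated_integrableR (mN x1) (mN x1) _ (gS x1)).1 => t.
by rewrite ger0_norm.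
Qed.

Lemma sqnormE x : 1 < x -> (\int[mu]_t (nc (g (x +i* t)) ^+ 2)%:E = (sqnorm x)%:E)%E.
Proof. by move=> x1; rewrite /sqnorm /Rintegral fineK//; exact: integrable_fin_num (Ni x1). Qed.

Lemma sqnorm_ge0 x : 0 <= sqnorm x.
Proof. by apply: Rintegral_ge0 => t _. Qed.

Lemma sqnorm_le x : 1 < x -> sqnorm x <= S.
Proof. by move=> x1; rewrite -lee_fin -sqnormE//; exact: gS. Qed.

(** With [m] the midpoint of [x1] and [x2], the reflected function
    [w |-> (g (2 * m - w^* ))^*] is holomorphic. So the integral over a vertical
    line of its product with [g] is the same on the line [Re = x1], where it is
    the inner product of the traces of [g] on the lines through [x1] and [x2],
    and on the line [Re = m], where it is [sqnorm m]. *)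
Lemma sqnorm_polarization (x1 x2 : R) : 1 < x1 -> x1 <= x2 ->
  (\int[mu]_t (nc (g (x1 +i* t) - g (x2 +i* t)) ^+ 2)%:E =
   (sqnorm x1 + sqnorm x2 - 2 * sqnorm ((x1 + x2) / 2))%:E)%E.
Proof.
move=> x11 x12; have x21 : 1 < x2 by exact: lt_le_trans x12.
set m := (x1 + x2) / 2.
have m1 : 1 < m by rewrite /m; lra.
pose h w := g w * (g ((2 * m)%:C - w^*%C))^*%C.
have refl x t : (2 * m)%:C - (x +i* t)^*%C = (2 * m - x) +i* t :> R[i].
  by apply/eqP; rewrite eq_complex /= opprK add0r !eqxx.
have dh z : 1 < complex.Re z < 2 * m - 1 -> cderiv h z.
  move=> /andP[z1 z2]; apply: cderivM; first exact: hg.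
  apply: cderiv_reflect; apply: hg; rewrite Re_add Re_opp complexRe_conj /=; lra.
have hB x : 1 < x < 2 * m - 1 -> (\int[mu]_t (nc (h (x +i* t)))%:E <= (S + S)%:E)%E.
  move=> /andP[xx1 xx2]; have xx3 : 1 < 2 * m - x by lra.
  rewrite EFinD; apply: le_trans (leeD (gS xx1) (gS xx3)).
  rewrite -ge0_integralD//=; last 4 first.
    by move=> t _; rewrite lee_fin.
    by apply/measurable_EFinP; exact: mN.
    by move=> t _; rewrite lee_fin.
    by apply/measurable_EFinP; exact: mN.
  apply: ge0_le_integral => //.
  - by move=> t _; rewrite lee_fin normc_ge0.
  - apply/measurable_EFinP; apply: continuous_measurable_fun => t.
    apply: (continuous_normc_vertical (f := h)); apply: cderiv_ccont; apply: dh.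
    by rewrite /=; lra.
  - by apply: emeasurable_funD; apply/measurable_EFinP; exact: mN.
  - move=> t _; rewrite -EFinD lee_fin /h refl Normc.normcM normc_conj.
    set a := nc (g _); set b := nc (g _).
    by have := sqr_ge0 (a - b); have := sqr_ge0 a; have := sqr_ge0 b; rewrite sqrrB; lra.
have e1 : \int[mu]_t complex.Re (h (x1 +i* t)) = sqnorm m.
  rewrite (line_shift dh hB (c1 := x1) (c2 := m)) //; try by rewrite /m; lra.
  rewrite /sqnorm; apply: eq_Rintegral => t _; rewrite /h refl.
  rewrite (_ : 2 * m - m = m); last by ring.
  by rewrite Re_mul complexRe_conj complexIm_conj normc_sqr; ring.
have hi : mu.-integrable setT (EFin \o (fun t => complex.Re (h (x1 +i* t)))).
  have x1m : 1 < x1 < 2 * m - 1 by rewrite /m; lra.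
  apply: (dominated_integrableR _ _ _ (hB x1 x1m)).1.
  - apply: continuous_measurable_fun => t.
    by apply: (continuous_vertical (f := h) _).1; apply: cderiv_ccont; exact: dh.
  - apply: continuous_measurable_fun => t.
    by apply: (continuous_normc_vertical (f := h)); apply: cderiv_ccont; exact: dh.
  - by move=> t; exact: Re_le_normc.
have NNi : mu.-integrable setT (EFin \o (fun t : R => nc (g (x1 +i* t)) ^+ 2 + nc (g (x2 +i* t)) ^+ 2)).
  exact: (integrableD measurableT (Ni x11) (Ni x21)).
have h2i : mu.-integrable setT (EFin \o (fun t => 2 * complex.Re (h (x1 +i* t)))).
  exact: (integrableZl measurableT 2 hi).
have E : (fun t : R => nc (g (x1 +i* t) - g (x2 +i* t)) ^+ 2) =
    (fun t => nc (g (x1 +i* t)) ^+ 2 + nc (g (x2 +i* t)) ^+ 2 - 2 * complex.Re (h (x1 +i* t))).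
  apply/funext => t; rewrite /h refl (_ : 2 * m - x1 = x2); last by rewrite /m; field.
  by rewrite !normc_sqr Re_mul complexRe_conj complexIm_conj !(Re_add, Re_opp, Im_add, Im_opp); ring.
have Ei : mu.-integrable setT (EFin \o (fun t : R => nc (g (x1 +i* t) - g (x2 +i* t)) ^+ 2)).
  by rewrite E; exact: (integrableB measurableT NNi h2i).
transitivity ((\int[mu]_t (nc (g (x1 +i* t) - g (x2 +i* t)) ^+ 2))%:E).
  by rewrite /Rintegral fineK//; exact: (integrable_fin_num measurableT Ei).
congr EFin; rewrite (congr1 (Rintegral mu setT) E) RintegralB// RintegralD//; [|exact: Ni|exact: Ni].
by rewrite RintegralZl// e1.
Qed.

(** By polarization [sqnorm] is midpoint convex, and a bounded convex function on
    a half-line cannot increase. *)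
Lemma sqnorm_nonincreasing (x y : R) : 1 < x -> x <= y -> sqnorm y <= sqnorm x.
Proof.
move=> x1 xy; rewrite leNgt; apply/negP => lt.
set h := y - x; have h0 : 0 <= h by rewrite subr_ge0.
set dl := sqnorm y - sqnorm x; have dl0 : 0 < dl by rewrite subr_gt0.
have px n : 1 < x + n%:R * h by rewrite (lt_le_trans x1)// lerDl mulr_ge0.
have step n : sqnorm (x + n.+1%:R * h) - sqnorm (x + n%:R * h) >= dl.
  elim: n => [|n IHn]; first by rewrite mul1r mul0r addr0 /h [x + (y - x)]addrC subrK.
  have le2 : x + n%:R * h <= x + n.+2%:R * h by rewrite lerD2l ler_wpM2r// ler_nat -addn2 leq_addr.
  have := sqnorm_polarization (px n) le2.
  rewrite (_ : (_ + _) / 2 = x + n.+1%:R * h); last by rewrite -!natr1; field.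
  move=> e; have : (0 <= (sqnorm (x + n%:R * h) + sqnorm (x + n.+2%:R * h) -
      2 * sqnorm (x + n.+1%:R * h))%:E)%E.
    by rewrite -e integral_ge0// => t _; rewrite lee_fin sqr_ge0.
  by rewrite lee_fin; lra.
have grow n : sqnorm x + n%:R * dl <= sqnorm (x + n%:R * h).
  elim: n => [|n IHn]; first by rewrite !mul0r !addr0.
  have e : n.+1%:R * dl = n%:R * dl + dl by rewrite -natr1 mulrDl mul1r.
  by have := step n; rewrite e; lra.
pose n := Num.bound `|S / dl|.
have nS : S < n%:R * dl.
  rewrite -ltr_pdivrMr//; apply: le_lt_trans (ler_norm _) _; apply: archi_boundP.
  by rewrite normr_ge0.
have := grow n; have := sqnorm_le (px n); have := sqnorm_ge0 x; lra.
Qed.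

(** [sqnorm] is monotone and bounded, so it has a limit at the edge; by
    polarization, close values of [sqnorm] make the traces close. *)
Lemma sqnorm_cauchy (e : R) : 0 < e -> exists2 x0, 1 < x0 &
  forall x y, 1 < x -> x <= y -> y <= x0 ->
  (\int[mu]_t (nc (g (x +i* t) - g (y +i* t)) ^+ 2)%:E <= e%:E)%E.
Proof.
move=> e0; pose A := [set sqnorm x | x in [set x | 1 < x]].
have supA : has_sup A.
  split; first by exists (sqnorm 2), 2 => //=; rewrite ltr1n.
  by exists S => _ [x x1 <-]; exact: sqnorm_le.
have [_ [x0 /= x01 <-] lt] := sup_adherent (divr_gt0 e0 (ltr0n _ 2)) supA.
exists x0 => // x y x1 xy yx0; rewrite sqnorm_polarization// lee_fin.
have ub z : 1 < z -> sqnorm z <= sup A by move=> z1; apply: sup_upper_bound => //; exists z.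
have := ub x x1; have := ub y (lt_le_trans x1 xy).
have : sqnorm x0 <= sqnorm ((x + y) / 2) by apply: sqnorm_nonincreasing; lra.
lra.
Qed.

End hardy_space.

(** * Limits at the edge *)

Section right_limits.
Context {R : realType}.
Notation nc := (@Normc.normc R).
Notation C := (R[i]^o).
Implicit Types phi : R -> R[i].

Lemma near_rightP (P : set R) (a : R) : (\forall x \near a^'+, P x) <->
  exists2 r, 0 < r & forall x, a < x -> x < a + r -> P x.
Proof.
split=> [|[r r0 rP]].
  rewrite near_withinE => /nbhs_ballP[r /= r0 rP]; exists r => // x ax xar.
  by apply: rP => //; rewrite -ball_normE/= ltr_norml; lra.
near=> x; apply: rP; first by near: x; exact: nbhs_right_gt.
by near: x; apply: nbhs_right_lt; rewrite ltrDl.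
Unshelve. all: by end_near. Qed.

Lemma cvg_rightP phi (a : R) (l : R[i]) :
  ((phi s : C) @[s --> a^'+] --> (l : C)) <->
  forall e : R, 0 < e -> exists2 r : R, 0 < r &
    forall s, a < s -> s < a + r -> nc (phi s - l) < e.
Proof.
split=> [/(@cvgrPdist_lt _ C _ (a^'+) _) H e e0|H].
  have := H e%:C; rewrite ltcR => /(_ e0)/near_rightP[r r0 rP].
  by exists r => // s as' sr; rewrite -ltcR -normcB; exact: rP.
apply/(@cvgrPdist_lt _ C _ (a^'+) _) => _ /eps_complex[e e0 ->].
apply/near_rightP; have [r r0 rP] := H e e0.
by exists r => // s s1 s2; rewrite distrC; have := rP s s1 s2; rewrite -ltcR.
Qed.

Lemma cauchy_rightR (f : R -> R) (a : R) :
  (forall e : R, 0 < e -> exists c : R, exists2 r : R, 0 < r &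
    forall s, a < s -> s < a + r -> `|f s - c| < e) -> cvg (f s @[s --> a^'+]).
Proof.
move=> H; apply: cauchy_cvg; apply: cauchy_exP => e e0.
have [c [r r0 rP]] := H e e0; exists c; apply/near_rightP; exists r => // s s1 s2.
by rewrite -ball_normE/= distrC; exact: rP.
Qed.

Lemma cauchy_right phi (a : R) :
  (forall e : R, 0 < e -> exists c : R[i], exists2 r : R, 0 < r &
    forall s, a < s -> s < a + r -> nc (phi s - c) < e) ->
  cvg ((phi s : C) @[s --> a^'+]).
Proof.
move=> H.
have cR : cvg (complex.Re (phi s) @[s --> a^'+]).
  apply: cauchy_rightR => e /H[c [r r0 rP]]; exists (complex.Re c), r => // s s1 s2.
  by rewrite -Re_opp -Re_add; apply: le_lt_trans (Re_le_normc _) _; exact: rP.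
have cI : cvg (complex.Im (phi s) @[s --> a^'+]).
  apply: cauchy_rightR => e /H[c [r r0 rP]]; exists (complex.Im c), r => // s s1 s2.
  by rewrite -Im_opp -Im_add; apply: le_lt_trans (Im_le_normc _) _; exact: rP.
move: cR cI => /cvg_ex[/= u cu] /cvg_ex[/= v cv].
apply/cvg_ex; exists (u +i* v); apply/cvg_rightP => e e0.
have e20 : 0 < e / 2 by rewrite divr_gt0.
move/cvgrPdist_lt : cu => /(_ _ e20)/near_rightP[r1 r10 P1].
move/cvgrPdist_lt : cv => /(_ _ e20)/near_rightP[r2 r20 P2].
exists (Num.min r1 r2); first by rewrite lt_min r10.
move=> s s1 s2; apply: le_lt_trans (normc_le_ReIm _) _.
have s3 : s < a + r1 by apply: lt_le_trans s2 _; rewrite lerD2l ge_min lexx.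
have s4 : s < a + r2 by apply: lt_le_trans s2 _; rewrite lerD2l ge_min lexx orbT.
have := P1 s s1 s3; have := P2 s s1 s4; rewrite distrC => A2; rewrite distrC => A1.
by rewrite !(Re_add, Im_add, Re_opp, Im_opp) /=; lra.
Qed.

End right_limits.

Section radial_maximal.
Context {R : realType}.
Notation mu := (@lebesgue_measure R).
Notation nc := (@Normc.normc R).

(** The maximal inequality bounds the measure of the set where the maximal
    function of [nc (H (1 +i* t)) ^+ 2] exceeds [la]; off that set the Poisson
    means at every distance [e] are controlled, hence so are the values of
    [H]. *)
Lemma radial_maximal (H : R[i] -> R[i]) (a M rho la : R) : hol H a -> ul2 H a M ->
  a < 1 -> 0 < la -> (\int[mu]_t (nc (H (1 +i* t)) ^+ 2)%:E <= rho%:E)%E ->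
  exists E : set R, [/\ measurable E, (mu E <= (3 / la * rho)%:E)%E &
    forall t, ~ E t -> forall e, 0 < e -> nc (H ((1 + e) +i* t)) ^+ 2 <= 48 * la].
Proof.
move=> hH HM a1 la0 Hrho; pose N t := nc (H (1 +i* t)) ^+ 2.
have N0 t : 0 <= N t by exact: sqr_ge0.
have cN : continuous N by exact: hol_continuous_sqr hH a1.
have mN : measurable_fun setT N by exact: continuous_measurable_fun.
have Ni : mu.-integrable setT (EFin \o N).
  by apply: (dominated_integrableR mN mN _ Hrho).1 => t; rewrite ger0_norm.
have locN : locally_integrable setT N by apply: open_integrable_locally => //; exact: openT.
exists [set t | (la%:E < HL_maximal N t)%E]; split.
- rewrite -[X in measurable X]setTI; apply: emeasurable_fun_o_infty => //.
  exact: measurable_HL_maximal.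
- apply: le_trans (maximal_inequality locN la0) _.
  rewrite [leRHS]EFinM lee_wpmul2l//; first by rewrite lee_fin divr_ge0// ltW.
  by under eq_integral do rewrite gee0_abs ?lee_fin//.
move=> t /= /negP; rewrite -leNgt => HL e e0.
have z1 : (1 : R) < complex.Re ((1 + e) +i* t) by rewrite /=; lra.
have := poisson_sqr_bound hH HM a1 z1.
rewrite /= [1 + e - 1](_ : _ = e); last by ring.
move=> h.
have six : (0 <= 6%:E :> \bar R)%E by rewrite lee_fin.
have := le_trans h (lee_wpmul2l six (poisson_le_HL e0 (ltW la0) cN N0 HL)).
rewrite -EFinM lee_fin.
set x := _ ^+ 2 => hx; have p2 := @pi_ge2 R.
have x0 : 0 <= x by exact: sqr_ge0.
have : x * 2 <= x * pi by rewrite ler_wpM2l.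
lra.
Qed.

(** The bounds on consecutive differences telescope, uniformly in [e]. Letting
    [k] grow, [g ((y k + e) +i* t)] approximates [g ((1 + e) +i* t)] uniformly in
    [e], and for fixed [k] it converges as [e] tends to [0]. *)
Lemma radial_limit_of_shifts (g : R[i] -> R[i]) (y : R^nat) (K : nat) (t : R) :
  hol g 1 -> (forall k, 1 < y k) -> (forall k, y k <= 1 + 2^-1 ^+ k) ->
  (forall k e, (K <= k)%N -> 0 < e ->
    nc (g ((y k.+1 + e) +i* t) - g ((y k + e) +i* t)) <= 7 * 2^-1 ^+ k) ->
  has_boundary_value g t.
Proof.
move=> hg y1 y2 H.
have pos k : 0 < 2^-1 ^+ k :> R by rewrite exprn_gt0.
have tele k n e : (K <= k)%N -> 0 < e ->
    nc (g ((y (n + k)%N + e) +i* t) - g ((y k + e) +i* t)) <=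
      14 * 2^-1 ^+ k - 14 * 2^-1 ^+ (n + k).
  move=> Kk e0; elim: n => [|n IHn]; first by rewrite add0n !subrr Normc.normc0.
  have := H (n + k)%N e (leq_trans Kk (leq_addl _ _)) e0.
  rewrite addSn exprS; set u := g (_ +i* _); set v := g (_ +i* _) => h.
  have := normcD (u - v) (v - g ((y k + e) +i* t)); rewrite addrA subrK => h'.
  by move: IHn; rewrite -/v => IHn; lra.
have lim k e : (K <= k)%N -> 0 < e ->
    nc (g ((1 + e) +i* t) - g ((y k + e) +i* t)) <= 14 * 2^-1 ^+ k.
  move=> Kk e0; apply/ler_addgt0Pl => eta eta0.
  have /ccontP cg : ccont g ((1 + e) +i* t) by apply/cderiv_ccont/hg; rewrite /=; lra.
  have [r r0 rP] := cg eta eta0.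
  have [n nr] := exists_halving_lt 1 r0.
  have yn : nc ((y (n + k)%N + e) +i* t - (1 + e) +i* t) < r.
    apply: le_lt_trans (normc_le_ReIm _) _; rewrite /= subrr normr0 addr0.
    have := y1 (n + k)%N; have := y2 (n + k)%N => h1 h2.
    rewrite ger0_norm; last by lra.
    apply: le_lt_trans nr; rewrite mul1r -exprVn.
    apply: (@le_trans _ _ (2^-1 ^+ (n + k))); first by lra.
    by rewrite exprD ler_piMr ?(ltW (pos _))// exprn_ile1//; lra.
  have := rP _ yn; have := tele k n e Kk e0; have := pos (n + k)%N.
  set u := g (_ +i* _); set v := g (_ +i* _); set w := g _.
  have := normcD (w - u) (u - v); rewrite addrA subrK [nc (w - u)]normcB.
  lra.
apply: cauchy_right => e e0.
have e28 : 0 < e / 28 by rewrite divr_gt0.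
have [n nr] := exists_halving_lt 1 e28.
pose k := maxn K n; have Kk : (K <= k)%N by exact: leq_maxl.
have ke : 14 * 2^-1 ^+ k < e / 2.
  have : 2^-1 ^+ k <= 2^-1 ^+ n :> R by apply: ler_wiXn2l; rewrite ?leq_maxr//; lra.
  by move: nr; rewrite mul1r -exprVn; lra.
have e2 : 0 < e / 2 by rewrite divr_gt0.
have /ccontP cg : ccont g (y k +i* t) by apply/cderiv_ccont/hg; exact: y1.
have [r r0 rP] := cg (e / 2) e2.
exists (g (y k +i* t)), r => // s s1 sr.
have s0 : 0 < s - 1 by lra.
have := lim k (s - 1) Kk s0; rewrite [1 + (s - 1)]addrC subrK.
have : nc (g ((y k + (s - 1)) +i* t) - g (y k +i* t)) < e / 2.
  apply: rP; apply: le_lt_trans (normc_le_ReIm _) _; rewrite /= subrr normr0 addr0.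
  by rewrite [y k + _]addrC addrK ger0_norm; lra.
set u := g (_ +i* _); set v := g (_ +i* _); set w := g (_ +i* _).
have := normcD (v - w) (w - u); rewrite addrA subrK; lra.
Qed.

End radial_maximal.

(** * Existence of boundary values *)

Section fatou_theorem.
Context {R : realType}.
Notation mu := (@lebesgue_measure R).
Notation nc := (@Normc.normc R).
Notation C := (R[i]^o).

Lemma complex_shiftE (x t c : R) : (x +i* t) + c%:C = (x + c) +i* t.
Proof. by apply/eqP; rewrite eq_complex /= addr0 !eqxx. Qed.

Lemma Re_shift (w : R[i]) (c : R) : complex.Re (w + c%:C) = complex.Re w + c.
Proof. by case: w. Qed.

Lemma cderiv_shift (f : R[i] -> R[i]) (c : R) (w : R[i]) :
  cderiv f (w + c%:C) -> cderiv (fun w => f (w + c%:C)) w.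
Proof.
move=> df; apply: (cderiv_comp (g := fun w => w + c%:C)) => //.
by apply: cderivD; [exact: cderiv_id|exact: cderiv_cst].
Qed.

Variables (psi : R[i] -> R[i]) (M : R).
Hypothesis hpsi : hol psi 1.
Hypothesis psiM : ul2 psi 1 M.

(** Division by [w] turns uniform local square integrability into square
    integrability on each line, without changing the existence of limits. *)
Let g w := psi w * w^-1.

Let w0 (w : R[i]) : 1 < complex.Re w -> w != 0.
Proof. by apply: contraTneq => ->; rewrite /= -leNgt ler01. Qed.

Let hg : hol g 1.
Proof.
move=> w w1; apply: cderivM; first exact: hpsi.
by apply: cderivV; [exact: w0|exact: cderiv_id].
Qed.

Let g_le (w : R[i]) : 1 < complex.Re w ->
  nc (g w) ^+ 2 <= nc (psi w) ^+ 2 * poisson 1 (complex.Im w - 0).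
Proof.
move=> w1; rewrite /g Normc.normcM Normc.normcV exprMn ler_wpM2l ?sqr_ge0//.
rewrite /poisson mul1r exprVn normc_sqr subr0 expr1n.
have A : 0 < 1 + complex.Im w ^+ 2 by rewrite ltr_wpDr ?sqr_ge0.
have B : 1 + complex.Im w ^+ 2 <= complex.Re w ^+ 2 + complex.Im w ^+ 2.
  by rewrite lerD2r exprn_ege1// ltW.
by rewrite lef_pV2 ?posrE// (lt_le_trans A).
Qed.

Let poisson1_le1 (t : R) : poisson 1 t <= 1.
Proof.
rewrite /poisson mul1r expr1n invf_le1 ?ltr_wpDr ?sqr_ge0//.
by rewrite lerDl sqr_ge0.
Qed.

Let g_le_psi (w : R[i]) : 1 < complex.Re w -> nc (g w) ^+ 2 <= nc (psi w) ^+ 2.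
Proof.
by move=> /g_le h; apply: (le_trans h); rewrite ler_piMr ?sqr_ge0 ?poisson1_le1.
Qed.

Let S := (2 + 2 / 1 ^+ 2) * M * pi.

Let gS x : 1 < x -> (\int[mu]_t (nc (g (x +i* t)) ^+ 2)%:E <= S%:E)%E.
Proof.
move=> x1; apply: le_trans (ul2_poisson 0 hpsi psiM x1 ltr01).
apply: ge0_le_integral => //.
- by move=> t _; rewrite lee_fin sqr_ge0.
- apply/measurable_EFinP; apply: continuous_measurable_fun.
  exact: hol_continuous_sqr hg x1.
- apply/measurable_EFinP; apply: measurable_funM; apply: continuous_measurable_fun.
    exact: hol_continuous_sqr hpsi x1.
  exact: continuous_poisson_shift.
- by move=> t _; rewrite lee_fin; exact: (g_le (w := x +i* t)).
Qed.

(** Differences of two shifts of [g] inherit the hypothesis on [psi], so that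
    [radial_maximal] applies to them. *)
Let g_difference_ul2 (c d a : R) : 1 <= a + c -> 1 <= a + d ->
  ul2 (fun w => g (w + c%:C) - g (w + d%:C)) a (4 * M).
Proof.
move=> ac ad x t ax.
have xc : 1 < x + c by lra.
have xd : 1 < x + d by lra.
have m1 b : 1 < b -> measurable_fun setT (fun u : R => nc (psi (b +i* (t + u))) ^+ 2).
  move=> b1; apply: (measurableT_comp (f := fun t => nc (psi (b +i* t)) ^+ 2)).
    by apply: continuous_measurable_fun; exact: hol_continuous_sqr hpsi b1.
  exact: measurable_funD.
apply: (@le_trans _ _ (\int[mu]_(u in `[0%R, 1%R])
   (2%:E * (nc (psi ((x + c) +i* (t + u))) ^+ 2)%:E +
    2%:E * (nc (psi ((x + d) +i* (t + u))) ^+ 2)%:E))%E).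
  apply: ge0_le_integral => //.
  - by move=> u _; rewrite lee_fin sqr_ge0.
  - apply/measurable_EFinP; apply: measurable_funTS.
    apply: (measurableT_comp (f := fun t =>
       nc (g ((x +i* t) + c%:C) - g ((x +i* t) + d%:C)) ^+ 2)); last exact: measurable_funD.
    apply: continuous_measurable_fun.
    apply: (hol_continuous_sqr (H := fun w => g (w + c%:C) - g (w + d%:C)) (a := a)) => //.
    by move=> w aw; apply: cderivB; apply: cderiv_shift; apply: hg; rewrite Re_add /=; lra.
  - by apply: emeasurable_funD; apply: emeasurable_funM; try exact: measurable_cst;
      apply/measurable_EFinP; apply: measurable_funTS; exact: m1.
  move=> u _; rewrite !complex_shiftE -!EFinM -EFinD lee_fin.
  have := g_le_psi (w := (x + c) +i* (t + u)) xc.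
  have := g_le_psi (w := (x + d) +i* (t + u)) xd.
  set A := g _; set B := g _ => h1 h2.
  have := normcD B (- A); rewrite normcN => h.
  have : nc (B - A) ^+ 2 <= (nc B + nc A) ^+ 2.
    by rewrite ler_pXn2r// nnegrE ?addr_ge0 ?normc_ge0.
  by have := sqr_ge0 (nc B - nc A); rewrite sqrrB sqrrD; lra.
have mm b : 1 < b -> measurable_fun (`[0%R, 1%R] : set R)
    (fun u : R => (nc (psi (b +i* (t + u))) ^+ 2)%:E).
  by move=> b1; apply/measurable_EFinP; apply: measurable_funTS; exact: m1.
rewrite ge0_integralD//=; last 4 first.
  by move=> u _; rewrite -EFinM lee_fin mulr_ge0// sqr_ge0.
  by apply: emeasurable_funM; [exact: measurable_cst|exact: mm].
  by move=> u _; rewrite -EFinM lee_fin mulr_ge0// sqr_ge0.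
  by apply: emeasurable_funM; [exact: measurable_cst|exact: mm].
rewrite !ge0_integralZl//=; last 4 first.
  exact: mm.
  by move=> u _; rewrite lee_fin sqr_ge0.
  exact: mm.
  by move=> u _; rewrite lee_fin sqr_ge0.
rewrite (_ : (4 * M)%:E = 2%:E * M%:E + 2%:E * M%:E)%E; last first.
  by rewrite -!EFinM -EFinD; congr EFin; ring.
by apply: leeD; rewrite lee_wpmul2l//; apply: psiM.
Qed.

(** Choose abscissas [y k] decreasing to [1] along which the traces of [g] form
    so fast a Cauchy sequence in mean square that the exceptional sets [E k] of
    [radial_maximal] have summable measure. Almost every [t] lies in finitely
    many of them, and there [radial_limit_of_shifts] applies. *)
Lemma ae_has_boundary_value : {ae mu, forall t, has_boundary_value psi t}.
Proof.
(* mean square [8 ^- k] at level [4 ^- k]: the measure is of order [2 ^- k] and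
   the differences are at most [7 * 2 ^- k], as [48 <= 7 ^ 2] *)
pose rho k : R := 8^-1 ^+ k.
have rho0 k : 0 < rho k by rewrite exprn_gt0.
have fP k : {x0 | 1 < x0 /\ forall x y, 1 < x -> x <= y -> y <= x0 ->
    (\int[mu]_t (nc (g (x +i* t) - g (y +i* t)) ^+ 2)%:E <= (rho k)%:E)%E}.
  by apply: cid; have [x0 h1 h2] := sqnorm_cauchy hg gS (rho0 k); exists x0.
pose f k := sval (fP k).
have f1 k : 1 < f k by have [] := svalP (fP k).
pose fix y (k : nat) : R := if k is k'.+1 then Num.min (f k) (1 + (y k' - 1) / 2)
  else Num.min (f 0%N) 2.
have y1 k : 1 < y k.
  elim: k => [|k IHk] /=; rewrite lt_min f1//=; first by rewrite ltr1n.
  by rewrite ltrDl divr_gt0// subr_gt0.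
have yf k : y k <= f k by case: k => [|k] /=; rewrite ge_min lexx.
have ydec k : y k.+1 <= y k.
  by rewrite /= ge_min; apply/orP; right; have := y1 k; lra.
have y2 k : y k <= 1 + 2^-1 ^+ k.
  elim: k => [|k IHk]; first by rewrite /= ge_min expr0; apply/orP; right.
  by rewrite /= ge_min exprS; apply/orP; right; lra.
pose H k w := g (w + (y k.+1 - 1)%:C) - g (w + (y k - 1)%:C).
(* [H k] is the difference of the shifts by [y k.+1 - 1] and [y k - 1]; it is
   holomorphic to the right of [a k], which is less than [1] *)
pose a k := 2 - y k.+1.
have HE k x t : H k (x +i* t) = g ((x + (y k.+1 - 1)) +i* t) - g ((x + (y k - 1)) +i* t).
  by rewrite /H !complex_shiftE.
have E_ k : {E : set R | [/\ measurable E, (mu E <= (6 / (2 ^ k.+1)%:R)%:E)%E &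
    forall t, ~ E t -> forall e, 0 < e -> nc (H k ((1 + e) +i* t)) ^+ 2 <= 48 * 4^-1 ^+ k]}.
  apply: cid.
  have hH : hol (H k) (a k).
    move=> w aw; have := ydec k; have := y1 k.+1; rewrite /a in aw => ? ?.
    by apply: cderivB; apply: cderiv_shift; apply: hg; rewrite Re_shift; lra.
  have HM : ul2 (H k) (a k) (4 * M).
    by apply: g_difference_ul2; rewrite /a; have := ydec k; lra.
  have a1 : a k < 1 by have := y1 k.+1; rewrite /a; lra.
  have la0 : 0 < 4^-1 ^+ k :> R by rewrite exprn_gt0.
  have Hrho : (\int[mu]_t (nc (H k (1 +i* t)) ^+ 2)%:E <= (rho k)%:E)%E.
    have := (svalP (fP k)).2 (y k.+1) (y k) (y1 _) (ydec k) (yf k).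
    under eq_integral do rewrite -[y k.+1](subrK 1) -[y k](subrK 1).
    under [X in _ -> (X <= _)%E]eq_integral do rewrite HE [1 + _]addrC [1 + (y k - 1)]addrC.
    by [].
  have [E [mE muE EP]] := radial_maximal hH HM a1 la0 Hrho; exists E; split => //.
  apply: le_trans muE _; rewrite lee_fin le_eqVlt; apply/orP; left; apply/eqP.
  rewrite /rho natrX exprS !exprVn (_ : 8 = 2 * 4 :> R); last by ring.
  by rewrite exprMn; field; rewrite !expf_neq0.
pose E k := sval (E_ k).
have mE k : measurable (E k) by have [] := svalP (E_ k).
exists (lim_sup_set E); split.
- apply: bigcap_measurable => // n _; apply: bigcup_measurable => k _; exact: mE.
- apply: lim_sup_set_cvg0 => //.
  apply: (@le_lt_trans _ _ 6%:E); last exact: ltry.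
  have six : 0 <= 6 :> R by [].
  apply: le_trans (epsilon_trick0 xpredT six); apply: lee_nneseries => // k _.
  by have [] := svalP (E_ k).
move=> t /= nt; apply: contrapT => nE; apply: nt.
have {nE} [K KE] : exists K, forall k, (K <= k)%N -> ~ E k t.
  apply: contrapT => h; apply: nE => n _; apply: contrapT => h'.
  by apply: h; exists n => k nk Ekt; apply: h'; exists k.
have gt : has_boundary_value g t.
  apply: (radial_limit_of_shifts (y := y) (K := K)) => // k e Kk e0.
  have [_ _ /(_ t (KE k Kk) e e0)] := svalP (E_ k).
  rewrite HE (_ : 1 + e + (y k.+1 - 1) = y k.+1 + e); last by ring.
  rewrite (_ : 1 + e + (y k - 1) = y k + e); last by ring.
  have p7 : 0 <= 7 * 2^-1 ^+ k :> R by apply: mulr_ge0 => //; exact: exprn_ge0.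
  move=> h; rewrite -(ler_pXn2r (n := 2))// ?nnegrE ?normc_ge0//.
  apply: le_trans h _; rewrite exprMn -exprM mulnC exprM.
  rewrite (_ : 2^-1 ^+ 2 = 4^-1 :> R); last by rewrite expr2; field.
  by rewrite ler_wpM2r ?exprn_ge0// expr2; lra.
move: gt => /cvg_ex[/= l gl]; apply/cvg_ex; exists (l * (1 +i* t)).
have sl : ((s +i* t : C) @[s --> (1 : R)^'+] --> (1 +i* t : C)).
  apply/cvg_rightP => e e0; exists e => // s s1 s2.
  by apply: le_lt_trans (normc_le_ReIm _) _; rewrite /= subrr normr0 addr0 ger0_norm; lra.
apply: cvg_trans (@cvgM _ _ _ _ (fun s => g (s +i* t)) (fun s => s +i* t) _ _ gl sl).
apply: near_eq_cvg; apply/near_rightP; exists 1 => // s s1 _ /=.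
by rewrite /g mulfVK// w0.
Qed.

End fatou_theorem.

(** * Rotations of the half-plane *)

Section rotation.
Context {R : realType}.
Notation nc := (@Normc.normc R).

Definition rot_den (al : R) (s : R[i]) : R[i] :=
  (cos al)%:C + (0 +i* sin al) * (s - 1).

(** The elliptic rotation of the half-plane [Re > 1] about the point [2]: in
    the coordinate [1 +i* tan phi] of the edge it is the translation of [phi] by
    [al]. *)
Definition rot (al : R) (s : R[i]) : R[i] :=
  1 + ((s - 1) * (cos al)%:C + (0 +i* sin al)) / rot_den al s.

Lemma Re_div (z w : R[i]) : complex.Re (z / w) =
  (complex.Re z * complex.Re w + complex.Im z * complex.Im w) / nc w ^+ 2.
Proof. by rewrite normc_sqr; case: z w => a b [c d] /=; ring. Qed.

Lemma Re_rot_den al s : complex.Re (rot_den al s) = cos al - sin al * complex.Im s.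
Proof. by case: s => x y; rewrite /rot_den /=; ring. Qed.

Lemma Im_rot_den al s : complex.Im (rot_den al s) = sin al * (complex.Re s - 1).
Proof. by case: s => x y; rewrite /rot_den /=; ring. Qed.

Lemma rot_den_neq0 al s : 1 < complex.Re s -> rot_den al s != 0.
Proof.
move=> s1; apply/eqP => /eqP; rewrite eq_complex Re_rot_den Im_rot_den /=.
rewrite mulf_eq0 => /andP[/eqP h /orP[/eqP sa|/eqP]]; last by lra.
have := cos2Dsin2 al; rewrite sa mul0r subr0 in h *; rewrite h expr0n/= addr0 => /eqP.
by rewrite eq_sym oner_eq0.
Qed.

Lemma Re_rot al s : 1 < complex.Re s -> 1 < complex.Re (rot al s).
Proof.
move=> s1; have d0 := rot_den_neq0 al s1.
rewrite /rot Re_add ltrDl Re_div; apply: divr_gt0; last first.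
  by rewrite exprn_gt0// normc_gt0.
rewrite Re_rot_den Im_rot_den.
have -> : complex.Re ((s - 1) * (cos al)%:C + (0 +i* sin al)) = (complex.Re s - 1) * cos al.
  by case: s {s1 d0} => x y /=; ring.
have -> : complex.Im ((s - 1) * (cos al)%:C + (0 +i* sin al)) = complex.Im s * cos al + sin al.
  by case: s {s1 d0} => x y /=; ring.
rewrite (_ : _ + _ = (complex.Re s - 1) * (cos al ^+ 2 + sin al ^+ 2)); last by ring.
by rewrite cos2Dsin2 mulr1 subr_gt0.
Qed.

Lemma rot_center al : rot al 2%:R = 2%:R.
Proof.
have d0 : rot_den al 2%:R != 0 by apply: rot_den_neq0; rewrite /=; lra.
rewrite /rot; have -> : (2%:R - 1) * (cos al)%:C + (0 +i* sin al) = rot_den al 2%:R.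
  by rewrite /rot_den (_ : 2%:R - 1 = 1); [rewrite mul1r mulr1|ring].
by rewrite divff.
Qed.

Lemma cderiv_rot al s : rot_den al s != 0 -> cderiv (rot al) s.
Proof.
move=> d0.
have ds : cderiv (fun s => s - 1) s.
  by apply: cderivB; [exact: cderiv_id|exact: cderiv_cst].
apply: cderivD; first exact: cderiv_cst.
apply: cderivM.
  by apply: cderivD; [apply: cderivM; [|exact: cderiv_cst]|exact: cderiv_cst].
apply: cderivV => //; apply: cderivD; first exact: cderiv_cst.
by apply: cderivM => //; exact: cderiv_cst.
Qed.

Lemma cos_atan_gt0 (t : R) : 0 < cos (atan t).
Proof. by apply: cos_gt0_pihalf; have [] := atan_def t. Qed.

Lemma rot_den_boundary al (t : R) :
  rot_den al (1 +i* t) = (cos (atan t + al) / cos (atan t))%:C.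
Proof.
have c0 := cos_atan_gt0 t.
have tE : t = sin (atan t) / cos (atan t) by rewrite -[LHS]atanK /tan.
apply/eqP; rewrite eq_complex Re_rot_den Im_rot_den /= subrr mulr0 eqxx andbT.
apply/eqP; rewrite cosD {1}tE; field; exact: lt0r_neq0.
Qed.

Lemma rot_boundary al (t : R) : cos (atan t + al) != 0 ->
  rot al (1 +i* t) = 1 +i* tan (atan t + al).
Proof.
move=> ca; have c0 := lt0r_neq0 (cos_atan_gt0 t).
have tE : t = sin (atan t) / cos (atan t) by rewrite -[LHS]atanK /tan.
rewrite /rot rot_den_boundary -fmorphV.
have -> : (1 +i* t - 1) * (cos al)%:C + (0 +i* sin al) =
    0 +i* (sin (atan t + al) / cos (atan t)) :> R[i].
  apply/eqP; rewrite eq_complex /=; apply/andP; split; apply/eqP; first by ring.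
  rewrite subrr mul0r add0r oppr0 addr0 sinD {1}tE; field; exact: c0.
apply/eqP; rewrite eq_complex /=; apply/andP; split; apply/eqP; first by ring.
by rewrite /tan; field; rewrite ca c0.
Qed.

End rotation.

(** * Products of rotated copies of a function *)

Section vanishing_sequence.
Context {R : realType}.

(** Distances to the edge; starting at [1 / 2] keeps [1 + eps n] left of [2]. *)
Definition eps (n : nat) : R := n.+2%:R^-1.

Lemma eps_gt0 n : 0 < eps n. Proof. by rewrite invr_gt0 ltr0n. Qed.

Lemma eps_le n : eps n <= 2^-1.
Proof. by rewrite lef_pV2 ?posrE ?ltr0n// ler_nat. Qed.

Lemma cvg_eps : eps n @[n --> \oo] --> (0 : R).
Proof. by have := @cvg_harmonic R; rewrite -cvg_shiftS. Qed.

End vanishing_sequence.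

Section rotation_product.
Context {R : realType}.
Notation mu := (@lebesgue_measure R).
Notation nc := (@Normc.normc R).
Variables (F : R[i] -> R[i]) (a B D : R).
Hypothesis a1 : a < 1.
Hypothesis hF : hol F a.
Hypothesis FB : forall w, a < complex.Re w -> nc (F w) <= B.
Hypothesis B0 : 0 <= B.
Hypothesis FD : forall t, nc (F (1 +i* t)) ^+ 2 * (1 + t ^+ 2) <= D ^+ 2.
Hypothesis D0 : 0 <= D.

(** The modulus on the edge in the angular coordinate [t = tan phi]. The point
    at infinity is [cos phi = 0], where the decay of [F] makes [0] the continuous
    value. *)
Definition angular_modulus (phi : R) : R :=
  if cos phi == 0 then 0 else nc (F (1 +i* tan phi)).

Let W := angular_modulus.

Lemma angular_modulus_ge0 phi : 0 <= W phi.
Proof. by rewrite /W /angular_modulus; case: ifP => // _; exact: normc_ge0. Qed.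

Lemma angular_modulus_le_cos phi : W phi <= D * `|cos phi|.
Proof.
rewrite /W /angular_modulus; case: ifPn => [_|c0]; first by rewrite mulr_ge0.
rewrite -(ler_pXn2r (n := 2))// ?nnegrE ?normc_ge0 ?mulr_ge0//.
have := FD (tan phi); rewrite -cos2_tan2// exprMn real_normK ?num_real//.
by rewrite ler_pdivrMr // exprn_even_gt0.
Qed.

Lemma continuous_angular_modulus : continuous W.
Proof.
move=> phi; have [c0|c0] := eqVneq (cos phi) 0.
  rewrite /continuous_at {2}/W /angular_modulus c0 eqxx.
  apply: (@squeeze_cvgr _ _ _ _ (cst 0) (fun p => D * `|cos p|)).
  - by apply: nearW => p; rewrite angular_modulus_ge0 angular_modulus_le_cos.
  - exact: cvg_cst.
  - have nc0 : `|cos p| @[p --> phi] --> `|cos phi|.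
      by apply: cvg_norm; exact: continuous_cos.
    have : D * `|cos p| @[p --> phi] --> D * `|cos phi|.
      by apply: cvgM nc0; exact: cvg_cst.
    by rewrite c0 normr0 mulr0.
have cF : ccont F (1 +i* tan phi) by apply/cderiv_ccont/hF.
have cf : {for phi, continuous (fun p => nc (F (1 +i* tan p)))}.
  apply: (@continuous_comp _ _ _ tan (fun t => nc (F (1 +i* t)))).
    exact: continuous_tan.
  exact: continuous_normc_vertical.
rewrite /continuous_at {2}/W /angular_modulus (negbTE c0).
apply: cvg_trans cf; apply: near_eq_cvg.
near=> p; rewrite /W /angular_modulus ifF//; apply/negbTE.
near: p; apply: (@cvgr_neq0 _ _ _ _ _ cos (cos phi)) => //; exact: continuous_cos.
Unshelve. all: by end_near. Qed.

Lemma angular_modulusDpi phi : W (phi + pi) = W phi.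
Proof. by rewrite /W /angular_modulus cosDpi oppr_eq0 tanDpi. Qed.

Let Phi (al : seq R) s := \prod_(x <- al) F (rot x s).

Lemma normc_prod (I : Type) (s : seq I) (G : I -> R[i]) :
  nc (\prod_(i <- s) G i) = \prod_(i <- s) nc (G i).
Proof. by apply: (big_morph nc (@Normc.normcM R)); exact: Normc.normc1. Qed.

Let hPhi al : hol (Phi al) 1.
Proof.
move=> w w1; apply: cderiv_prod => x _; apply: (cderiv_comp (f := F)).
  by apply: cderiv_rot; exact: rot_den_neq0.
by apply: hF; exact: lt_trans (Re_rot x w1).
Qed.

Let Phi_le al w : 1 < complex.Re w -> nc (Phi al w) <= B ^+ size al.
Proof.
move=> w1; rewrite /Phi normc_prod; elim: al => [|x al IHal].
  by rewrite big_nil expr0.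
rewrite big_cons /= exprS; apply: ler_pM; rewrite ?normc_ge0//.
  by apply: prodr_ge0 => i _; exact: normc_ge0.
by apply: FB; exact: lt_trans (Re_rot x w1).
Qed.

Let Phi_ul2 al : ul2 (Phi al) 1 ((B ^+ size al) ^+ 2).
Proof.
move=> x t x1.
have mu01 : mu `[0%R, 1%R] = 1%E.
  by rewrite lebesgue_measure_itv/= lte_fin ltr01 -EFinB subr0.
apply: (@le_trans _ _ (\int[mu]_(u in `[0%R, 1%R]) cst ((B ^+ size al) ^+ 2)%:E u)%E).
  apply: ge0_le_integral => //.
  - by move=> u _; rewrite lee_fin sqr_ge0.
  - apply/measurable_EFinP; apply: measurable_funTS.
    apply: (measurableT_comp (f := fun t => nc (Phi al (x +i* t)) ^+ 2)).
      by apply: continuous_measurable_fun; exact: hol_continuous_sqr (hPhi al) x1.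
    exact: measurable_funD.
  - move=> u _; rewrite lee_fin ler_pXn2r// ?nnegrE ?normc_ge0 ?exprn_ge0//.
    exact: Phi_le.
by rewrite integral_cst// [X in (_ * X)%E](_ : _ = 1%E)// mule1.
Qed.

Lemma continuous_angular_product al :
  continuous (fun phi => \prod_(x <- al) W (phi + x) ^+ 2).
Proof.
elim: al => [|x al IHal] phi.
  rewrite (_ : (fun _ => _) = cst 1); last by apply/funext => ?; rewrite big_nil.
  exact: cst_continuous.
rewrite (_ : (fun _ => _) =
  (fun p => W (p + x) ^+ 2 * \prod_(x <- al) W (p + x) ^+ 2)); last first.
  by apply/funext => ?; rewrite big_cons.
apply: cvgM; last exact: IHal.
apply: (@continuous_comp _ _ _ (fun p => p + x) (fun p => W p ^+ 2)).
  by apply: cvgD; [exact: cvg_id|exact: cvg_cst].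
apply: (@continuous_comp _ _ _ W (fun p => p ^+ 2)); first exact: continuous_angular_modulus.
exact: exprn_continuous.
Qed.

(** [rot x] sends [1 +i* t] to infinity exactly when [t] is the cotangent of
    [x]. *)
Lemma ae_no_pole (al : seq R) :
  {ae mu, forall t, {in al, forall x, cos (atan t + x) != 0}}.
Proof.
exists [set` [seq cos x / sin x | x <- al]]; split.
- apply: countable_measurable => [t|]; first exact: measurable_set1.
  by apply: finite_set_countable; exact: finite_seq.
- by apply: countable_lebesgue_measure0; apply: finite_set_countable; exact: finite_seq.
move=> t /= H; apply: contrapT => nt; apply: H => x xal; apply/negP => /eqP c0.
apply: nt; apply/mapP; exists x => //.
have ca := cos_atan_gt0 t.
have := c0; rewrite cosD => /eqP; rewrite subr_eq0 => /eqP e.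
have tE : t = sin (atan t) / cos (atan t) by rewrite -[LHS]atanK /tan.
have e2 : cos x = t * sin x.
  by rewrite tE mulrAC -e mulrAC divff ?mul1r// gt_eqF.
have s0 : sin x != 0.
  apply/eqP => sx; have := cos2Dsin2 x; rewrite e2 sx mulr0 expr0n/= addr0 => /eqP.
  by rewrite eq_sym oner_eq0.
by rewrite e2 mulfK.
Qed.

Let del (n : nat) : R := eps n.

Let del_gt0 n : 0 < del n. Proof. exact: eps_gt0. Qed.

Let del_le n : del n <= 2^-1. Proof. exact: eps_le. Qed.

Let cvg_del : 1 + del n @[n --> \oo] --> (1 : R).
Proof. by rewrite -[X in _ --> X](addr0 1); apply: cvgD; [exact: cvg_cst|exact: cvg_eps]. Qed.

(** Apply [poisson_sqr_bound] at the fixed point [2] of the rotations to the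
    product of the functions [F \o rot x], whose value there is
    [F 2 ^+ size al]. It is only holomorphic up to poles on the edge, so the
    bound is taken on the lines [Re = 1 + eps n] and passes to the limit by
    dominated convergence. *)
Lemma rotation_product_bound (al : seq R) (Q : R) : 0 <= Q ->
  (forall t, \prod_(x <- al) W (atan t + x) ^+ 2 <= Q) ->
  nc (F 2%:R) ^+ (2 * size al) <= 6 * Q.
Proof.
move=> Q0 WQ.
have Phi2 : nc (Phi al 2%:R) ^+ 2 = nc (F 2%:R) ^+ (2 * size al).
  rewrite /Phi normc_prod (eq_bigr (fun=> nc (F 2%:R))); last first.
    by move=> x _; rewrite rot_center.
  by rewrite big_const_seq count_predT iter_mulr_1 -exprM mulnC.
pose f_ n t := nc (Phi al ((1 + del n) +i* t)) ^+ 2 * poisson (1 - del n) (t - 0).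
pose f t := \prod_(x <- al) W (atan t + x) ^+ 2 * poisson 1 (t - 0).
pose gg t := (B ^+ size al) ^+ 2 * 4 * poisson 1 (t - 0).
have d1 n : 0 < 1 - del n by have := del_le n; lra.
have x1 n : 1 < 1 + del n by rewrite ltrDl.
have mf_ n : measurable_fun setT (EFin \o f_ n).
  apply/measurable_EFinP; apply: measurable_funM; apply: continuous_measurable_fun.
    exact: hol_continuous_sqr (hPhi al) (x1 n).
  exact: continuous_poisson_shift.
have mf : measurable_fun setT (EFin \o f).
  apply/measurable_EFinP; apply: measurable_funM; apply: continuous_measurable_fun.
    move=> t; apply: (@continuous_comp _ _ _ atan (fun p => \prod_(x <- al) W (p + x) ^+ 2)).
      exact: continuous_atan.
    exact: continuous_angular_product.
  exact: continuous_poisson_shift.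
have mg : measurable_fun setT gg.
  apply: measurable_funM; first exact: measurable_cst.
  by apply: continuous_measurable_fun; exact: continuous_poisson_shift.
have Pg0 t : 0 <= poisson 1 (t - 0) by exact: poisson_ge0.
have gg0 t : 0 <= gg t.
  rewrite /gg; apply: mulr_ge0; last exact: Pg0.
  by apply: mulr_ge0 => //; exact: sqr_ge0.
have gi : mu.-integrable setT (EFin \o gg).
  have e1 : (\int[mu]_t (gg t)%:E <= ((B ^+ size al) ^+ 2 * 4 * pi)%:E)%E.
    under eq_integral do rewrite /gg EFinM.
    rewrite ge0_integralZl//=.
    - by rewrite EFinM integral_poisson.
    - by apply/measurable_EFinP; apply: continuous_measurable_fun; exact: continuous_poisson_shift.
    - by move=> t _; rewrite lee_fin; exact: Pg0.
    - by rewrite lee_fin; apply: mulr_ge0 => //; exact: sqr_ge0.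
  by apply: (dominated_integrableR mg mg _ e1).1 => t; rewrite ger0_norm.
have f_f : {ae mu, forall t, setT t -> (EFin \o f_ n) t @[n --> \oo] --> (EFin \o f) t}.
  have [N [mN N0 sN]] := ae_no_pole al; exists N; split => // t /= nt.
  apply: sN => /= np; apply: nt => _; apply: cvg_EFin; first exact: nearW.
  apply: cvgM; last first.
    have cp : {for (1 : R), continuous (fun d => poisson d (t - 0))}.
      apply: cvgM; first exact: cvg_id.
      apply: cvgV; first by rewrite gt_eqF// poisson_den_gt0.
      by apply: cvgD; [exact: exprn_continuous|exact: cvg_cst].
    have dd : 1 - del n @[n --> \oo] --> (1 : R).
      rewrite -[X in _ --> X](_ : 2 - 1 = 1); last by ring.
      rewrite (_ : (fun n => _) = (fun n => 2 - (1 + del n))); last first.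
        by apply/funext => n; ring.
      by apply: cvgB cvg_del; exact: cvg_cst.
    exact: (cvg_comp _ _ dd cp).
  have cPhi : ccont (Phi al) (1 +i* t).
    apply/cderiv_ccont/cderiv_prod => x xal; apply: (cderiv_comp (f := F)).
      apply: cderiv_rot; rewrite rot_den_boundary.
      by rewrite fmorph_eq0 mulf_neq0 ?np// invr_eq0 gt_eqF// cos_atan_gt0.
    by apply: hF; rewrite rot_boundary ?np.
  have -> : \prod_(x <- al) W (atan t + x) ^+ 2 = nc (Phi al (1 +i* t)) ^+ 2.
    rewrite /Phi normc_prod prodrXl; congr (_ ^+ 2).
    rewrite big_seq_cond [RHS]big_seq_cond; apply: eq_bigr => x /andP[xal _].
    by rewrite rot_boundary ?np// /W /angular_modulus (negbTE (np x xal)).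
  have cn := continuous_normc_horizontal cPhi.
  have := cvg_comp _ _ cvg_del cn.
  move=> h; exact: (cvg_comp _ _ h (@exprn_continuous R 2 _)).
have f_g : {ae mu, forall t n, setT t -> (`|(EFin \o f_ n) t| <= (EFin \o gg) t)%E}.
  apply: aeW => t n _ /=; rewrite lee_fin /f_ /gg ger0_norm; last first.
    by rewrite mulr_ge0 ?sqr_ge0// poisson_ge0.
  rewrite -[leRHS]mulrA; apply: ler_pM; rewrite ?sqr_ge0 ?poisson_ge0//.
    rewrite ler_pXn2r// ?nnegrE ?normc_ge0 ?exprn_ge0//.
    by apply: Phi_le; exact: x1.
  rewrite /poisson subr0 ler_pdivrMr ?poisson_den_gt0// expr1n mul1r.
  have t0 := sqr_ge0 t.
  rewrite mulrAC ler_pdivlMr; last by rewrite ltr_wpDr.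
  have := del_le n; have := del_gt0 n; set d := del n => h1 h2.
  have : (1 - d) * (1 + t ^+ 2) <= 1 * (1 + t ^+ 2) by rewrite ler_wpM2r; lra.
  by have : 4^-1 <= (1 - d) ^+ 2; [rewrite expr2; nra|nra].
have [_ _ H] := @dominated_convergence _ _ _ mu setT measurableT _ _ _
  mf_ mf f_f gi f_g.
have L : (\int[mu]_t (f t)%:E <= (Q * pi)%:E)%E.
  rewrite EFinM -(integral_poisson 0 ltr01) -ge0_integralZl//=; last 2 first.
    by apply/measurable_EFinP; apply: continuous_measurable_fun; exact: continuous_poisson_shift.
    by move=> t _; rewrite lee_fin; exact: Pg0.
  apply: ge0_le_integral => //.
  - move=> t _; rewrite lee_fin; apply: mulr_ge0; last exact: Pg0.
    by apply: prodr_ge0 => x _; exact: sqr_ge0.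
  - apply: emeasurable_funM; first exact: measurable_cst.
    by apply/measurable_EFinP; apply: continuous_measurable_fun; exact: continuous_poisson_shift.
  - move=> t _; rewrite -EFinM lee_fin; apply: ler_wpM2r; [exact: Pg0|exact: WQ].
have low n : ((nc (F 2%:R) ^+ (2 * size al) * pi / 6)%:E <= \int[mu]_t (f_ n t)%:E)%E.
  have c2 : 1 + del n < complex.Re (2%:R : R[i]) by rewrite /=; have := del_le n; lra.
  have := poisson_sqr_bound (hPhi al) (@Phi_ul2 al) (x1 n) c2.
  rewrite Phi2 (_ : complex.Re _ - _ = 1 - del n); last by rewrite /=; ring.
  rewrite (_ : complex.Im _ = 0) ?[complex.Im _]/= ?addr0// => h.
  by rewrite EFinM lee_pdivrMr// muleC.
have : ((nc (F 2%:R) ^+ (2 * size al) * pi / 6)%:E <= (Q * pi)%:E)%E.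
  apply: le_trans L; rewrite -(cvg_lim _ H)//; apply: lime_ge.
    by apply/cvg_ex; eexists; exact: H.
  by apply: nearW => n; exact: low.
by rewrite lee_fin ler_pdivrMr// mulrAC ler_pM2r ?pi_gt0// mulrC.
Qed.

End rotation_product.

(** * Riemann sums and the angular coordinate *)

Section riemann_sums.
Context {R : realType}.
Notation mu := (@lebesgue_measure R).
Implicit Types V : R -> R.

(** [rectangle_induction] on a segment, taken as a degenerate rectangle. *)
Lemma segment_uniform_continuity V (A B tau : R) : continuous V -> A <= B -> 0 < tau ->
  exists2 rho, 0 < rho & forall x y, A <= x <= B -> `|y - x| < rho ->
    `|V y - V x| <= tau.
Proof.
move=> cV AB tau0.
apply: (rectangle_induction (c0 := 0) (d0 := 0) (P := fun a b _ _ =>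
  exists2 rho, 0 < rho & forall x y, a <= x <= b -> `|y - x| < rho ->
    `|V y - V x| <= tau) AB (lexx 0)).
- move=> a b c d _ ab _ _ _ _ m n [r1 r10 h1] [r2 r20 h2] _ _.
  exists (Num.min r1 r2); first by rewrite lt_min r10.
  move=> x y /andP[ax xb]; rewrite lt_min => /andP[y1 y2].
  have [xm|mx] := leP x m; first by apply: h1 => //; rewrite ax.
  by apply: h2 => //; rewrite (ltW mx).
- move=> x y0 _ _.
  have t2 : 0 < tau / 2 by rewrite divr_gt0.
  move/cvgrPdist_lt : (cV x) => /(_ _ t2)/nbhs_ballP[r /= r0 rP].
  exists (r / 2); first by rewrite divr_gt0.
  move=> a b c d _ _ _ _ /andP[ax xb] _ bar _.
  exists (r / 2); first by rewrite divr_gt0.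
  move=> u v /andP[au ub] uv.
  have hu : ball x r u by rewrite -ball_normE/= ltr_norml; lra.
  have hv : ball x r v by rewrite -ball_normE/= ltr_norml; rewrite ltr_norml in uv; lra.
  have := rP _ hu; have := rP _ hv; rewrite !ltr_norml ler_norml; lra.
Qed.

Lemma continuous_integrable_seg V (a b : R) : continuous V ->
  mu.-integrable `[a, b] (EFin \o V).
Proof.
move=> cV; apply: continuous_compact_integrable; first exact: segment_compact.
exact: continuous_subspaceT.
Qed.

Lemma riemann_sum_le V (A B tau h phi : R) (N : nat) : continuous V -> 0 <= h ->
  (forall x y, A <= x <= B -> `|y - x| <= h -> `|V y - V x| <= tau) ->
  A <= phi -> phi + N%:R * h <= B ->
  \sum_(k < N) V (phi + k%:R * h) * h <= seg V phi (phi + N%:R * h) + tau * (N%:R * h).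
Proof.
move=> cV h0 Vt Ap; elim: N => [|N IHN] pB.
  by rewrite big_ord0 mul0r addr0 mulr0 addr0 /seg set_itv1 Rintegral_set1.
have Nh : N%:R * h + h = N.+1%:R * h by rewrite -natr1 mulrDl mul1r.
have Nh0 : 0 <= N%:R * h by rewrite mulr_ge0.
rewrite big_ord_recr /= -Nh.
rewrite (@seg_split _ _ phi (phi + N%:R * h)); last 3 first.
  by rewrite lerDl.
  by rewrite lerD2l lerDl.
  exact: continuous_integrable_seg.
rewrite -Nh in pB.
have {}IHN := IHN ltac:(lra).
have := @seg_near _ V (V (phi + N%:R * h)) tau (phi + N%:R * h) (phi + (N%:R * h + h)).
rewrite [X in V _ * X](_ : _ = h); last by ring.
rewrite [X in tau * X](_ : _ = h); last by ring.
have le1 : phi + N%:R * h <= phi + (N%:R * h + h) by lra.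
move=> /(_ le1 (continuous_integrable_seg _ _ cV)) H.
have {H} : `|seg V (phi + N%:R * h) (phi + (N%:R * h + h)) - V (phi + N%:R * h) * h| <= tau * h.
  apply: H => x /andP[x1 x2]; apply: Vt; first by apply/andP; split; lra.
  by rewrite ler_norml; lra.
rewrite ler_norml mulrDr; lra.
Qed.

Lemma seg_substitution V (F F' : R -> R) (a b : R) : a <= b ->
  (forall x, is_derive x (1 : R) F (F' x)) -> continuous F' ->
  {homo F : x y / x < y} -> continuous V ->
  seg V (F a) (F b) = seg (fun x => V (F x) * F' x) a b.
Proof.
move=> ab dF cF' mF cV; have F'E : derive1 F = F'.
  by apply/funext => x; rewrite derive1E derive_val.
have cF : continuous F.
  by move=> x; apply: differentiable_continuous; apply/derivable1_diffP; exact: ex_derive.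
rewrite /seg /Rintegral (integration_by_substitution_increasing (F := F))//.
- by congr fine; apply: eq_integral => x _; rewrite F'E.
- by move=> x y _ _; exact: mF.
- by rewrite F'E => x _; exact: cF'.
- by rewrite F'E; apply/cvg_ex; exists (F' a); apply: cvg_at_right_filter; exact: cF'.
- by rewrite F'E; apply/cvg_ex; exists (F' b); apply: cvg_at_left_filter; exact: cF'.
- split; first by move=> x _; exact: ex_derive.
    by apply: cvg_at_right_filter; exact: cF.
  by apply: cvg_at_left_filter; exact: cF.
- exact: continuous_subspaceT.
Qed.

Lemma seg_period V (p phi : R) : 0 <= p -> continuous V -> (forall x, V (x + p) = V x) ->
  - (p / 2) <= phi <= p / 2 -> seg V phi (phi + p) = seg V (- (p / 2)) (p / 2).
Proof.
move=> p0 cV Vp /andP[p1 p2].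
have i a b : mu.-integrable `[a, b] (EFin \o V) by exact: continuous_integrable_seg.
rewrite (@seg_split _ _ phi (p / 2)) ?i//; last by lra.
rewrite (@seg_split _ _ (- (p / 2)) phi)// addrC; congr (_ + _).
have E : seg V (- (p / 2) + p) (phi + p) = seg (fun x => V (x + p) * cst 1 x) (- (p / 2)) phi.
  apply: (@seg_substitution V (fun x => x + p) (cst 1)) => //.
  - by move=> x; apply: is_derive_eq; rewrite addr0.
  - by move=> x; exact: cst_continuous.
  - by move=> x y xy; rewrite ltrD2r.
rewrite (_ : - (p / 2) + p = p / 2) in E; last by field.
by rewrite E; congr (Rintegral _ _ _); apply/funext => x; rewrite Vp mulr1.
Qed.

Lemma weight_ge0 (t : R) : 0 <= (1 + t ^+ 2)^-1.
Proof. by rewrite invr_ge0 addr_ge0// sqr_ge0. Qed.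

Lemma continuous_weight : continuous (fun t : R => (1 + t ^+ 2)^-1).
Proof. exact: (@continuous_oneDsqrV R). Qed.

Lemma bounded_weight_integrable (g : R -> R) (K : R) : measurable_fun setT g ->
  (forall t, `|g t| <= K) ->
  mu.-integrable setT (EFin \o (fun t : R => g t * (1 + t ^+ 2)^-1)).
Proof.
move=> mg gK; have K0 : 0 <= K by apply: le_trans (gK 0).
have mD : measurable_fun setT (fun t : R => (1 + t ^+ 2)^-1).
  by apply: continuous_measurable_fun; exact: continuous_weight.
have e1 : (\int[mu]_t (K * (1 + t ^+ 2)^-1)%:E <= (K * pi)%:E)%E.
  under eq_integral do rewrite EFinM.
  rewrite ge0_integralZl//=.
  - by rewrite integral_poisson1 EFinM.
  - exact/measurable_EFinP.
  - by move=> t _; rewrite lee_fin; exact: weight_ge0.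
apply: (dominated_integrableR _ _ _ e1).1.
- exact: measurable_funM.
- by apply: measurable_funM => //; exact: measurable_cst.
- by move=> t; rewrite normrM [`|_^-1|]ger0_norm ?weight_ge0// ler_wpM2r// weight_ge0.
Qed.

Lemma atan_weight_integrable V (K : R) : continuous V -> (forall x, `|V x| <= K) ->
  mu.-integrable setT (EFin \o (fun t => V (atan t) * (1 + t ^+ 2)^-1)).
Proof.
move=> cV VK; apply: (@bounded_weight_integrable (fun t => V (atan t)) K) => //.
apply: continuous_measurable_fun => t.
by apply: (@continuous_comp _ _ _ atan V); [exact: continuous_atan|exact: cV].
Qed.

(** Substitute [t = tan x] on [- n, n] and let [n] grow; boundedness of [V]
    makes the two missing end pieces small. *)
Lemma seg_atan V (K : R) : continuous V -> (forall x, `|V x| <= K) ->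
  seg V (- (pi / 2)) (pi / 2) = \int[mu]_t (V (atan t) * (1 + t ^+ 2)^-1).
Proof.
move=> cV VK; have K0 : 0 <= K by apply: le_trans (VK 0).
have i a b : mu.-integrable `[a, b] (EFin \o V) by exact: continuous_integrable_seg.
pose u n := seg (fun t => V (atan t) * (1 + t ^+ 2)^-1) (- n%:R) n%:R.
have lim : u n @[n --> \oo] --> \int[mu]_t (V (atan t) * (1 + t ^+ 2)^-1).
  by apply: cvg_seg_line => //; exact: atan_weight_integrable VK.
have uE n : u n = seg V (- atan n%:R) (atan n%:R).
  have nn : - n%:R <= n%:R :> R by have := ler0n R n; lra.
  rewrite -atanN (@seg_substitution V atan (fun t => (1 + t ^+ 2)^-1))//.
  - by move=> t; exact: (@continuous_oneDsqrV R).
  - exact: lt_atan.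
have [H1 H2] : (forall n, atan n%:R <= pi / 2 :> R) /\ (forall n, 0 <= atan n%:R :> R).
  by split=> n; [exact/ltW/atan_ltpi2|rewrite -[leLHS](@atan0 R) le_atan].
have bound a b : a <= b -> `|seg V a b| <= K * (b - a).
  move=> ab; have := @seg_near _ V 0 K a b ab (i a b).
  by rewrite mul0r subr0; apply => x _; rewrite subr0.
have d n : `|seg V (- (pi / 2)) (pi / 2) - u n| <= 2 * K * (pi / 2 - atan n%:R).
  have a1 := H1 n; have a2 := H2 n; set al := atan n%:R in a1 a2 *.
  rewrite uE -/al (@seg_split _ _ (- (pi / 2)) (- al)) ?i//; [|lra|lra].
  rewrite (@seg_split _ _ (- al) al) ?i//; [|lra].
  have b1 := bound (- (pi / 2)) (- al); have b2 := bound al (pi / 2).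
  have {}b1 := b1 ltac:(lra); have {}b2 := b2 ltac:(lra).
  move: b1 b2; rewrite !ler_norml; lra.
have lim2 : u n @[n --> \oo] --> seg V (- (pi / 2)) (pi / 2).
  apply/cvgrPdist_le => e e0.
  have L : K * 2 + 1 > 0 by lra.
  have e' : 0 < e / (K * 2 + 1) by rewrite divr_gt0.
  move/cvgrPdist_lt : (@cvgy_atan R) => /(_ _ e')[A [Ar AP]].
  near=> n; apply: (le_trans (d n)).
  have := AP n%:R; rewrite ger0_norm ?subr_ge0// => h.
  have {}h : pi / 2 - atan n%:R < e / (K * 2 + 1).
    by apply: h; near: n; exact: nbhs_infty_gtr.
  rewrite ltr_pdivlMr// in h; have := H1 n; nra.
exact: (cvg_unique _ lim2 lim).
Unshelve. all: by end_near. Qed.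

End riemann_sums.

(** * Jensen's inequality *)

Section jensen.
Context {R : realType}.
Notation mu := (@lebesgue_measure R).
Notation nc := (@Normc.normc R).

(** Apply [rotation_product_bound] to the [N] rotations by the angles [k * h],
    [h = pi / N]. At the edge the logarithm of the product is [N / pi] times a
    Riemann sum of [V] over a period, so that
    [2 * N * ln |F 2| <= ln 6 + (2 * N / pi) * (I + o(1))]. Dividing by [N]
    removes the constant [6]. The regularization [eta] keeps [V] continuous
    where [F] vanishes. *)
Lemma jensen_decaying (F : R[i] -> R[i]) (a B D eta : R) : a < 1 -> hol F a ->
  (forall w, a < complex.Re w -> nc (F w) <= B) ->
  (forall t, nc (F (1 +i* t)) ^+ 2 * (1 + t ^+ 2) <= D ^+ 2) -> 0 <= D ->
  0 < eta -> F 2%:R != 0 ->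
  pi * ln (nc (F 2%:R)) <=
  \int[mu]_t (ln (nc (F (1 +i* t)) ^+ 2 + eta) / 2 * (1 + t ^+ 2)^-1).
Proof.
move=> a1 hF FB FD D0 eta0 F20.
have B0 : 0 <= B.
  by apply: le_trans (normc_ge0 _) (FB 2%:R _); rewrite /=; lra.
pose W := angular_modulus F; pose V p : R := ln (W p ^+ 2 + eta) / 2.
have W0 p : 0 <= W p ^+ 2 by exact: sqr_ge0.
have cW : continuous W by exact: continuous_angular_modulus a1 hF FD D0.
have cV : continuous V.
  move=> p; apply: cvgM; last exact: cvg_cst.
  apply: (@continuous_comp _ _ _ (fun p => W p ^+ 2 + eta) (@ln R)); last first.
    by apply: continuous_ln; rewrite ltr_wpDl.
  apply: cvgD; last exact: cvg_cst.
  apply: (@continuous_comp _ _ _ W (fun x => x ^+ 2)); [exact: cW|exact: exprn_continuous].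
have Vpi p : V (p + pi) = V p by rewrite /V /W angular_modulusDpi.
pose K := `|ln (D ^+ 2 + eta)| + `|ln eta|.
have VK p : `|V p| <= K.
  have h1 : ln eta <= ln (W p ^+ 2 + eta).
    by rewrite ler_ln ?posrE ?ltr_wpDl// lerDr.
  have h2 : ln (W p ^+ 2 + eta) <= ln (D ^+ 2 + eta).
    rewrite ler_ln ?posrE ?ltr_wpDl ?sqr_ge0// lerD2r.
    rewrite ler_pXn2r// ?nnegrE ?angular_modulus_ge0//.
    apply: le_trans (angular_modulus_le_cos FD D0 p) _.
    by rewrite ler_piMr// ler_norml cos_geN1 cos_le1.
  have := ler_norm (ln (D ^+ 2 + eta)); have := ler_norm (- ln eta); rewrite normrN.
  have := normr_ge0 (ln (D ^+ 2 + eta)); have := normr_ge0 (ln eta).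
  rewrite /K /V ler_norml; lra.
have -> : \int[mu]_t (ln (nc (F (1 +i* t)) ^+ 2 + eta) / 2 * (1 + t ^+ 2)^-1) =
    seg V (- (pi / 2)) (pi / 2).
  rewrite (seg_atan cV VK); apply: eq_Rintegral => t _; rewrite /V /W /angular_modulus.
  by rewrite gt_eqF ?cos_atan_gt0// atanK.
set I := seg V _ _.
have p0 := @pi_gt0 R.
suff small tau : 0 < tau -> pi * ln (nc (F 2%:R)) <= I + tau * (1 + pi).
  apply/ler_addgt0Pl => e e0.
  have e1 : 0 < e / (1 + pi) by rewrite divr_gt0//; lra.
  have := small _ e1; rewrite divfK; last by rewrite gt_eqF//; lra.
  by rewrite addrC.
move=> tau0.
have le3 : - (pi / 2) <= 3 * (pi / 2) :> R by lra.
have [rho rho0 rhoP] := segment_uniform_continuity cV le3 tau0.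
pose n0 := Num.bound (`|pi / rho| + `|pi * ln 6 / tau|).
pose N := n0.+1; have N0 : 0 < N%:R :> R by rewrite ltr0n.
have NP : `|pi / rho| + `|pi * ln 6 / tau| < N%:R.
  apply: lt_trans (archi_boundP _) _; first by rewrite addr_ge0.
  by rewrite ltr_nat.
have N1 : pi / rho < N%:R.
  by apply: le_lt_trans NP; apply: le_trans (ler_norm _) _; rewrite lerDl.
have N2 : pi * ln 6 / tau < N%:R.
  by apply: le_lt_trans NP; apply: le_trans (ler_norm _) _; rewrite lerDr.
pose h : R := pi / N%:R; have h0 : 0 < h by rewrite divr_gt0.
have Nh : N%:R * h = pi by rewrite /h mulrC divfK// gt_eqF.
have hr : h < rho by rewrite /h ltr_pdivrMr// mulrC -ltr_pdivrMr.
pose al : seq R := [seq k%:R * h | k <- iota 0 N].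
pose Q : R := expR (2 * (N%:R / pi) * (I + tau * pi)).
have WQ t : \prod_(x <- al) W (atan t + x) ^+ 2 <= Q.
  have [/andP[t1 t2] _] := atan_def t; set p := atan t in t1 t2 *.
  (* the sum starts at [atan t] and not at [- pi / 2]: by periodicity its limit
   is the same, uniformly in [t] since [3 * (pi / 2)] bounds all sample points *)
have R1 : \sum_(k < N) V (p + k%:R * h) * h <= I + tau * pi.
    have := @riemann_sum_le _ V (- (pi / 2)) (3 * (pi / 2)) tau h p N cV (ltW h0).
    rewrite Nh seg_period//; [|exact: ltW|by rewrite (ltW t1) (ltW t2)].
    apply; [|exact: ltW|lra] => x y xx yx; apply: rhoP => //.
    exact: le_lt_trans hr.
  apply: (@le_trans _ _ (\prod_(x <- al) expR (2 * V (p + x)))).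
    apply: ler_prod => x _; rewrite W0/= /V mulrC divfK ?pnatr_eq0//.
    by rewrite lnK ?posrE ?ltr_wpDl// lerDl ltW.
  rewrite -expR_sum ler_expR big_map (_ : iota 0 N = index_iota 0 N) ?big_mkord; last first.
    by rewrite /index_iota subn0.
  rewrite -mulr_sumr -mulrA.
  rewrite ler_pM2l// -ler_pdivrMl ?divr_gt0// invf_div.
  by apply: le_trans R1; rewrite -/h -[leRHS]mulr_suml [leLHS]mulrC.
have := rotation_product_bound a1 hF FB B0 FD D0 (expR_ge0 _) WQ.
rewrite size_map size_iota => H.
have f0 : 0 < nc (F 2%:R) by rewrite normc_gt0.
have : ln (nc (F 2%:R) ^+ (2 * N)) <= ln (6 * Q).
  by rewrite ler_ln ?posrE ?exprn_gt0 ?mulr_gt0 ?expR_gt0.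
rewrite lnXn// lnM ?posrE ?expR_gt0// /Q expRK -[_ *+ (2 * N)%N]mulr_natl natrM => L.
have {}L : 2 * N%:R * (pi * ln (nc (F 2%:R))) <= pi * ln 6 + 2 * N%:R * (I + tau * pi).
  rewrite mulrCA; have := L; rewrite -(ler_pM2l p0) [X in _ <= X]mulrDr => L'.
  apply: le_trans L' _; rewrite lerD2l (_ : pi * _ = 2 * N%:R * (I + tau * pi))//.
  rewrite [LHS](_ : _ = (pi / pi) * (2 * N%:R * (I + tau * pi))); last by ring.
  by rewrite divff ?lt0r_neq0// mul1r.
have T : pi * ln 6 <= N%:R * tau by rewrite -ler_pdivrMr// ltW.
rewrite -(ler_pM2l (mulr_gt0 (ltr0n R 2) N0)); apply: (le_trans L).
rewrite (_ : I + tau * (1 + pi) = I + tau * pi + tau); last first.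
  by rewrite mulrDr mulr1 [tau + _]addrC addrA.
rewrite [leRHS]mulrDr addrC lerD2l -mulrA; apply: (le_trans T).
by rewrite ler_peMl ?ler1n// mulr_ge0// ltW.
Qed.

(** A regularization of the logarithm that is bounded below and yet tends to
    minus infinity at [x = 0] when [eta] tends to [0]; [ln] itself has
    [ln 0 = 0]. *)
Definition smooth_log (eta x : R) : R := ln (x ^+ 2 + eta) / 2.

Lemma smooth_log_bound (eta B x : R) : 0 < eta -> 0 <= x <= B ->
  `|smooth_log eta x| <= `|ln (B ^+ 2 + eta)| + `|ln eta|.
Proof.
move=> e0 /andP[x0 xB].
have h1 : ln eta <= ln (x ^+ 2 + eta).
  by rewrite ler_ln ?posrE ?ltr_wpDl ?sqr_ge0// lerDr sqr_ge0.
have h2 : ln (x ^+ 2 + eta) <= ln (B ^+ 2 + eta).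
  rewrite ler_ln ?posrE ?ltr_wpDl ?sqr_ge0// lerD2r.
  by rewrite ler_pXn2r// ?nnegrE// (le_trans x0).
have := ler_norm (ln (B ^+ 2 + eta)); have := ler_norm (- ln eta); rewrite normrN.
have := normr_ge0 (ln (B ^+ 2 + eta)); have := normr_ge0 (ln eta).
rewrite /smooth_log ler_norml; lra.
Qed.

Lemma continuous_smooth_log (eta : R) (g : R -> R) : 0 < eta -> continuous g ->
  continuous (fun t : R => smooth_log eta (g t)).
Proof.
move=> e0 cg t; apply: cvgM; last exact: cvg_cst.
apply: (@continuous_comp _ _ _ (fun p => g p ^+ 2 + eta) (@ln R)); last first.
  by apply: continuous_ln; rewrite ltr_wpDl// sqr_ge0.
apply: cvgD; last exact: cvg_cst.
by apply: (@continuous_comp _ _ _ g (fun x => x ^+ 2)); [exact: cg|exact: exprn_continuous].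
Qed.

(** Dividing [f] by [1 + k * w] produces the decay that [jensen_decaying] asks
    for; it lowers the modulus on [Re > 0], and costs only [ln (1 + 2 * k)] at
    the point [2]. *)
Lemma jensen_bounded (f : R[i] -> R[i]) (a B eta : R) : a < 1 -> hol f a ->
  (forall w, a < complex.Re w -> nc (f w) <= B) -> 0 < eta -> f 2%:R != 0 ->
  pi * ln (nc (f 2%:R)) <=
  \int[mu]_t (smooth_log eta (nc (f (1 +i* t))) * (1 + t ^+ 2)^-1).
Proof.
move=> a1 hf fB eta0 f20.
have B0 : 0 <= B.
  by apply: le_trans (normc_ge0 _) (fB 2%:R _); rewrite /=; lra.
have cf (f0 : R[i] -> R[i]) : hol f0 (Num.max a 0) -> continuous (fun t : R => nc (f0 (1 +i* t))).
  move=> hf0 t; apply: continuous_normc_vertical; apply: cderiv_ccont; apply: hf0.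
  by rewrite /= gt_max a1 ltr01.
have mi (f0 : R[i] -> R[i]) : hol f0 (Num.max a 0) -> (forall t, nc (f0 (1 +i* t)) <= B) ->
    mu.-integrable setT (EFin \o (fun t : R =>
      smooth_log eta (nc (f0 (1 +i* t))) * (1 + t ^+ 2)^-1)).
  move=> hf0 fB0; apply: (bounded_weight_integrable
    (K := `|ln (B ^+ 2 + eta)| + `|ln eta|)).
    apply: continuous_measurable_fun; apply: continuous_smooth_log => //.
    exact: cf.
  by move=> t; apply: smooth_log_bound => //; rewrite normc_ge0 fB0.
have hf' : hol f (Num.max a 0).
  by move=> w; rewrite gt_max => /andP[aw _]; exact: hf.
set I := Rintegral _ _ _.
suff small k : 0 < k -> pi * ln (nc (f 2%:R)) <= I + pi * (2 * k).
  apply/ler_addgt0Pl => e e0.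
  have k0 : 0 < e / (pi * 2) by rewrite divr_gt0// mulr_gt0// pi_gt0.
  have := small _ k0; rewrite mulrA [_ * (e / _)]mulrCA divff ?mulr1 1?addrC//.
  by rewrite lt0r_neq0// mulr_gt0// pi_gt0.
move=> k0.
pose den (w : R[i]) : R[i] := 1 + k%:C * w.
have Reden w : complex.Re (den w) = 1 + k * complex.Re w.
  by rewrite /den; case: w => x y /=; ring.
have Imden w : complex.Im (den w) = k * complex.Im w.
  by rewrite /den; case: w => x y /=; ring.
have den1 w : 0 < complex.Re w -> 1 <= nc (den w).
  move=> w0; apply: le_trans _ (Re_le_normc _); apply: le_trans _ (ler_norm _).
  by rewrite Reden lerDl mulr_ge0// ltW.
pose F w := f w / den w.
have hF : hol F (Num.max a 0).
  move=> w aw; apply: cderivM; first exact: hf'.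
  apply: cderivV.
    rewrite -normc_gt0 (lt_le_trans ltr01)// den1//.
    by move: aw; rewrite gt_max => /andP[].
  apply: cderivD; first exact: cderiv_cst.
  by apply: cderivM; [exact: cderiv_cst|exact: cderiv_id].
have Ff w : 0 < complex.Re w -> nc (F w) <= nc (f w).
  move=> w0; rewrite /F Normc.normcM Normc.normcV ler_pdivrMr; last first.
    exact: lt_le_trans ltr01 (den1 w w0).
  by rewrite ler_peMr ?normc_ge0// den1.
have a'1 : Num.max a 0 < 1 by rewrite gt_max a1 ltr01.
have FB w : Num.max a 0 < complex.Re w -> nc (F w) <= B.
  by rewrite gt_max => /andP[aw w0]; apply: le_trans (Ff w w0) (fB w aw).
have Re2 : complex.Re (2%:R : R[i]) = 2 by rewrite /=; ring.
have Im2 : complex.Im (2%:R : R[i]) = 0 by rewrite /=; ring.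
have FD t : nc (F (1 +i* t)) ^+ 2 * (1 + t ^+ 2) <= (B / k) ^+ 2.
  rewrite /F Normc.normcM Normc.normcV !exprMn !exprVn normc_sqr -normc_sqr.
  have d0 : 0 < nc (den (1 +i* t)) ^+ 2.
    by rewrite exprn_gt0// (lt_le_trans ltr01)// den1//=; lra.
  rewrite -mulrA; apply: ler_pM => //; rewrite ?sqr_ge0//.
  - by rewrite mulr_ge0 ?invr_ge0 ?sqr_ge0// addr_ge0// sqr_ge0.
  - by rewrite ler_pXn2r// ?nnegrE ?normc_ge0//; apply: fB.
  - rewrite mulrC ler_pdivrMr// mulrC ler_pdivlMr ?exprn_gt0//.
    rewrite normc_sqr Reden Imden /= mulr1.
    by have := sqr_ge0 k; have := mulr_ge0 (ler0n R 2) (ltW k0); rewrite exprMn; nra.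
have F20 : F 2%:R != 0.
  rewrite /F mulf_neq0// invr_eq0 -normc_gt0 (lt_le_trans ltr01)// den1//.
  by rewrite Re2; lra.
have Bk0 : 0 <= B / k by rewrite divr_ge0// ltW.
have J := jensen_decaying a'1 hF FB FD Bk0 eta0 F20.
have FI : \int[mu]_t (ln (nc (F (1 +i* t)) ^+ 2 + eta) / 2 * (1 + t ^+ 2)^-1) <= I.
  apply: le_Rintegral => //.
  - by apply: (mi F) => // t; apply: FB; rewrite /= a'1.
  - by apply: (mi f) => // t; apply: fB.
  - move=> t _; rewrite ler_wpM2r ?weight_ge0// /smooth_log ler_pM2r//.
    rewrite ler_ln ?posrE ?ltr_wpDl ?sqr_ge0// lerD2r.
    by rewrite ler_pXn2r// ?nnegrE ?normc_ge0//; apply: Ff; rewrite /=; lra.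
have d2 : nc (den 2%:R) = 1 + 2 * k.
  apply/eqP; rewrite -(eqrXn2 (n := 2))// ?normc_ge0//; last by lra.
  by rewrite normc_sqr Reden Imden Re2 Im2 mulr0 expr0n/= addr0 mulrC.
have := le_trans J FI.
rewrite /F Normc.normcM Normc.normcV d2 lnM ?posrE ?normc_gt0// ?invr_gt0; last by lra.
rewrite lnV ?posrE; last by lra.
have : ln (1 + 2 * k) <= 2 * k by apply: le_ln1Dx; lra.
rewrite -(ler_pM2l (pi_gt0 R)) mulrBr; lra.
Qed.

End jensen.

(** * Limits of truncated logarithms *)

Section lower_integral.
Import HBNNSimple.
Context {R : realType}.
Notation mu := (@lebesgue_measure R).

(** The integral of a nonnegative function is the supremum of the integrals of
    the simple functions below it, for measurable and nonmeasurable integrands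
    alike; erasing a simple function on a null set does not change its
    integral. *)
Lemma ae_le_lower_integral (f g : R -> \bar R) (N : set R) : measurable N -> mu N = 0 ->
  (forall t, 0 <= f t)%E -> (forall t, 0 <= g t)%E -> (forall t, ~ N t -> f t <= g t)%E ->
  (\int[mu]_t f t <= \int[mu]_t g t)%E.
Proof.
move=> mN N0 f0 g0 fg; rewrite !ge0_integralTE//.
apply: ge_ereal_sup => _ [h /= hf <-].
have mNC : measurable (~` N) by exact: measurableC.
apply: (@le_trans _ _ (sintegral mu (proj_nnsfun h mNC))); last first.
  apply: ereal_sup_ubound; exists (proj_nnsfun h mNC) => //= t.
  rewrite /mindic indicE; case: (pselect (N t)) => Nt.
    by rewrite memNset ?mulr0//= => /(_ Nt).
  by rewrite mem_set// mulr1; exact: le_trans (hf t) (fg t Nt).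
rewrite -!integralT_nnsfun.
rewrite (@ge0_negligible_integral _ _ _ mu setT N)//; last 2 first.
  exact/measurable_EFinP.
  by move=> t _; rewrite lee_fin.
rewrite setTD integral_mkcond; apply: ge0_le_integral => //.
- by move=> t _; rewrite patchE; case: ifP => // _; rewrite lee_fin.
- by apply/measurable_restrict => //; apply: measurable_funTS; exact/measurable_EFinP.
- exact/measurable_EFinP.
- by move=> t _; rewrite patchE /= /mindic indicE; case: ifP => _; rewrite ?mulr1 ?mulr0.
Qed.

Lemma limn_einf_le_near (u : (\bar R)^nat) (c : \bar R) :
  (\forall n \near \oo, u n <= c)%E -> (limn_einf u <= c)%E.
Proof.
move=> [N _ NP]; rewrite limn_einf_lim; apply: lime_le; first exact: is_cvg_einfs.
apply: nearW => n; apply: (@le_trans _ _ (u (maxn n N))).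
  by apply: ereal_inf_lbound; exists (maxn n N) => //=; exact: leq_maxl.
by apply: NP => /=; exact: leq_maxr.
Qed.

End lower_integral.

Section smooth_log_limits.
Context {R : realType}.

Variables (x : R^nat) (b : R).
Hypothesis xb : x n @[n --> \oo] --> b.

Let cvg_sqr_eps : x n ^+ 2 + eps n @[n --> \oo] --> b ^+ 2.
Proof.
rewrite -[X in _ --> X]addr0; apply: cvgD; last exact: cvg_eps.
exact: (cvg_comp _ _ xb (@exprn_continuous R 2 _)).
Qed.

Lemma cvg_smooth_log : 0 < b -> smooth_log (eps n) (x n) @[n --> \oo] --> ln b.
Proof.
move=> b0; have -> : ln b = ln (b ^+ 2) / 2 by rewrite lnXn// -[_ *+ 2]mulr_natr mulfK.
apply: cvgM; last exact: cvg_cst.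
by apply: (cvg_comp _ _ cvg_sqr_eps); apply: continuous_ln; rewrite exprn_gt0.
Qed.

Lemma smooth_log_Ny (A : R) : b = 0 -> \forall n \near \oo, smooth_log (eps n) (x n) <= A.
Proof.
move=> b0; have := cvg_sqr_eps; rewrite b0 expr0n/= => /cvgr0Pnorm_lt.
move=> /(_ (expR (2 * A)) (expR_gt0 _)); apply: filterS => n.
have y0 : 0 < x n ^+ 2 + eps n by rewrite ltr_wpDl ?sqr_ge0// eps_gt0.
rewrite gtr0_norm// => /ltW h; rewrite /smooth_log ler_pdivrMr// mulrC.
by rewrite -ler_expR lnK ?posrE.
Qed.

End smooth_log_limits.

Section log_limits.
Context {R : realType}.

Lemma cvg_maxr (u v : R^nat) (a b : R) : u n @[n --> \oo] --> a -> v n @[n --> \oo] --> b ->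
  Num.max (u n) (v n) @[n --> \oo] --> Num.max a b.
Proof.
move=> ua vb; rewrite maxr_absE; under eq_cvg do rewrite maxr_absE.
apply: cvgM; last exact: cvg_cst.
by apply: cvgD; [exact: cvgD|apply: cvg_norm; exact: cvgB].
Qed.

Lemma cvg_minr (u v : R^nat) (a b : R) : u n @[n --> \oo] --> a -> v n @[n --> \oo] --> b ->
  Num.min (u n) (v n) @[n --> \oo] --> Num.min a b.
Proof.
move=> ua vb; rewrite minr_absE; under eq_cvg do rewrite minr_absE.
apply: cvgM; last exact: cvg_cst.
by apply: cvgB; [exact: cvgD|apply: cvg_norm; exact: cvgB].
Qed.

Variables (x : R^nat) (b w : R).
Hypothesis xb : x n @[n --> \oo] --> b.
Hypothesis b0 : 0 <= b.
Hypothesis w0 : 0 < w.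

Lemma cvg_logm : ((Num.max 0 (- smooth_log (eps n) (x n)) * w)%:E @[n --> \oo] -->
   logm b * w%:E)%E.
Proof.
move: b0; rewrite le_eqVlt => /predU1P[be|bp].
  rewrite /logm -be le0_lneNy//= max_r ?leey// gt0_mulye ?lte_fin//.
  apply/cvgeyPge => A; have := smooth_log_Ny xb (- (A / w)) (esym be).
  apply: filterS => n h; rewrite lee_fin -ler_pdivrMr// le_max; apply/orP; right.
  by rewrite lerNr.
rewrite /logm lne_EFin// -EFinN -EFin_max -EFinM; apply: cvg_EFin; first exact: nearW.
apply: cvgM; last exact: cvg_cst.
by apply: cvg_maxr; [exact: cvg_cst|apply: cvgN; exact: cvg_smooth_log].
Qed.

(** At [b = 0] the positive part of [ln b] is right because [ln 0 = 0]. *)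
Lemma cvg_logp_min (K : R) : 0 <= K ->
  Num.min (Num.max 0 (smooth_log (eps n) (x n))) K * w @[n --> \oo] -->
  Num.min (Num.max 0 (ln b)) K * w.
Proof.
move=> K0; apply: cvgM; last exact: cvg_cst.
apply: cvg_minr; last exact: cvg_cst.
move: b0; rewrite le_eqVlt => /predU1P[be|bp].
  rewrite -be ln0// maxxx; have := smooth_log_Ny xb 0 (esym be).
  move=> h; apply: cvg_near_cst; apply: filterS h => n h.
  by apply/max_idPl.
by apply: cvg_maxr; [exact: cvg_cst|exact: cvg_smooth_log].
Qed.

Lemma logp_min_le (K : R) : ((Num.min (Num.max 0 (ln b)) K * w)%:E <= logp b * w%:E)%E.
Proof.
rewrite EFinM; apply: lee_wpmul2r; first by rewrite lee_fin ltW.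
apply: (@le_trans _ _ (Num.max 0 (ln b))%:E); first by rewrite lee_fin ge_min lexx.
rewrite /logp EFin_max; move: b0; rewrite le_eqVlt => /predU1P[<-|bp].
  by rewrite ln0// maxxx le_max lexx.
by rewrite lne_EFin.
Qed.

End log_limits.

Section log_mean_limit.
Context {R : realType}.
Notation mu := (@lebesgue_measure R).
Notation weight t := ((1 + t ^+ 2)^-1).

(** If [u] exceeds [K] then [u <= exp u <= exp (- K) * exp (2 * u)]: large
    logarithms are paid for by the mean square. *)
Lemma smooth_log_truncated (eta x K : R) : 0 < eta -> eta <= 1 -> 0 <= K ->
  Num.max 0 (smooth_log eta x) <=
  Num.min (Num.max 0 (smooth_log eta x)) K + expR (- K) * (x ^+ 2 + 1).
Proof.
move=> eta0 eta1 K0; set u := smooth_log eta x.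
have eK := expR_gt0 (- K).
have y0 : 0 < x ^+ 2 + eta by rewrite ltr_wpDl ?sqr_ge0.
case: (leP (Num.max 0 u) K) => uK.
  by rewrite lerDl mulr_ge0 ?(ltW eK)// addr_ge0// sqr_ge0.
have Ku : K < u by move: uK; rewrite lt_max ltNge K0.
rewrite (max_idPr _) ?(le_trans K0 (ltW Ku))//.
apply: (@le_trans _ _ (expR (- K) * expR (u + u))).
  rewrite -expRD; apply: (@le_trans _ _ (expR u)).
    by apply: le_trans (expR_ge1Dx u); rewrite lerDr.
  by rewrite ler_expR; lra.
rewrite -[leLHS]add0r lerD// ler_pM2l// /u /smooth_log -splitr lnK ?posrE//.
by rewrite lerD2l.
Qed.

Variables (phi : nat -> R -> R) (b : R -> R) (N : set R) (C l : R) (L : nat -> R).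
Hypothesis phi_cont : forall n, continuous (phi n).
Hypothesis phi_bound : forall n, exists B, forall t, 0 <= phi n t <= B.
Hypothesis phi_sqr : forall n, \int[mu]_t (phi n t ^+ 2 * weight t) <= C.
Hypothesis mN : measurable N.
Hypothesis N0 : mu N = 0.
Hypothesis phi_b : forall t, ~ N t -> phi n t @[n --> \oo] --> b t.
Hypothesis L_le : \forall n \near \oo,
  L n <= \int[mu]_t (smooth_log (eps n) (phi n t) * weight t).
Hypothesis L_l : L n @[n --> \oo] --> l.

Let u n t := smooth_log (eps n) (phi n t).
Let m n t := Num.max 0 (- u n t).
Let p n t := Num.max 0 (u n t).

Let cu n : continuous (u n).
Proof. by apply: continuous_smooth_log; [exact: eps_gt0|exact: phi_cont]. Qed.

Let ubound n : exists B, forall t, `|u n t| <= B.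
Proof.
have [B hB] := phi_bound n.
by eexists=> t; apply: smooth_log_bound; [exact: eps_gt0|exact: hB].
Qed.

Let mu_u n : measurable_fun setT (u n).
Proof. exact: continuous_measurable_fun. Qed.

Let mm n : measurable_fun setT (m n).
Proof. by apply: measurable_maxr => //; exact: measurable_funN. Qed.

Let mp n : measurable_fun setT (p n).
Proof. exact: measurable_maxr. Qed.

Let iu n : mu.-integrable setT (EFin \o (fun t => u n t * weight t)).
Proof. by have [B hB] := ubound n; exact: bounded_weight_integrable hB. Qed.

Let im n : mu.-integrable setT (EFin \o (fun t => m n t * weight t)).
Proof.
have [B hB] := ubound n; apply: (@bounded_weight_integrable _ _ B) => // t.
rewrite ger0_norm ?le_max ?lexx// ge_max (le_trans _ (hB t))//=.
by apply: le_trans (hB t); rewrite -normrN ler_norm.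
Qed.

Let ip n : mu.-integrable setT (EFin \o (fun t => p n t * weight t)).
Proof.
have [B hB] := ubound n; apply: (@bounded_weight_integrable _ _ B) => // t.
rewrite ger0_norm ?le_max ?lexx// ge_max (le_trans _ (hB t))//=.
by apply: le_trans (hB t); rewrite ler_norm.
Qed.

Let iq n K : 0 <= K ->
  mu.-integrable setT (EFin \o (fun t => Num.min (p n t) K * weight t)).
Proof.
move=> K0; apply: (@bounded_weight_integrable _ _ K) => [|t].
  by apply: measurable_minr => //; exact: measurable_cst.
by rewrite ger0_norm ?ge_min ?lexx ?orbT// le_min K0 andbT le_max lexx.
Qed.

Let iphi n : mu.-integrable setT (EFin \o (fun t => phi n t ^+ 2 * weight t)).
Proof.
have [B hB] := phi_bound n; apply: (@bounded_weight_integrable _ _ (B ^+ 2)) => [|t].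
  by apply: measurable_funX; exact: continuous_measurable_fun.
have /andP[h1 h2] := hB t.
by rewrite ger0_norm ?sqr_ge0// ler_pXn2r// ?nnegrE// (le_trans h1).
Qed.

Let i1 : mu.-integrable setT (EFin \o (fun t : R => 1 * weight t)).
Proof.
apply: (@bounded_weight_integrable _ _ 1) => [|t]; first exact: measurable_cst.
by rewrite normr1.
Qed.

(** The negative part is the positive part minus the function, and the positive
    part is truncated at the expense of a multiple of [expR (- K)]. *)
Lemma truncated_inequality n K : 0 <= K ->
  \int[mu]_t (m n t * weight t) <= \int[mu]_t (Num.min (p n t) K * weight t) +
    expR (- K) * (C + pi) - \int[mu]_t (u n t * weight t).
Proof.
move=> K0.
have -> : \int[mu]_t (m n t * weight t) =
    \int[mu]_t (p n t * weight t) - \int[mu]_t (u n t * weight t).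
  rewrite -RintegralB//; apply: eq_Rintegral => t _; rewrite -mulrBl; congr (_ * _).
  rewrite /m /p; case: (lerP 0 (u n t)) => u0.
    by rewrite (max_idPl _) ?oppr_le0// subrr.
  by rewrite (max_idPr _) ?sub0r// oppr_ge0 ltW.
rewrite lerD2r.
have iS : mu.-integrable setT (EFin \o (fun t => phi n t ^+ 2 * weight t + 1 * weight t)).
  exact: (integrableD measurableT (iphi n) i1).
have -> : expR (- K) * (C + pi) = expR (- K) * C + expR (- K) * pi by rewrite mulrDr.
apply: (@le_trans _ _ (\int[mu]_t (Num.min (p n t) K * weight t) +
    expR (- K) * \int[mu]_t (phi n t ^+ 2 * weight t + 1 * weight t))); last first.
  rewrite lerD2l -mulrDr ler_pM2l ?expR_gt0// RintegralD// lerD//.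
  rewrite le_eqVlt; apply/orP; left; apply/eqP; rewrite /Rintegral.
  by under eq_integral do rewrite mul1r; rewrite integral_poisson1.
have iZ : mu.-integrable setT (EFin \o (fun t => expR (- K) *
    (phi n t ^+ 2 * weight t + 1 * weight t))).
  exact: (integrableZl measurableT (expR (- K)) iS).
rewrite -RintegralZl// -RintegralD//; last exact: iq.
apply: le_Rintegral => //.
  exact: (integrableD measurableT (iq n K0) iZ).
move=> t _; rewrite -mulrDl mulrA -mulrDl ler_wpM2r ?weight_ge0//.
by apply: smooth_log_truncated; rewrite ?eps_gt0// (le_trans (eps_le _))//; lra.
Qed.

Let b0 t : ~ N t -> 0 <= b t.
Proof.
move=> Nt; rewrite -(cvg_lim _ (phi_b Nt))//; apply: limr_ge.
  by apply/cvg_ex; eexists; exact: phi_b.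
by apply: nearW => n; have [B /(_ t)/andP[]] := phi_bound n.
Qed.

Let w0 (t : R) : 0 < weight t.
Proof. by rewrite invr_gt0 ltr_pwDl// sqr_ge0. Qed.

(** The limit is written as an upper limit, which is measurable, whereas [b] is
    only known off the null set [N]. *)
Lemma truncated_limit K : 0 <= K -> exists2 F : R,
  \int[mu]_t (Num.min (p n t) K * weight t) @[n --> \oo] --> F &
  (F%:E <= \int[mu]_t (logp (b t) * (weight t)%:E))%E.
Proof.
move=> K0; pose f n t : \bar R := (Num.min (p n t) K * weight t)%:E.
have mf n : measurable_fun setT (f n).
  by apply/measurable_EFinP; have /measurable_int/measurable_EFinP := iq n K0.
pose F t := limn_esup (f ^~ t).
have fb t : ~ N t -> f ^~ t @ \oo --> (Num.min (Num.max 0 (ln (b t))) K * weight t)%:E.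
  by move=> Nt; apply: cvg_EFin; [exact: nearW|exact: (cvg_logp_min (w := weight t) (phi_b Nt) (b0 Nt) K0)].
have FE t : ~ N t -> F t = (Num.min (Num.max 0 (ln (b t))) K * weight t)%:E.
  by move=> Nt; rewrite /F (cvg_limn_einf_sup (fb _ Nt)).2.
have [] := @dominated_convergence _ _ _ mu setT measurableT f F
    (fun t => (K * weight t)%:E) mf _ _ _ _.
- exact: measurable_fun_limn_esup.
- exists N; split => // t /= h; apply: contrapT => Nt; apply: h => _.
  by rewrite FE//; exact: fb.
- apply: (@bounded_weight_integrable _ (cst K) K) => [|t]; first exact: measurable_cst.
  by rewrite ger0_norm.
- apply: aeW => t n _; rewrite /f abse_EFin lee_fin ger0_norm ?mulr_ge0 ?weight_ge0//.
    by rewrite ler_wpM2r ?weight_ge0// ge_min lexx orbT.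
  by rewrite le_min K0 andbT le_max lexx.
move=> iF _ cF; exists (fine (\int[mu]_t F t)).
  apply: fine_cvg; rewrite fineK//; exact: integrable_fin_num.
rewrite fineK; last exact: integrable_fin_num.
apply: (ae_le_lower_integral mN N0) => [t|t|t Nt].
- rewrite /F limn_esup_lim; apply: lime_ge; first exact: is_cvg_esups.
  apply: nearW => n; apply: (@le_trans _ _ (f n t)).
    by rewrite lee_fin mulr_ge0 ?weight_ge0// le_min K0 andbT le_max lexx.
  by apply: ereal_sup_ubound; exists n => /=.
- by rewrite mule_ge0 ?lee_fin ?weight_ge0// /logp le_max lexx.
- by rewrite FE//; exact: logp_min_le (b0 Nt) (w0 t) _.
Qed.

(** Fatou's lemma on the negative parts and dominated convergence on the
    truncated positive parts; the truncation error is uniform in [n] and vanishes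
    as [K] grows. *)
Lemma log_mean_limit : (\int[mu]_t (logm (b t) * (weight t)%:E) <=
  \int[mu]_t (logp (b t) * (weight t)%:E) - l%:E)%E.
Proof.
have C0 : 0 <= C.
  apply: le_trans (phi_sqr 0%N); apply: Rintegral_ge0 => t _.
  by rewrite mulr_ge0 ?sqr_ge0// weight_ge0.
have D0 : 0 < C + pi by rewrite ltr_wpDl// pi_gt0.
apply/lee_addgt0Pr => d d0.
pose K := (C + pi) * (2 / d); have K0 : 0 < K by rewrite mulr_gt0// divr_gt0.
(* [expR K >= K], and [K] was chosen to be [(C + pi) / (d / 2)] *)
have KD : expR (- K) * (C + pi) <= d / 2.
  rewrite expRN mulrC ler_pdivrMr ?expR_gt0//.
  apply: (@le_trans _ _ (d / 2 * K)).
    by rewrite /K mulrCA -[2 / d]invf_div divff ?mulr1// gt_eqF// divr_gt0.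
  rewrite ler_pM2l ?divr_gt0//; apply: le_trans (expR_ge1Dx K); lra.
have [F cF FP] := truncated_limit (ltW K0).
apply: (@le_trans _ _ (F - l + d)%:E); last first.
  by rewrite EFinD EFinB leeD2r// leeB.
apply: (@le_trans _ _ (\int[mu]_t limn_einf (fun n => (m n t * weight t)%:E))%E).
  apply: (ae_le_lower_integral mN N0) => [t|t|t Nt].
  - by rewrite mule_ge0 ?lee_fin ?weight_ge0// /logm le_max lexx.
  - rewrite limn_einf_lim; apply: lime_ge; first exact: is_cvg_einfs.
    apply: nearW => n; apply: le_ereal_inf_tmp => _ [k _ <-].
    by rewrite lee_fin mulr_ge0 ?weight_ge0// le_max lexx.
  - by rewrite (cvg_limn_einf_sup (cvg_logm (phi_b Nt) (b0 Nt) (w0 t))).1.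
apply: le_trans (fatou mu measurableT _ _) _.
- by move=> n; have /measurable_int := im n.
- by move=> n t _; rewrite lee_fin mulr_ge0 ?weight_ge0// le_max lexx.
apply: limn_einf_le_near.
have d4 : 0 < d / 4 by rewrite divr_gt0.
have /cvgrPdist_lt/(_ _ d4) nF := cF.
have /cvgrPdist_lt/(_ _ d4) nL := L_l.
near=> n.
have h1 : `|F - \int[mu]_t (Num.min (p n t) K * weight t)| < d / 4 by near: n.
have h2 : `|l - L n| < d / 4 by near: n.
have h3 : L n <= \int[mu]_t (u n t * weight t) by near: n.
have h4 := truncated_inequality n (ltW K0).
rewrite -[X in (X <= _)%E]fineK; last exact: (integrable_fin_num measurableT (im n)).
rewrite lee_fin; apply: le_trans h4 _.
move: h1 h2; rewrite !ltr_norml => /andP[h1 _] /andP[_ h2].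
have arith (X Z U T F' l' d' : R) : Z <= d' / 2 -> - (d' / 4) < F' - X ->
    l' - T < d' / 4 -> T <= U -> X + Z - U <= F' - l' + d' by lra.
exact: arith KD h1 h2 h3.
Unshelve. all: by end_near.
Qed.

End log_mean_limit.

(** * The boundary logarithm inequality *)


Section boundary_logarithm.
Context {R : realType}.
Notation mu := (@lebesgue_measure R).
Notation nc := (@Normc.normc R).
Variables (psi : R[i] -> R[i]) (M : R).
Hypothesis hpsi : hol psi 1.
Hypothesis psiM : ul2 psi 1 M.

Let e n : R := eps n.
Let phi n t := nc (psi ((1 + e n) +i* t)).

Let shifted_hol n : hol (fun w => psi (w + (e n)%:C)) (1 - e n).
Proof. by move=> w wn; apply: cderiv_shift; apply: hpsi; rewrite Re_shift; lra. Qed.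

(** A shift to the right makes [psi] bounded: [poisson_sqr_bound] on a line at
    the fixed distance [e n / 4] bounds all values by the uniform local mean
    square. *)
Lemma shifted_bounded n : exists B, forall w,
  1 - e n / 2 < complex.Re w -> nc (psi (w + (e n)%:C)) <= B.
Proof.
have e0 : 0 < e n by exact: eps_gt0.
have p0 := pi_gt0 R.
pose d0 := e n / 4; have d00 : 0 < d0 by rewrite divr_gt0.
have M0 : 0 <= M.
  rewrite -lee_fin; apply: le_trans (psiM (x := 2) 0 _); last by lra.
  by apply: integral_ge0 => t _; rewrite lee_fin exprn_ge0// normc_ge0.
pose A := 6 * ((2 + 2 / d0 ^+ 2) * M).
have d1 : 0 <= 2 / d0 ^+ 2 by rewrite divr_ge0// sqr_ge0.
have A0 : 0 <= A by rewrite mulr_ge0// mulr_ge0// addr_ge0.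
exists (A + 1) => w wn; set z := w + _.
have rz : complex.Re z = complex.Re w + e n by rewrite Re_shift.
pose c := complex.Re z - d0.
have c1 : 1 < c by rewrite /c rz /d0; lra.
have cz : c < complex.Re z by rewrite /c; lra.
have := poisson_sqr_bound hpsi psiM c1 cz.
have -> : complex.Re z - c = d0 by rewrite /c; ring.
have h := ul2_poisson (complex.Im z) hpsi psiM c1 d00.
have : (6%:E * \int[mu]_t (nc (psi (c +i* t)) ^+ 2 * poisson d0 (t - complex.Im z))%:E <=
   6%:E * ((2 + 2 / d0 ^+ 2) * M * pi)%:E)%E by apply: lee_wpmul2l.
move=> h2 h1; have := le_trans h1 h2; rewrite -EFinM lee_fin mulrA ler_pM2r// => h3.
have : nc (psi z) ^+ 2 <= (A + 1) ^+ 2.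
  by apply: le_trans h3 _; rewrite -/A expr2; nra.
by rewrite ler_pXn2r// nnegrE ?normc_ge0// addr_ge0.
Qed.

Let phi_shift n t : phi n t = nc (psi (1 +i* t + (e n)%:C)).
Proof. by rewrite complex_shiftE. Qed.

Let phi_bound n : exists B, forall t, 0 <= phi n t <= B.
Proof.
have [B hB] := shifted_bounded n; exists B => t.
rewrite phi_shift normc_ge0 hB//=.
by have := @eps_gt0 R n; rewrite /e; lra.
Qed.

Let phi_cont n : continuous (phi n).
Proof.
move=> t; apply: continuous_normc_vertical; apply: cderiv_ccont; apply: hpsi.
by rewrite /= ltrDl eps_gt0.
Qed.

Let phi_sqr n : \int[mu]_t (phi n t ^+ 2 * (1 + t ^+ 2)^-1) <= 4 * M * pi.
Proof.
have e1 : 1 < 1 + e n by rewrite ltrDl eps_gt0.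
have h := ul2_poisson 0 hpsi psiM e1 ltr01.
have E : (\int[mu]_t (phi n t ^+ 2 * (1 + t ^+ 2)^-1)%:E <= (4 * M * pi)%:E)%E.
  rewrite (_ : 4 = 2 + 2 / 1 ^+ 2 :> R); last by rewrite expr1n divr1; ring.
  apply: le_trans h; rewrite le_eqVlt; apply/orP; left; apply/eqP.
  by apply: eq_integral => t _; rewrite /poisson subr0 expr1n div1r.
rewrite /Rintegral; set I := (\int[mu]_t _)%E in E *.
have I0 : (0 <= I)%E.
  by apply: integral_ge0 => t _; rewrite lee_fin mulr_ge0 ?sqr_ge0// weight_ge0.
by move: I0 E; case: I => //= r; rewrite !lee_fin.
Qed.

Let phi_lim (N : set R) : (forall t, ~ N t -> has_boundary_value psi t) ->
  forall t, ~ N t -> phi n t @[n --> \oo] --> nc (boundary_value psi t).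
Proof.
move=> hN t /hN /cvg_rightP H; apply/cvgrPdist_lt => d /H[r r0 rP].
have := @cvg_eps R => /cvgr0Pnorm_lt/(_ _ r0); apply: filterS => n.
rewrite gtr0_norm ?eps_gt0// => nr.
rewrite distrC; apply: le_lt_trans (normc_lipschitz _ _) _.
by apply: rP; rewrite ?ltrDl ?eps_gt0// ltrD2l.
Qed.

Let cvg_two : nc (psi (2%:R + (e n)%:C)) @[n --> \oo] --> nc (psi 2%:R).
Proof.
have /hpsi/cderiv_ccont/ccontP c2 : 1 < complex.Re (2%:R : R[i]) by rewrite /=; lra.
apply/cvgrPdist_lt => d /c2[r r0 rP].
have := @cvg_eps R => /cvgr0Pnorm_lt/(_ _ r0); apply: filterS => n nr.
rewrite distrC; apply: le_lt_trans (normc_lipschitz _ _) _.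
by apply: rP; rewrite addrC addKr normc_real.
Qed.

(** [jensen_bounded] for the shifts [w |-> psi (w + e n)], with the
    regularization [e n], passes to the limit by [log_mean_limit]; the shifts do
    not vanish at [2] for large [n], by continuity. *)
Lemma boundary_log_inequality : psi 2%:R != 0 ->
  (\int[mu]_t (logm (nc (boundary_value psi t)) * ((1 + t ^+ 2)^-1)%:E) <=
   \int[mu]_t (logp (nc (boundary_value psi t)) * ((1 + t ^+ 2)^-1)%:E)
     - (pi * ln (nc (psi 2%:R)))%:E)%E.
Proof.
move=> psi2; have n2 : 0 < nc (psi 2%:R) by rewrite normc_gt0.
have [N [mN N0 sN]] := ae_has_boundary_value hpsi psiM.
have hN t : ~ N t -> has_boundary_value psi t.
  by move=> Nt; apply: contrapT => h; apply: Nt; exact: sN.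
apply: (@log_mean_limit _ phi _ N _ _ (fun n => pi * ln (nc (psi (2%:R + (e n)%:C))))
  phi_cont phi_bound phi_sqr mN N0 (phi_lim hN)); last first.
  apply: cvgM; first exact: cvg_cst.
  by apply: (cvg_comp _ _ cvg_two); exact: continuous_ln.
have near_pos : \forall n \near \oo, 0 < nc (psi (2%:R + (e n)%:C)).
  exact: cvgr_gt _ cvg_two _ n2.
apply: filterS near_pos => n n0.
have [B hB] := shifted_bounded n.
have e0 : 0 < e n by exact: eps_gt0.
have a1 : 1 - e n / 2 < 1 by lra.
have hf : hol (fun w => psi (w + (e n)%:C)) (1 - e n / 2).
  by move=> w wn; apply: shifted_hol; lra.
have f2 : psi (2%:R + (e n)%:C) != 0 by rewrite -normc_gt0.
have := jensen_bounded a1 hf hB e0 f2.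
by congr (_ <= _); apply: eq_Rintegral => t _; rewrite phi_shift.
Qed.

End boundary_logarithm.

Theorem lemma6 (R : realType) (psi : R[i] -> R[i])
  (psi_holo : holomorphic_on [set s : R[i] | 1 < complex.Re s] psi)
  (psi_bound :
    (ereal_sup [set (\int[lebesgue_measure]_(t in `[0%R, 1%R])
                       ((Normc.normc (psi (s + 0 +i* t)) ^+ 2)%:E))%E
               | s in [set s : R[i] | (1 < complex.Re s)%R]] < +oo)%E)
  (psi2 : psi 2%:R != 0) :
  {ae lebesgue_measure, forall t : R, has_boundary_value psi t} /\
  (\int[lebesgue_measure]_t
      (logm (Normc.normc (boundary_value psi t)) * ((1 + t ^+ 2)^-1)%:E)
   <= \int[lebesgue_measure]_t
      (logp (Normc.normc (boundary_value psi t)) * ((1 + t ^+ 2)^-1)%:E)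
      - (pi * ln (Normc.normc (psi 2%:R)))%:E)%E.
Proof.
have hpsi : hol psi 1 by move=> w w1; apply: derivable_cderiv; exact: psi_holo.
move: psi_bound; set S := [set _ | _ in _] => Sfin.
have I0 (x t : R) : (0 <= \int[lebesgue_measure]_(u in `[0%R, 1%R])
    (Normc.normc (psi (x +i* (t + u))) ^+ 2)%:E)%E.
  by apply: integral_ge0 => u _; rewrite lee_fin exprn_ge0// normc_ge0.
have SI (x t : R) : 1 < x -> (\int[lebesgue_measure]_(u in `[0%R, 1%R])
    (Normc.normc (psi (x +i* (t + u))) ^+ 2)%:E <= ereal_sup S)%E.
  move=> x1; apply: ereal_sup_ubound; exists (x +i* t) => //.
  apply: eq_integral => u _; congr ((Normc.normc (psi _) ^+ 2)%:E).
  by apply/eqP; rewrite eq_complex /= addr0 !eqxx.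
have psiM : ul2 psi 1 (fine (ereal_sup S)).
  move=> x t x1; rewrite fineK ?SI// ge0_fin_numE//.
  by apply: le_trans (SI 2 0 _); [exact: I0|lra].
split; first exact: ae_has_boundary_value hpsi psiM.
exact: boundary_log_inequality hpsi psiM psi2.
Qed.
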